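(* Let $k$ be a commutative ring, $G$ a finite group, $H$ a subgroup of $G$, and $\mathfrak{P}$ a nonempty collection of subgroups of $H$. Let $$\mathfrak{X}=\{gP_1g^{-1}\cap P_2 \mid P_1,P_2\in\mathfrak{P},\ g\in G\setminus H\}.$$ Let $\mathcal{C}_G$ be either one of the categories of complexes $\mathbf{C}_G$ or one of the homotopy categories $\mathbf{K}_G$ listed in the context, and let $\mathcal{C}_H$ be the corresponding category for $H$. Then there are (mutually inverse) equivalences of categories $$\mathcal{I}:\frac{\mathfrak{P}\text{-}\mathbf{Proj}(\mathcal{C}_H)}{\mathfrak{X}\text{-}\mathbf{Proj}(\mathcal{C}_H)}\longrightarrow\frac{\mathfrak{P}\text{-}\mathbf{Proj}(\mathcal{C}_G)}{\mathfrak{X}\text{-}\mathbf{Proj}(\mathcal{C}_G)},\qquad \mathcal{R}:\frac{\mathfrak{P}\text{-}\mathbf{Proj}(\mathcal{C}_G)}{\mathfrak{X}\text{-}\mathbf{Proj}(\mathcal{C}_G)}\longrightarrow\frac{\mathfrak{P}\text{-}\mathbf{Proj}(\mathcal{C}_H)}{\mathfrak{X}\text{-}\mathbf{Proj}(\mathcal{C}_H)}$$ that are induced by the induction and restriction operations.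
   Context: Complexes. $\mathbf{Cpx}(kG)$ is the category of cochain complexes $\cdots\to X^n\to X^{n+1}\to\cdots$ of $kG$-modules and chain maps; $\mathbf{Cpx}^+,\mathbf{Cpx}^-,\mathbf{Cpx}^b$ are the full subcategories of complexes bounded above, bounded below, and both. $\mathbf{cpxFL}(kG)$ is the full subcategory of complexes all of whose terms are $kG$-modules of finite composition length, with bounded versions $\mathbf{cpxFL}^{+},\mathbf{cpxFL}^{-},\mathbf{cpxFL}^{b}$. Here $\otimes=\otimes_k$ with diagonal group action. Categories allowed. $\mathbf{C}_G$ is any one of $\mathbf{Cpx}(kG)$, $\mathbf{Cpx}^{*}(kG)$, $\mathbf{cpxFL}(kG)$, $\mathbf{cpxFL}^{*}(kG)$ with $*\in\{+,-,b\}$, and $\mathbf{C}_H$ is the same with $H$ in place of $G$. Let $V$ be a finitely generated $kG$-module that is free as a $k$-module. An exact sequence $E$ of complexes is term split if in each degree it is a split sequence of $kG$-modules; $V$-split if $V\otimes E$ is split as a sequence of complexes; $V$-term split if $V\otimes E$ is term split; term+$V$-split if it is both term split and $V$-split. For a class $\mathscr{E}$ of exact sequences, an object $P$ is $\mathscr{E}$-projective if $\mathrm{Hom}(P,-)$ sends every sequence in $\mathscr{E}$ to an exact sequence. Let $\mathbf{C}/\mathscr{E}\text{-}\mathbf{Proj}$ have the objects of $\mathbf{C}$ and the morphisms of $\mathbf{C}$ modulo those factoring through an $\mathscr{E}$-projective object. Then $\mathcal{K}(\mathbf{C})$, $\mathcal{K}_{V\text{-split}}(\mathbf{C})$, $\mathcal{K}_{V\text{-ts}}(\mathbf{C})$,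 $\mathcal{K}_{\mathrm{ts}+V\text{-split}}(\mathbf{C})$ denote this quotient for $\mathscr{E}$ the class of term split (this gives the usual homotopy category), $V$-split, $V$-term split, and term+$V$-split sequences in $\mathbf{C}$, respectively. $\mathbf{K}_G$ is one of these four for $\mathbf{C}=\mathbf{C}_G$, and $\mathbf{K}_H$ is the corresponding one for $\mathbf{C}_H$, with $V$ replaced by its restriction $V_{\downarrow H}$. Relative projectivity. For a collection $\mathfrak{U}$ of subgroups of $H$, an object of $\mathcal{C}_G$ is $\mathfrak{U}$-projective if it is a direct summand of a direct sum of objects induced from objects of $\mathcal{C}_P$, $P\in\mathfrak{U}$ (equivalently, a direct summand of $V_{\mathfrak{U}}\otimes Y$ for some $Y$, where $V_{\mathfrak{U}}=\bigoplus_{P\in\mathfrak{U}}k_P^{\uparrow G}$); similarly for $\mathcal{C}_H$, with induction to $H$. $\mathfrak{U}\text{-}\mathbf{Proj}(\mathcal{C})$ is the full subcategory of $\mathfrak{U}$-projective objects. The quotients displayed have the objects of the numerator and morphisms modulo those factoring through an object of the denominator. Functors. $\mathcal{I}$ is induced by $X\mapsto X^{\uparrow G}=kG\otimes_{kH}X$. $\mathcal{R}$ is restriction to $H$ followed by the equivalence that discards $\mathfrak{Y}$-projective summands, where $\mathfrak{Y}=\{gPg^{-1}\cap H\mid P\in\mathfrak{P},\ g\in G\setminus H\}$ (the restriction of a $\mathfrak{P}$-projective object need not be $\mathfrak{P}$-projective, but modulo $\mathfrak{Y}$-projective objects it agrees with one). *)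

(* Defs.v *)
From HB Require Import structures.
From mathcomp Require Import all_boot all_order all_algebra all_fingroup.
From mathcomp Require Import boolp.

Set Implicit Arguments.
Unset Strict Implicit.
Unset Printing Implicit Defensive.

Import GRing.Theory.
Local Open Scope ring_scope.
Local Open Scope quotient_scope.
Local Obligation Tactic := idtac.

Record category := Category {
  obj :> Type;
  hom : obj -> obj -> zmodType;
  idm : forall X, hom X X;
  comp : forall X Y Z, hom Y Z -> hom X Y -> hom X Z;
  compA : forall X Y Z W (h : hom Z W) (g : hom Y Z) (f : hom X Y),
    comp h (comp g f) = comp (comp h g) f;
  comp1m : forall X Y (f : hom X Y), comp (idm Y) f = f;
  compm1 : forall X Y (f : hom X Y), comp f (idm X) = f;
  compDl : forall X Y Z (g g' : hom Y Z) (f : hom X Y),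
    comp (g + g') f = comp g f + comp g' f;
  compDr : forall X Y Z (g : hom Y Z) (f f' : hom X Y),
    comp g (f + f') = comp g f + comp g f'
}.
Arguments hom {c} X Y.
Arguments idm {c} X.
Arguments comp {c X Y Z} g f.

Notation "g \oc f" := (comp g f) (at level 40, left associativity).

Record functor (A B : category) := Functor {
  fobj :> A -> B;
  fmap : forall X Y, hom X Y -> hom (fobj X) (fobj Y);
  fmapD : forall X Y (f g : hom X Y), fmap (f + g) = fmap f + fmap g;
  fmap1 : forall X, fmap (idm X) = idm (fobj X);
  fmapM : forall X Y Z (g : hom Y Z) (f : hom X Y),
    fmap (g \oc f) = fmap g \oc fmap f
}.
Arguments fmap {A B} _ {X Y} _.

Section CategoryTheory.

Lemma comp0l (A : category) (X Y Z : A) (f : hom X Y) :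
  (0 : hom Y Z) \oc f = 0.
Proof. by apply: (addrI (0 \oc f)); rewrite -compDl !addr0. Qed.

Lemma comp0r (A : category) (X Y Z : A) (g : hom Y Z) :
  g \oc (0 : hom X Y) = 0.
Proof. by apply: (addrI (g \oc 0)); rewrite -compDr !addr0. Qed.

Lemma compNl (A : category) (X Y Z : A) (g : hom Y Z) (f : hom X Y) :
  (- g) \oc f = - (g \oc f).
Proof. by apply: (addrI (g \oc f)); rewrite -compDl !addrN comp0l. Qed.

Lemma compNr (A : category) (X Y Z : A) (g : hom Y Z) (f : hom X Y) :
  g \oc (- f) = - (g \oc f).
Proof. by apply: (addrI (g \oc f)); rewrite -compDr !addrN comp0r. Qed.

Lemma fmap0 (A B : category) (F : functor A B) (X Y : A) :
  fmap F (0 : hom X Y) = 0.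
Proof. by apply: (addrI (fmap F 0)); rewrite -fmapD !addr0. Qed.

Lemma fmapN (A B : category) (F : functor A B) (X Y : A) (f : hom X Y) :
  fmap F (- f) = - fmap F f.
Proof. by apply: (addrI (fmap F f)); rewrite -fmapD !addrN fmap0. Qed.

End CategoryTheory.

Definition functor_id (A : category) : functor A A :=
  @Functor A A id (fun X Y f => f)
    (fun _ _ _ _ => erefl) (fun _ => erefl) (fun _ _ _ _ _ => erefl).

Program Definition functor_comp (A B C : category)
    (F : functor B C) (F' : functor A B) : functor A C :=
  @Functor A C (fun X => F (F' X)) (fun X Y f => fmap F (fmap F' f)) _ _ _.
Next Obligation. by move=> * /=; rewrite !fmapD. Qed.
Next Obligation. by move=> * /=; rewrite !fmap1. Qed.
Next Obligation. by move=> * /=; rewrite !fmapM. Qed.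

Definition nat_iso (A B : category) (F F' : functor A B) : Prop :=
  exists (a : forall X, hom (F X) (F' X)) (b : forall X, hom (F' X) (F X)),
    [/\ forall X Y (f : hom X Y), a Y \oc fmap F f = fmap F' f \oc a X,
        forall X, b X \oc a X = idm (F X)
      & forall X, a X \oc b X = idm (F' X)].

Definition inverse_equivalences (A B : category)
    (F : functor A B) (F' : functor B A) : Prop :=
  nat_iso (functor_comp F' F) (functor_id A) /\
  nat_iso (functor_comp F F') (functor_id B).

Definition is_equivalence (A B : category) (F : functor A B) : Prop :=
  exists F' : functor B A, inverse_equivalences F F'.

Definition is_direct_sum (A : category) (I : Type) (Z : I -> A) (S : A)
    (iota : forall i, hom (Z i) S) : Prop :=
  forall (T : A) (f : forall i, hom (Z i) T),
    exists! u : hom S T, forall i, u \oc iota i = f i.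

Definition direct_summand (A : category) (X S : A) : Prop :=
  exists (X' : A) (i : hom X S) (p : hom S X) (i' : hom X' S) (p' : hom S X'),
    [/\ p \oc i = idm X, p' \oc i' = idm X'
      & i \oc p + i' \oc p' = idm S].

Definition split_sequence (A : category) (X Y Z : A)
    (f : hom X Y) (g : hom Y Z) : Prop :=
  exists (r : hom Y X) (s : hom Z Y),
    [/\ r \oc f = idm X, g \oc s = idm Z
      & f \oc r + s \oc g = idm Y].

Definition full_sub (A : category) (P : A -> Prop) : category :=
  @Category {X : A | P X} (fun X Y => hom (sval X) (sval Y))
    (fun X => idm (sval X)) (fun X Y Z g f => g \oc f)
    (fun _ _ _ _ => @compA A _ _ _ _) (fun _ _ => @comp1m A _ _)
    (fun _ _ => @compm1 A _ _) (fun _ _ _ => @compDl A _ _ _)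
    (fun _ _ _ => @compDr A _ _ _).

Definition full_sub_functor (A B : category) (F : functor A B)
    (P : A -> Prop) (P' : B -> Prop) (h : forall X, P X -> P' (F X)) :
    functor (full_sub P) (full_sub P') :=
  @Functor (full_sub P) (full_sub P')
    (fun X => exist P' (F (sval X)) (h _ (svalP X)))
    (fun X Y f => fmap F f)
    (fun _ _ => @fmapD _ _ F _ _) (fun _ => @fmap1 _ _ F _)
    (fun _ _ _ => @fmapM _ _ F _ _ _).

(* The additive subgroup of hom X Y generated by the morphisms factoring
   through an object of S.  When S is closed under finite direct sums, every
   finite sum of such morphisms is itself one. *)
Inductive factors (A : category) (S : A -> Prop) (X Y : A) : hom X Y -> Prop :=
| factors0 : factors S (0 : hom X Y)
| factorsD (f : hom X Y) (Z : A) (a : hom X Z) (b : hom Z Y) :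
    S Z -> factors S f -> factors S (f + b \oc a).

Section Quotient.
Variables (A : category) (S : A -> Prop).
Implicit Types X Y Z : A.

Lemma factors_add X Y (f g : hom X Y) :
  factors S f -> factors S g -> factors S (f + g).
Proof.
move=> hf; elim=> [|h Z a b SZ _ IH]; first by rewrite addr0.
by rewrite addrA; apply: factorsD.
Qed.

Lemma factors_opp X Y (f : hom X Y) : factors S f -> factors S (- f).
Proof.
elim=> [|h Z a b SZ _ IH]; first by rewrite oppr0; apply: factors0.
by rewrite opprD -compNl; apply: factorsD.
Qed.

Lemma factors_compl X Y Z (g : hom Y Z) (f : hom X Y) :
  factors S f -> factors S (g \oc f).
Proof.
elim=> [|h W a b SW _ IH]; first by rewrite comp0r; apply: factors0.
by rewrite compDr compA; apply: factorsD.
Qed.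

Lemma factors_compr X Y Z (g : hom Y Z) (f : hom X Y) :
  factors S g -> factors S (g \oc f).
Proof.
elim=> [|h W a b SW _ IH]; first by rewrite comp0l; apply: factors0.
by rewrite compDl -compA; apply: factorsD.
Qed.

Definition factors_pred X Y : hom X Y -> bool := fun f => `[< factors S f >].

Lemma factors_pred_closed X Y : zmod_closed (@factors_pred X Y).
Proof.
split=> [|f g /asboolP hf /asboolP hg]; apply/asboolP; first exact: factors0.
by apply: factors_add => //; apply: factors_opp.
Qed.

HB.instance Definition _ X Y := GRing.isZmodClosed.Build (hom X Y)
  (@factors_pred X Y) (@factors_pred_closed X Y).

Definition factors_ideal X Y : zmodClosed (hom X Y) :=
  GRing.ZmodClosed.clone (hom X Y) (@factors_pred X Y) _.

Definition quot_hom X Y : zmodType := Quotient.quot (factors_ideal X Y).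

Definition quot_pi X Y (f : hom X Y) : quot_hom X Y := \pi f.

Lemma quot_piP X Y (f g : hom X Y) :
  quot_pi f = quot_pi g <-> factors S (f - g).
Proof.
split=> [/eqP|h].
  by rewrite /quot_pi -Quotient.idealrBE => /asboolP.
by apply/eqP; rewrite /quot_pi -Quotient.idealrBE; apply/asboolP.
Qed.

Lemma quot_piD X Y (f g : hom X Y) : quot_pi (f + g) = quot_pi f + quot_pi g.
Proof. by rewrite /quot_pi !piE. Qed.

Definition quot_repr X Y (u : quot_hom X Y) : hom X Y :=
  generic_quotient.repr u.

Lemma quot_reprK X Y (u : quot_hom X Y) : quot_pi (quot_repr u) = u.
Proof. exact: reprK. Qed.

Definition quot_comp X Y Z (v : quot_hom Y Z) (u : quot_hom X Y) :
  quot_hom X Z := quot_pi (quot_repr v \oc quot_repr u).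

Lemma quot_compE X Y Z (g : hom Y Z) (f : hom X Y) :
  quot_comp (quot_pi g) (quot_pi f) = quot_pi (g \oc f).
Proof.
apply/quot_piP; set g' := quot_repr _; set f' := quot_repr _.
have hg : factors S (g' - g) by apply/quot_piP; rewrite /g' quot_reprK.
have hf : factors S (f' - f) by apply/quot_piP; rewrite /f' quot_reprK.
have -> : g' \oc f' - g \oc f = g' \oc (f' - f) + (g' - g) \oc f.
  by rewrite compDr compDl compNr compNl addrA subrK.
by apply: factors_add; [apply: factors_compl | apply: factors_compr].
Qed.

Program Definition quot : category :=
  @Category A quot_hom (fun X => quot_pi (idm X)) quot_comp _ _ _ _ _.
Next Obligation.
move=> X Y Z W h g f.
by rewrite -[h]quot_reprK -[g]quot_reprK -[f]quot_reprK !quot_compE compA.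
Qed.
Next Obligation.
by move=> X Y f; rewrite -[f]quot_reprK quot_compE comp1m.
Qed.
Next Obligation.
by move=> X Y f; rewrite -[f]quot_reprK quot_compE compm1.
Qed.
Next Obligation.
move=> X Y Z g g' f; rewrite -[g]quot_reprK -[g']quot_reprK -[f]quot_reprK.
by rewrite -quot_piD !quot_compE -quot_piD compDl.
Qed.
Next Obligation.
move=> X Y Z g f f'; rewrite -[g]quot_reprK -[f]quot_reprK -[f']quot_reprK.
by rewrite -quot_piD !quot_compE -quot_piD compDr.
Qed.

End Quotient.

Section QuotientFunctor.
Variables (A B : category) (F : functor A B) (S : A -> Prop) (S' : B -> Prop).
Hypothesis h : forall X, S X -> S' (F X).

Lemma fmap_factors (X Y : A) (f : hom X Y) :
  factors S f -> factors S' (fmap F f).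
Proof.
elim=> [|g Z a b SZ _ IH]; first by rewrite fmap0; apply: factors0.
by rewrite fmapD fmapM; apply: factorsD => //; apply: h.
Qed.

Definition quot_fmap (X Y : A) (u : quot_hom S X Y) : quot_hom S' (F X) (F Y) :=
  quot_pi S' (fmap F (quot_repr u)).

Lemma quot_fmapE (X Y : A) (f : hom X Y) :
  quot_fmap (quot_pi S f) = quot_pi S' (fmap F f).
Proof.
apply/quot_piP; rewrite -fmapN -fmapD; apply: fmap_factors.
by apply/quot_piP; rewrite quot_reprK.
Qed.

Program Definition quot_functor : functor (quot S) (quot S') :=
  @Functor (quot S) (quot S') F quot_fmap _ _ _.
Next Obligation.
move=> X Y f g; rewrite -[f]quot_reprK -[g]quot_reprK -quot_piD !quot_fmapE.
by rewrite fmapD quot_piD.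
Qed.
Next Obligation. by move=> X; rewrite /= quot_fmapE fmap1. Qed.
Next Obligation.
move=> X Y Z g f; rewrite -[f]quot_reprK -[g]quot_reprK /= quot_compE.
by rewrite !quot_fmapE quot_compE fmapM.
Qed.

End QuotientFunctor.

Definition subquot (A : category) (P S : A -> Prop) : category :=
  @quot (full_sub P) (fun X => S (sval X)).

Definition subquot_functor (A B : category) (F : functor A B)
    (P S : A -> Prop) (P' S' : B -> Prop)
    (hP : forall X, P X -> P' (F X)) (hS : forall X, S X -> S' (F X)) :
    functor (subquot P S) (subquot P' S') :=
  @quot_functor _ _ (full_sub_functor hP) _ _ (fun X => hS (sval X)).

Section Complexes.
Variable A : category.

Record complex := Complex {
  term :> int -> A;
  diff : forall n, hom (term n) (term (n + 1));
  diff2 : forall n, diff (n + 1) \oc diff n = 0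
}.

Record chain_map (X Y : complex) := ChainMap {
  cmap :> forall n, hom (X n) (Y n);
  cmapP : forall n, diff Y n \oc cmap n = cmap (n + 1) \oc diff X n
}.

Lemma chain_map_eq X Y (f g : chain_map X Y) : (forall n, f n = g n) -> f = g.
Proof.
case: f g => [f hf] [g hg] /= fg.
have {}fg : f = g by apply: functional_extensionality_dep.
by case: _ / fg in hg *; congr ChainMap; apply: Prop_irrelevance.
Qed.

Section Zmod.
Variables X Y : complex.

Program Definition chain_zero := @ChainMap X Y (fun n => 0) _.
Next Obligation. by move=> n; rewrite comp0l comp0r. Qed.
Program Definition chain_opp (f : chain_map X Y) :=
  @ChainMap X Y (fun n => - f n) _.
Next Obligation. by move=> f n; rewrite /= compNl compNr cmapP. Qed.
Program Definition chain_add (f g : chain_map X Y) :=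
  @ChainMap X Y (fun n => f n + g n) _.
Next Obligation. by move=> f g n; rewrite /= compDl compDr !cmapP. Qed.

HB.instance Definition _ := gen_eqMixin (chain_map X Y).
HB.instance Definition _ := gen_choiceMixin (chain_map X Y).

Lemma chain_addA : associative chain_add.
Proof. by move=> f g h; apply: chain_map_eq => n; apply: addrA. Qed.
Lemma chain_addC : commutative chain_add.
Proof. by move=> f g; apply: chain_map_eq => n; apply: addrC. Qed.
Lemma chain_add0 : left_id chain_zero chain_add.
Proof. by move=> f; apply: chain_map_eq => n; apply: add0r. Qed.
Lemma chain_addN : left_inverse chain_zero chain_opp chain_add.
Proof. by move=> f; apply: chain_map_eq => n; apply: addNr. Qed.

HB.instance Definition _ := GRing.isZmodule.Build (chain_map X Y)
  chain_addA chain_addC chain_add0 chain_addN.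
End Zmod.

Program Definition chain_id (X : complex) : chain_map X X :=
  @ChainMap X X (fun n => idm (X n)) _.
Next Obligation. by move=> X n; rewrite comp1m compm1. Qed.

Program Definition chain_comp (X Y Z : complex)
    (g : chain_map Y Z) (f : chain_map X Y) : chain_map X Z :=
  @ChainMap X Z (fun n => g n \oc f n) _.
Next Obligation. by move=> X Y Z g f n; rewrite compA cmapP -!compA cmapP. Qed.

Program Definition Cpx : category :=
  @Category complex (fun X Y => chain_map X Y) chain_id chain_comp _ _ _ _ _.
Next Obligation. by move=> *; apply: chain_map_eq => n; apply: compA. Qed.
Next Obligation. by move=> *; apply: chain_map_eq => n; apply: comp1m. Qed.
Next Obligation. by move=> *; apply: chain_map_eq => n; apply: compm1. Qed.
Next Obligation. by move=> *; apply: chain_map_eq => n; apply: compDl. Qed.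
Next Obligation. by move=> *; apply: chain_map_eq => n; apply: compDr. Qed.

End Complexes.

Section ComplexFunctor.
Variables (A B : category) (F : functor A B).

Program Definition cpx_fobj (X : complex A) : complex B :=
  @Complex B (fun n => F (X n)) (fun n => fmap F (diff X n)) _.
Next Obligation. by move=> X n; rewrite /= -fmapM diff2 fmap0. Qed.

Program Definition cpx_fmap (X Y : complex A) (f : chain_map X Y) :
  chain_map (cpx_fobj X) (cpx_fobj Y) :=
  @ChainMap B (cpx_fobj X) (cpx_fobj Y) (fun n => fmap F (f n)) _.
Next Obligation. by move=> X Y f n; rewrite /= -!fmapM cmapP. Qed.

Program Definition cpx_functor : functor (Cpx A) (Cpx B) :=
  @Functor (Cpx A) (Cpx B) cpx_fobj cpx_fmap _ _ _.
Next Obligation. by move=> *; apply: chain_map_eq => n; apply: fmapD. Qed.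
Next Obligation. by move=> *; apply: chain_map_eq => n; apply: fmap1. Qed.
Next Obligation. by move=> *; apply: chain_map_eq => n; apply: fmapM. Qed.

End ComplexFunctor.

(* As for mx_representation, only the values of the action on D matter. *)
Record kmod (k : comPzRingType) (gT : finGroupType) (D : {group gT}) := Kmod {
  carrier :> lmodType k;
  act : gT -> carrier -> carrier;
  act_linear : forall g, g \in D -> linear (act g);
  act1 : forall x, act 1%g x = x;
  actM : forall g h, g \in D -> h \in D ->
    forall x, act (g * h)%g x = act g (act h x)
}.

Section Modules.
Variables (k : comPzRingType) (gT : finGroupType) (D : {group gT}).
Implicit Types M N : kmod k D.

Record khom M N := Khom {
  kfun :> M -> N;
  khom_linear : linear kfun;
  khom_act : forall g, g \in D -> forall x, kfun (act g x) = act g (kfun x)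
}.

Lemma khom_eq M N (f g : khom M N) : (forall x, f x = g x) -> f = g.
Proof.
case: f g => [f lf hf] [g lg hg] /= fg.
have {}fg : f = g by apply: functional_extensionality_dep.
by case: _ / fg in lg hg *; congr Khom; apply: Prop_irrelevance.
Qed.

Lemma linear_add (V W : lmodType k) (f : V -> W) : linear f ->
  {morph f : x y / x + y}.
Proof. by move=> lf x y; rewrite -[x in LHS]scale1r lf scale1r. Qed.

Lemma linear_zero (V W : lmodType k) (f : V -> W) : linear f -> f 0 = 0.
Proof. by move=> lf; apply: (addrI (f 0)); rewrite -linear_add // !addr0. Qed.

Lemma linear_scale (V W : lmodType k) (f : V -> W) : linear f ->
  forall a, {morph f : x / a *: x}.
Proof. by move=> lf a x; rewrite -[_ *: x]addr0 lf linear_zero // addr0. Qed.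

Lemma linear_opp (V W : lmodType k) (f : V -> W) : linear f ->
  {morph f : x / - x}.
Proof. by move=> lf x; rewrite -!scaleN1r linear_scale. Qed.

Section Zmod.
Variables M N : kmod k D.

Program Definition khom_zero := @Khom M N (fun x => 0) _ _.
Next Obligation. by move=> a x y /=; rewrite scaler0 addr0. Qed.
Next Obligation. by move=> g gD x; rewrite (linear_zero (act_linear gD)). Qed.
Program Definition khom_opp (f : khom M N) := @Khom M N (fun x => - f x) _ _.
Next Obligation. by move=> f a x y /=; rewrite khom_linear opprD scalerN. Qed.
Next Obligation.
by move=> f g gD x /=; rewrite khom_act // (linear_opp (act_linear gD)).
Qed.
Program Definition khom_add (f g : khom M N) :=
  @Khom M N (fun x => f x + g x) _ _.
Next Obligation.
by move=> f g a x y /=; rewrite !khom_linear addrACA scalerDr.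
Qed.
Next Obligation.
by move=> f g h hD x /=; rewrite !khom_act // (linear_add (act_linear hD)).
Qed.

HB.instance Definition _ := gen_eqMixin (khom M N).
HB.instance Definition _ := gen_choiceMixin (khom M N).

Lemma khom_addA : associative khom_add.
Proof. by move=> f g h; apply: khom_eq => x; apply: addrA. Qed.
Lemma khom_addC : commutative khom_add.
Proof. by move=> f g; apply: khom_eq => x; apply: addrC. Qed.
Lemma khom_add0 : left_id khom_zero khom_add.
Proof. by move=> f; apply: khom_eq => x; apply: add0r. Qed.
Lemma khom_addN : left_inverse khom_zero khom_opp khom_add.
Proof. by move=> f; apply: khom_eq => x; apply: addNr. Qed.

HB.instance Definition _ := GRing.isZmodule.Build (khom M N)
  khom_addA khom_addC khom_add0 khom_addN.
End Zmod.

Definition khom_id M : khom M M :=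
  @Khom M M id (fun _ _ _ => erefl) (fun _ _ _ => erefl).

Program Definition khom_comp (M N L : kmod k D) (g : khom N L) (f : khom M N) :
    khom M L :=
  @Khom M L (fun x => g (f x)) _ _.
Next Obligation. by move=> M N L g f a x y /=; rewrite !khom_linear. Qed.
Next Obligation. by move=> M N L g f h hD x /=; rewrite !khom_act. Qed.

Program Definition Mod : category :=
  @Category (kmod k D) (fun M N => khom M N) khom_id khom_comp _ _ _ _ _.
Next Obligation. by move=> *; apply: khom_eq. Qed.
Next Obligation. by move=> *; apply: khom_eq. Qed.
Next Obligation. by move=> *; apply: khom_eq. Qed.
Next Obligation. by move=> *; apply: khom_eq. Qed.
Next Obligation.
by move=> X Y Z g f f'; apply: khom_eq => x; apply: (linear_add (khom_linear g)).
Qed.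

Definition zero_module M : Prop := forall x : M, x = 0.

Definition submodule M (S : M -> Prop) : Prop :=
  [/\ S 0, forall x y, S x -> S y -> S (x + y),
      forall a x, S x -> S (a *: x)
    & forall g, g \in D -> forall x, S x -> S (act g x)].

(* S' / S is simple, in terms of the submodules between S and S'. *)
Definition simple_factor M (S S' : M -> Prop) : Prop :=
  [/\ forall x, S x -> S' x, exists2 x, S' x & ~ S x
    & forall T, submodule T -> (forall x, S x -> T x) ->
        (forall x, T x -> S' x) ->
        (forall x, T x -> S x) \/ (forall x, S' x -> T x)].

Definition finite_length M : Prop :=
  exists (n : nat) (S : nat -> M -> Prop),
    [/\ forall i, submodule (S i), forall x, S 0%N x -> x = 0, forall x, S n x
      & forall i, (i < n)%N -> simple_factor (S i) (S i.+1)].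

Definition finitely_generated M : Prop :=
  exists (n : nat) (v : 'I_n -> M), forall x : M,
    exists a : 'I_n -> gT -> k, x = \sum_(i < n) \sum_(g in D) a i g *: act g (v i).

End Modules.

Arguments Mod k {gT} D.

Definition free_module (k : comPzRingType) (M : lmodType k) : Prop :=
  exists (I : choiceType) (e : I -> M),
    (forall x : M, exists (s : seq I) (a : I -> k), x = \sum_(i <- s) a i *: e i) /\
    (forall (s : seq I) (a : I -> k), uniq s ->
       \sum_(i <- s) a i *: e i = 0 -> forall i, i \in s -> a i = 0).

Section Restriction.
Variables (k : comPzRingType) (gT : finGroupType) (G H : {group gT}).
Hypothesis sHG : H \subset G.

Definition resM (M : kmod k G) : kmod k H :=
  @Kmod k gT H M (@act _ _ _ M) (fun g gH => act_linear (subsetP sHG g gH))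
    (@act1 _ _ _ M)
    (fun g h gH hH => actM (subsetP sHG g gH) (subsetP sHG h hH)).

Definition res_khom (M N : kmod k G) (f : khom M N) : khom (resM M) (resM N) :=
  @Khom k gT H (resM M) (resM N) f (khom_linear f)
    (fun g gH => khom_act f (subsetP sHG g gH)).

Program Definition res : functor (Mod k G) (Mod k H) :=
  @Functor (Mod k G) (Mod k H) resM res_khom _ _ _.
Next Obligation. by move=> *; apply: khom_eq. Qed.
Next Obligation. by move=> *; apply: khom_eq. Qed.
Next Obligation. by move=> *; apply: khom_eq. Qed.

End Restriction.

(* P acts on A on the right through ra and on N on the left through la.
   Elements of the tensor product are formal sums of pure tensors, that is,
   sequences of pairs, modulo the k-linear congruence teq generated by
   bilinearity and by (a h, x) = (a, h x) for h in P.  For P = set0 this is the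
   tensor product over k, and for P a group it is the one over kP. *)
Section TensorProduct.
Variables (k : comPzRingType) (gT : finGroupType) (P : {set gT}).
Variables (A N : lmodType k) (ra : gT -> A -> A) (la : gT -> N -> N).

Definition tscale_seq (c : k) : seq (A * N) -> seq (A * N) :=
  map (fun p => (c *: p.1, p.2)).

Inductive teq : seq (A * N) -> seq (A * N) -> Prop :=
| teq_refl s : teq s s
| teq_sym s t : teq s t -> teq t s
| teq_trans s t u : teq s t -> teq t u -> teq s u
| teq_cat s s' t t' : teq s s' -> teq t t' -> teq (s ++ t) (s' ++ t')
| teq_scale c s t : teq s t -> teq (tscale_seq c s) (tscale_seq c t)
| teq_catC s t : teq (s ++ t) (t ++ s)
| teq_0 x : teq [:: (0, x)] [::]
| teq_Dl a a' x : teq [:: (a + a', x)] [:: (a, x); (a', x)]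
| teq_Dr a x x' : teq [:: (a, x + x')] [:: (a, x); (a, x')]
| teq_Z c a x : teq [:: (c *: a, x)] [:: (a, c *: x)]
| teq_bal h a x : h \in P -> teq [:: (ra h a, x)] [:: (a, la h x)].

Definition teqb (s t : seq (A * N)) : bool := `[< teq s t >].

Lemma teqb_equiv : equiv_class_of teqb.
Proof.
split=> [s|s t|t s u]; first by apply/asboolP; apply: teq_refl.
  by apply/asboolP/asboolP; apply: teq_sym.
by move=> /asboolP st /asboolP tu; apply/asboolP; apply: teq_trans tu.
Qed.

Canonical teqb_equiv_rel := EquivRelPack teqb_equiv.

Definition tens : Type := {eq_quot teqb}.
HB.instance Definition _ := Choice.on tens.

Definition tpi (s : seq (A * N)) : tens := \pi_({eq_quot teqb}) s.
Definition trepr (u : tens) : seq (A * N) :=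
  generic_quotient.repr (u : {eq_quot teqb}).

Lemma treprK u : tpi (trepr u) = u.
Proof. exact: reprK. Qed.

Lemma tpiP s t : tpi s = tpi t <-> teq s t.
Proof.
split=> [/eqmodP /asboolP //|st].
by apply/eqmodP; apply/asboolP.
Qed.

Lemma trepr_pi s : teq (trepr (tpi s)) s.
Proof. by apply/tpiP; rewrite treprK. Qed.

Definition tzero : tens := tpi [::].
Definition tadd (u v : tens) : tens := tpi (trepr u ++ trepr v).
Definition tscale (c : k) (u : tens) : tens := tpi (tscale_seq c (trepr u)).

Lemma taddE s t : tadd (tpi s) (tpi t) = tpi (s ++ t).
Proof. by apply/tpiP; apply: teq_cat; apply: trepr_pi. Qed.

Lemma tscaleE c s : tscale c (tpi s) = tpi (tscale_seq c s).
Proof. by apply/tpiP; apply: teq_scale; apply: trepr_pi. Qed.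

Lemma tscale_seqA c d s : tscale_seq c (tscale_seq d s) = tscale_seq (c * d) s.
Proof.
by rewrite /tscale_seq -map_comp; apply: eq_map => p /=; rewrite scalerA.
Qed.

Lemma tscale_seq1 s : tscale_seq 1 s = s.
Proof. by rewrite -[RHS]map_id; apply: eq_map => -[a x] /=; rewrite scale1r. Qed.

Lemma teq_interleave p q s t :
  teq ([:: p; q] ++ (s ++ t)) ((p :: s) ++ (q :: t)).
Proof.
rewrite -[p :: s]cat1s -[q :: t]cat1s -[[:: p; q]]cat1s -!catA.
apply: teq_cat; first exact: teq_refl.
by rewrite !catA; apply: teq_cat; [apply: teq_catC | apply: teq_refl].
Qed.

Lemma tscale_seqDl c d s :
  teq (tscale_seq (c + d) s) (tscale_seq c s ++ tscale_seq d s).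
Proof.
elim: s => [|[a x] s IH] /=; first exact: teq_refl.
apply: teq_trans (teq_interleave _ _ _ _).
rewrite -cat1s; apply: teq_cat IH.
by rewrite scalerDl; apply: teq_Dl.
Qed.

Lemma tscale_seq0 s : teq (tscale_seq 0 s) [::].
Proof.
elim: s => [|[a x] s IH] /=; first exact: teq_refl.
by rewrite scale0r -cat1s -[[::]]cats0; apply: teq_cat => //; apply: teq_0.
Qed.

Lemma taddA : associative tadd.
Proof.
move=> u v w; rewrite -[u]treprK -[v]treprK -[w]treprK.
by rewrite !taddE catA.
Qed.
Lemma taddC : commutative tadd.
Proof.
move=> u v; rewrite -[u]treprK -[v]treprK !taddE.
by apply/tpiP; apply: teq_catC.
Qed.
Lemma tadd0 : left_id tzero tadd.
Proof. by move=> u; rewrite -[u]treprK taddE. Qed.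
Lemma taddN : left_inverse tzero (tscale (- 1)) tadd.
Proof.
move=> u; rewrite -[u]treprK tscaleE taddE; apply/tpiP.
rewrite -[X in _ ++ X]tscale_seq1.
apply: (teq_trans (teq_sym (tscale_seqDl _ _ _))).
by rewrite addNr; apply: tscale_seq0.
Qed.

HB.instance Definition _ := GRing.isZmodule.Build tens taddA taddC tadd0 taddN.

Lemma tscaleA c d u : tscale c (tscale d u) = tscale (c * d) u.
Proof. by rewrite -[u]treprK !tscaleE tscale_seqA. Qed.
Lemma tscale1 : left_id 1 tscale.
Proof. by move=> u; rewrite -[u]treprK tscaleE tscale_seq1. Qed.
Lemma tscaleDr : right_distributive tscale +%R.
Proof.
move=> c u v; rewrite -[u]treprK -[v]treprK -[LHS]/(tscale c (tadd _ _)).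
by rewrite -[RHS]/(tadd _ _) taddE !tscaleE taddE /tscale_seq map_cat.
Qed.
Lemma tscaleDl u : {morph tscale^~ u : c d / c + d}.
Proof.
move=> c d; rewrite -[u]treprK !tscaleE -[RHS]/(tadd _ _) taddE.
by apply/tpiP; apply: tscale_seqDl.
Qed.

HB.instance Definition _ := GRing.Zmodule_isLmodule.Build k tens
  tscaleA tscale1 tscaleDr tscaleDl.

Lemma tpiD s t : tpi (s ++ t) = tpi s + tpi t.
Proof. by rewrite -[RHS]/(tadd _ _) taddE. Qed.

Lemma tpiZ c s : tpi (tscale_seq c s) = c *: tpi s.
Proof. by rewrite -[RHS]/(tscale _ _) tscaleE. Qed.

End TensorProduct.

Section TensorMap.
Variables (k : comPzRingType) (gT : finGroupType) (P : {set gT}).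

Section Map.
Variables (A N A' N' : lmodType k).
Variables (ra : gT -> A -> A) (la : gT -> N -> N).
Variables (ra' : gT -> A' -> A') (la' : gT -> N' -> N').

Definition tmap_seq (f : A -> A') (h : N -> N') : seq (A * N) -> seq (A' * N') :=
  map (fun p => (f p.1, h p.2)).

(* The map f (x) h, meaningful when f and h are tensor_compatible. *)
Definition tmap (f : A -> A') (h : N -> N') (u : tens P ra la) :
    tens P ra' la' :=
  tpi P ra' la' (tmap_seq f h (trepr u)).

Definition tensor_compatible (f : A -> A') (h : N -> N') : Prop :=
  [/\ linear f, linear h,
      forall g, g \in P -> forall a, f (ra g a) = ra' g (f a)
    & forall g, g \in P -> forall x, h (la g x) = la' g (h x)].

Variables (f : A -> A') (h : N -> N').
Hypothesis fh : tensor_compatible f h.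

Lemma tmap_teq s t : teq P ra la s t ->
  teq P ra' la' (tmap_seq f h s) (tmap_seq f h t).
Proof.
have [lf lh cf ch] := fh.
have tscale_tmap c u : tmap_seq f h (tscale_seq c u) = tscale_seq c (tmap_seq f h u).
  rewrite /tmap_seq /tscale_seq -!map_comp; apply: eq_map => p /=.
  by rewrite (linear_scale lf).
elim=> {s t}.
- by move=> s; apply: teq_refl.
- by move=> s t _; apply: teq_sym.
- by move=> s t u _ st _ tu; apply: teq_trans tu.
- by move=> s s' t t' _ ss _ tt; rewrite /tmap_seq !map_cat; apply: teq_cat.
- by move=> c s t _ st; rewrite !tscale_tmap; apply: teq_scale.
- by move=> s t; rewrite /tmap_seq !map_cat; apply: teq_catC.
- by move=> x; rewrite /= (linear_zero lf); apply: teq_0.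
- by move=> a a' x; rewrite /= (linear_add lf); apply: teq_Dl.
- by move=> a x x'; rewrite /= (linear_add lh); apply: teq_Dr.
- by move=> c a x; rewrite /= (linear_scale lf) (linear_scale lh); apply: teq_Z.
- by move=> g a x gP; rewrite /= cf // ch //; apply: teq_bal.
Qed.

Lemma tmapE s : tmap f h (tpi P ra la s) = tpi P ra' la' (tmap_seq f h s).
Proof. by apply/tpiP; apply: tmap_teq; apply: trepr_pi. Qed.

Lemma tmap_linear : linear (tmap f h).
Proof.
have [lf lh cf ch] := fh.
move=> c u v; rewrite -[u]treprK -[v]treprK -tpiZ -tpiD !tmapE -tpiZ -tpiD.
congr tpi; rewrite /tmap_seq map_cat; congr (_ ++ _).
by rewrite /tscale_seq -!map_comp; apply: eq_map => p /=; rewrite (linear_scale lf).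
Qed.

End Map.
End TensorMap.

Arguments tmap {k gT P A N A' N' ra la ra' la'} f h u.
Arguments tensor_compatible {k gT} P {A N A' N'} ra la ra' la' f h.

Section TensorMapTheory.
Variables (k : comPzRingType) (gT : finGroupType) (P : {set gT}).
Variables (A1 N1 A2 N2 A3 N3 : lmodType k).
Variables (r1 : gT -> A1 -> A1) (l1 : gT -> N1 -> N1).
Variables (r2 : gT -> A2 -> A2) (l2 : gT -> N2 -> N2).
Variables (r3 : gT -> A3 -> A3) (l3 : gT -> N3 -> N3).

Lemma tmap_id (f : A1 -> A1) (h : N1 -> N1) (u : tens P r1 l1) :
  (forall a, f a = a) -> (forall x, h x = x) -> tmap f h u = u.
Proof.
move=> fE hE; rewrite -[RHS]treprK /tmap; congr tpi.
by rewrite -[RHS]map_id; apply: eq_map => -[a x] /=; rewrite fE hE.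
Qed.

Lemma tmap_comp (f : A1 -> A2) (h : N1 -> N2) (f' : A2 -> A3) (h' : N2 -> N3)
    (f'' : A1 -> A3) (h'' : N1 -> N3) (u : tens P r1 l1) :
  tensor_compatible P r2 l2 r3 l3 f' h' ->
  (forall a, f'' a = f' (f a)) -> (forall x, h'' x = h' (h x)) ->
  tmap f'' h'' u = tmap f' h' (tmap f h u : tens P r2 l2) :> tens P r3 l3.
Proof.
move=> c fE hE; rewrite [tmap f h u]/tmap tmapE // /tmap; congr tpi.
rewrite /tmap_seq -map_comp; apply: eq_map => p /=.
by rewrite fE hE.
Qed.

Lemma tmapDr (f : A1 -> A2) (h h' : N1 -> N2) (u : tens P r1 l1) :
  tmap f (fun x => h x + h' x) u = tmap f h u + tmap f h' u :> tens P r2 l2.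
Proof.
rewrite /tmap -tpiD; apply/tpiP.
elim: (trepr u) => [|[a x] s IH] /=; first exact: teq_refl.
apply: teq_trans (teq_interleave _ _ _ _ _ _ _).
by rewrite -cat1s; apply: teq_cat IH; apply: teq_Dr.
Qed.

End TensorMapTheory.

Section Diagonal.
Variables (k : comPzRingType) (gT : finGroupType) (D : {group gT}).
Variable V : kmod k D.

Definition diag_tens (X : kmod k D) : lmodType k :=
  tens (set0 : {set gT}) (fun _ (v : V) => v) (fun _ (x : X) => x).

Lemma diag_compatible (X Y : kmod k D) (f : V -> V) (h : X -> Y) :
  linear f -> linear h ->
  tensor_compatible (set0 : {set gT}) (fun _ (v : V) => v) (fun _ (x : X) => x)
    (fun _ (v : V) => v) (fun _ (y : Y) => y) f h.
Proof. by move=> lf lh; split=> // g; rewrite inE. Qed.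

Program Definition diagM (X : kmod k D) : kmod k D :=
  @Kmod k gT D (diag_tens X) (fun g => tmap (act g) (act g)) _ _ _.
Next Obligation.
move=> X g gD; apply: tmap_linear; apply: diag_compatible; exact: act_linear.
Qed.
Next Obligation. by move=> X u; apply: tmap_id => ?; apply: act1. Qed.
Next Obligation.
move=> X g h gD hD u; apply: tmap_comp => [|v|x]; last 2 first.
- exact: actM.
- exact: actM.
by apply: diag_compatible; apply: act_linear.
Qed.

Program Definition diag_khom (X Y : kmod k D) (f : khom X Y) :
    khom (diagM X) (diagM Y) :=
  @Khom k gT D (diagM X) (diagM Y) (tmap id f) _ _.
Next Obligation.
by move=> X Y f; apply: tmap_linear; apply: diag_compatible => //;
   apply: khom_linear.
Qed.
Next Obligation.
move=> X Y f g gD u /=.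
rewrite -(@tmap_comp _ _ _ _ _ _ _ _ _ _ _ _ _ _ _ (act g) (act g) id f
  (act g) (fun x => f (act g x))) //; last first.
  by apply: diag_compatible => //; apply: khom_linear.
apply: tmap_comp => [|v|x] //; last exact: khom_act.
by apply: diag_compatible; apply: act_linear.
Qed.

Program Definition diag : functor (Mod k D) (Mod k D) :=
  @Functor (Mod k D) (Mod k D) diagM diag_khom _ _ _.
Next Obligation. by move=> X Y f g; apply: khom_eq => u; apply: tmapDr. Qed.
Next Obligation. by move=> X; apply: khom_eq => u; apply: tmap_id. Qed.
Next Obligation.
move=> X Y Z g f; apply: khom_eq => u; apply: tmap_comp => //.
by apply: diag_compatible => //; apply: khom_linear.
Qed.

End Diagonal.

Section Induction.
Variables (k : comPzRingType) (gT : finGroupType) (P D : {group gT}).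

(* The group algebra kD as a k-module, with left and right translations:
   a : galg stands for the sum of the (a y) y, y in D.  The
   projection subg D is multiplicative on D; P is meant to be contained in D. *)
Definition galg : lmodType k := {ffun subg_of D -> k^o}.

Definition galg_l (g : gT) (a : galg) : galg :=
  [ffun y => a ((subg D g)^-1 * y)%g].
Definition galg_r (h : gT) (a : galg) : galg :=
  [ffun y => a (y * (subg D h)^-1)%g].

Lemma galg_l_linear g : linear (galg_l g).
Proof. by move=> c a b; apply/ffunP => y; rewrite !ffunE. Qed.

Lemma galg_lr g h a : galg_l g (galg_r h a) = galg_r h (galg_l g a).
Proof. by apply/ffunP => y; rewrite !ffunE mulgA. Qed.

Lemma galg_l1 a : galg_l 1 a = a.
Proof. by apply/ffunP => y; rewrite !ffunE morph1 invg1 mul1g. Qed.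

Lemma galg_lM g h a : g \in D -> h \in D ->
  galg_l (g * h) a = galg_l g (galg_l h a).
Proof.
by move=> gD hD; apply/ffunP => y; rewrite !ffunE morphM // invMg mulgA.
Qed.

Definition ind_tens (X : kmod k P) : lmodType k :=
  tens (P : {set gT}) galg_r (@act _ _ _ X).

Lemma ind_compatible (X Y : kmod k P) (f : galg -> galg) (h : X -> Y) :
  linear f -> (forall g a, f (galg_r g a) = galg_r g (f a)) ->
  linear h -> (forall g, g \in P -> forall x, h (act g x) = act g (h x)) ->
  tensor_compatible (P : {set gT}) galg_r (@act _ _ _ X)
    galg_r (@act _ _ _ Y) f h.
Proof. by move=> lf cf lh ch; split. Qed.

Program Definition indM (X : kmod k P) : kmod k D :=
  @Kmod k gT D (ind_tens X) (fun g => tmap (galg_l g) id) _ _ _.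
Next Obligation.
move=> X g gD; apply: tmap_linear; apply: ind_compatible => //.
  exact: galg_l_linear.
exact: galg_lr.
Qed.
Next Obligation. by move=> X u; apply: tmap_id => // a; apply: galg_l1. Qed.
Next Obligation.
move=> X g h gD hD u; apply: tmap_comp => // [|a]; last exact: galg_lM.
by apply: ind_compatible => //; [apply: galg_l_linear | apply: galg_lr].
Qed.

Program Definition ind_khom (X Y : kmod k P) (f : khom X Y) :
    khom (indM X) (indM Y) :=
  @Khom k gT D (indM X) (indM Y) (tmap id f) _ _.
Next Obligation.
by move=> X Y f; apply: tmap_linear; apply: ind_compatible => //;
   [apply: khom_linear | apply: khom_act].
Qed.
Next Obligation.
move=> X Y f g gD u /=.
rewrite -(@tmap_comp _ _ _ _ _ _ _ _ _ _ _ _ _ _ _ (galg_l g) id id f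
  (galg_l g) f) //; last first.
  by apply: ind_compatible => //; [apply: khom_linear | apply: khom_act].
apply: tmap_comp => //.
by apply: ind_compatible => //; [apply: galg_l_linear | apply: galg_lr].
Qed.

Program Definition ind : functor (Mod k P) (Mod k D) :=
  @Functor (Mod k P) (Mod k D) indM ind_khom _ _ _.
Next Obligation. by move=> X Y f g; apply: khom_eq => u; apply: tmapDr. Qed.
Next Obligation. by move=> X; apply: khom_eq => u; apply: tmap_id. Qed.
Next Obligation.
move=> X Y Z g f; apply: khom_eq => u; apply: tmap_comp => //.
by apply: ind_compatible => //; [apply: khom_linear | apply: khom_act].
Qed.

End Induction.

Arguments ind {k gT} P D.

Inductive boundedness := Unbounded | BoundedAbove | BoundedBelow | Bounded.

Inductive seq_class := TermSplit | VSplit | VTermSplit | TermAndVSplit.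

Section ComplexCategories.
Variables (k : comPzRingType) (gT : finGroupType) (D : {group gT}).
Implicit Types X Y Z : Cpx (Mod k D).

Definition bounded_above X : Prop :=
  exists N : int, forall n, N < n -> zero_module (X n).

Definition bounded_below X : Prop :=
  exists N : int, forall n, n < N -> zero_module (X n).

Definition has_bounds (b : boundedness) X : Prop :=
  match b with
  | Unbounded => True
  | BoundedAbove => bounded_above X
  | BoundedBelow => bounded_below X
  | Bounded => bounded_above X /\ bounded_below X
  end.

(* fl tells whether the terms are required to have finite length. *)
Definition allowed (fl : bool) (b : boundedness) X : Prop :=
  has_bounds b X /\ (fl -> forall n, finite_length (X n)).

Definition C_cat (fl : bool) (b : boundedness) : category :=
  full_sub (allowed fl b).

Definition short_exact X Y Z (f : hom X Y) (g : hom Y Z) : Prop :=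
  forall n : int,
    [/\ injective (f n), forall y, g n y = 0 <-> exists x, f n x = y
      & forall z, exists y, g n y = z].

Definition term_split X Y Z (f : hom X Y) (g : hom Y Z) : Prop :=
  forall n : int, @split_sequence (Mod k D) _ _ _ (f n) (g n).

Variable V : kmod k D.

Notation VT := (cpx_functor (diag V)).

Definition V_split X Y Z (f : hom X Y) (g : hom Y Z) : Prop :=
  split_sequence (fmap VT f) (fmap VT g).

Definition V_term_split X Y Z (f : hom X Y) (g : hom Y Z) : Prop :=
  term_split (fmap VT f) (fmap VT g).

Definition in_class (c : seq_class) X Y Z (f : hom X Y) (g : hom Y Z) : Prop :=
  short_exact f g /\
  match c with
  | TermSplit => term_split f g
  | VSplit => V_split f g
  | VTermSplit => V_term_split f g
  | TermAndVSplit => term_split f g /\ V_split f g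
  end.

Variables (fl : bool) (b : boundedness).

Definition E_projective (c : seq_class) (Q : C_cat fl b) : Prop :=
  forall (X Y Z : C_cat fl b) (f : hom X Y) (g : hom Y Z),
    @in_class c (sval X) (sval Y) (sval Z) f g ->
    [/\ injective (fun u : hom Q X => f \oc u),
        forall v : hom Q Y, g \oc v = 0 <-> exists u : hom Q X, f \oc u = v
      & forall w : hom Q Z, exists v : hom Q Y, g \oc v = w].

(* For o = Some TermSplit this is the usual homotopy category. *)
Definition CK_cat (o : option seq_class) : category :=
  match o with
  | None => C_cat fl b
  | Some c => quot (@E_projective c)
  end.

Definition CK_complex (o : option seq_class) : CK_cat o -> Cpx (Mod k D) :=
  match o return CK_cat o -> Cpx (Mod k D) with
  | None => fun X : C_cat fl b => sval X
  | Some c => fun X : C_cat fl b => sval X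
  end.

End ComplexCategories.

Arguments E_projective {k gT D} V fl b c Q.
Arguments CK_cat {k gT D} V fl b o.
Arguments CK_complex {k gT D V fl b o} X.

Section RelativeProjectivity.
Variables (k : comPzRingType) (gT : finGroupType) (D : {group gT}).
Variables (V : kmod k D) (fl : bool) (b : boundedness) (o : option seq_class).

(* CK_cat has the same objects for every o, so Y ranges over those of C_cat. *)
Definition induced_from (U : {set {group gT}}) (Z : CK_cat V fl b o) : Prop :=
  exists2 P : {group gT}, P \in U &
    exists Y : C_cat k P fl b, CK_complex Z = cpx_functor (ind P D) (sval Y).

Definition rel_projective (U : {set {group gT}}) (X : CK_cat V fl b o) : Prop :=
  exists (I : Type) (Z : I -> CK_cat V fl b o) (S : CK_cat V fl b o)
    (iota : forall i, hom (Z i) S),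
    [/\ forall i, induced_from U (Z i), is_direct_sum iota
      & direct_summand X S].

End RelativeProjectivity.

Arguments rel_projective {k gT D V fl b o} U X.

Section Descent.
Variables (k : comPzRingType) (gT : finGroupType) (D D' : {group gT}).
Variable F : functor (Cpx (Mod k D)) (Cpx (Mod k D')).
Variables (V : kmod k D) (V' : kmod k D').
Variables (fl : bool) (b : boundedness).

Record descends (o : option seq_class) : Prop := Descends {
  descends_C : forall X, allowed fl b X -> allowed fl b (F X);
  descends_K : forall c, o = Some c -> forall X : C_cat k D fl b,
    E_projective V fl b c X ->
    E_projective V' fl b c (full_sub_functor descends_C X)
}.

Definition CK_functor (o : option seq_class) :
    descends o -> functor (CK_cat V fl b o) (CK_cat V' fl b o) :=
  match o return descends o -> functor (CK_cat V fl b o) (CK_cat V' fl b o) with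
  | None => fun h => full_sub_functor (descends_C h)
  | Some c => fun h => quot_functor (descends_K h erefl)
  end.

End Descent.

(* In MathComp's convention P :^ g^-1 is g P g^-1. *)
Definition coll_X (gT : finGroupType) (G H : {group gT})
    (PP : {set {group gT}}) : {set {group gT}} :=
  [set Q : {group gT} | [exists P1 in PP, exists P2 in PP,
     exists g in G :\: H, Q == (P1 :^ g^-1 :&: P2)%G]].

Definition coll_Y (gT : finGroupType) (G H : {group gT})
    (PP : {set {group gT}}) : {set {group gT}} :=
  [set Q : {group gT} | [exists P in PP,
     exists g in G :\: H, Q == (P :^ g^-1 :&: H)%G]].

(* Main.v *)
(* Write Tr_Q^D for the relative trace.  An object of C_D is U-projective exactly
   when its identity is a sum of traces Tr_Q^D with Q in U, up to a map that
   factors through an E-projective object; the same description holds for the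
   ideal of maps factoring through U-projectives.  With it, Mackey's formula shows
   that, modulo X-projectives, induction is full and faithful on P-projectives,
   that a map between P-projectives of C_H which factors through a Y-projective
   factors through an X-projective, and that X -> Res Ind X is invertible modulo
   Y-projectives.  Dense image, for induction and for the inclusion of H-objects
   into the Y-quotient, amounts to splitting an idempotent modulo X-projectives:
   in the finite length case by Fitting's lemma, otherwise by an Eilenberg swindle
   with a countable direct sum. *)

From HB Require Import structures.
From mathcomp Require Import all_boot all_order all_algebra all_fingroup.
From mathcomp Require Import boolp functions.
Require Import Defs.

Set Implicit Arguments.
Unset Strict Implicit.
Unset Printing Implicit Defensive.

Import Order.TTheory GRing.Theory Num.Theory.
Local Open Scope ring_scope.
Local Obligation Tactic := idtac.

(** * Relative traces *)

(** Over an arbitrary k there is no Krull-Schmidt theorem, so objects are never cut into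
    indecomposables: an object is handled through its identity, and every statement is one about
    ideals of maps. The ideals live in [C_cat], as sums of traces plus maps that vanish in [CK_cat];
    one computation with actual chain maps then serves every value of [o]. Three obstacles shape the
    rest. A direct sum in [CK_cat] may be infinite and is a coproduct of the quotient only, so its
    identity becomes a finite sum of traces only after its summands are grouped by the finitely many
    members of U. Finite length over kH has to pass to kG and back; it is compared with finite
    length over k, expressed by rank functions on k-submodules. In an unbounded complex no single
    power of an endomorphism f need reach its Fitting decomposition in all degrees, so the inverse
    of f on the stable part is singled out by a relation on elements and glued by uniqueness. *)

Definition equivariant (k : comPzRingType) (gT : finGroupType)
    (P A B : {group gT}) (M : kmod k A) (N : kmod k B) (t : M -> N) : Prop :=
  forall g, g \in P -> forall x, t (act g x) = act g (t x).

Section ModuleTrace.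
Variables (k : comPzRingType) (gT : finGroupType) (A : {group gT}).
Implicit Types (D G H P Q : {group gT}) (M N L : kmod k A).

Lemma actJ M g h x : g \in A -> h \in A ->
  act (g * h)%g x = act g (act h x) :> M.
Proof. by move=> gA hA; rewrite actM. Qed.

Lemma actK M g : g \in A -> cancel (act g) (act g^-1 : M -> M).
Proof. by move=> gA x; rewrite -actJ ?groupV // mulVg act1. Qed.

Lemma actKV M g : g \in A -> cancel (act g^-1 : M -> M) (act g).
Proof. by move=> gA x; rewrite -actJ ?groupV // mulgV act1. Qed.

Lemma lin_sum (V W : lmodType k) (f : V -> W) (I : Type) (r : seq I)
  (S : pred I) (F : I -> V) : linear f ->
  f (\sum_(i <- r | S i) F i) = \sum_(i <- r | S i) f (F i).
Proof.
by move=> lf; apply: big_morph; [apply: linear_add | apply: linear_zero].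
Qed.

Lemma act_sum M g (I : Type) (r : seq I) (S : pred I) (F : I -> M) : g \in A ->
  act g (\sum_(i <- r | S i) F i) = \sum_(i <- r | S i) act g (F i).
Proof. by move=> gA; apply: lin_sum; apply: act_linear. Qed.

Definition conjt M N (t : M -> N) (g : gT) (x : M) : N :=
  act g (t (act g^-1 x)).

(** The choice of [repr C] in C is immaterial as soon as t is P-equivariant, see [conjt_repr]. *)
Definition tr D P M N (t : M -> N) (x : M) : N :=
  \sum_(C in lcosets P D) conjt t (repr C) x.

Lemma conjtM M N (t : M -> N) g h x : g \in A -> h \in A ->
  conjt t (g * h) x = conjt (conjt t h) g x.
Proof. by move=> gA hA; rewrite /conjt invMg !actJ ?groupV. Qed.


Lemma conjt_equi P M N (t : M -> N) g x : P \subset A -> equivariant P t ->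
  g \in P -> conjt t g x = t x.
Proof.
by move=> PA tP gP; rewrite /conjt -tP // actKV //; apply: (subsetP PA).
Qed.

Lemma conjt_eq M N (t t' : M -> N) g x :
  (forall x, t x = t' x) -> conjt t g x = conjt t' g x.
Proof. by move=> tt; rewrite /conjt tt. Qed.

Lemma conjt_repr P M N (t : M -> N) g x : P \subset A -> equivariant P t ->
  g \in A -> conjt t (repr (g *: P)%g) x = conjt t g x.
Proof.
move=> PA tP gA.
have [h hP ->] := lcosetP (mem_repr g (lcoset_refl P g)).
rewrite conjtM //; last exact: (subsetP PA).
by apply: conjt_eq => y; apply: (conjt_equi _ PA).
Qed.

Lemma conjt_lmul P M N (t : M -> N) h (C : {set gT}) x :
  P \subset A -> equivariant P t -> C \in lcosets P A -> h \in A ->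
  conjt t (repr (h *: C)%g) x = conjt (conjt t (repr C)) h x.
Proof.
move=> PA tP /lcosetsP[g gA ->] hA.
rewrite -lcosetM (conjt_repr _ PA) ?groupM // conjtM //.
by apply: conjt_eq => y; rewrite (conjt_repr _ PA).
Qed.

Lemma lcosetsS D P : D \subset A -> lcosets P D \subset lcosets P A.
Proof.
move=> DA; apply/subsetP => C /lcosetsP[g gD ->]; apply/lcosetsP.
by exists g => //; apply: (subsetP DA).
Qed.

Lemma lcosets_lmul D P h (C : {set gT}) : h \in D ->
  ((h *: C)%g \in lcosets P D) = (C \in lcosets P D).
Proof.
have imp g (B : {set gT}) : g \in D -> B \in lcosets P D -> (g *: B)%g \in lcosets P D.
  move=> gD /lcosetsP[x xD ->]; rewrite -lcosetM; apply/lcosetsP.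
  by exists (g * x)%g => //; apply: groupM.
move=> hD; apply/idP/idP; last exact: imp.
move=> hC; have -> : C = (h^-1 *: (h *: C))%g by rewrite lcosetK.
by apply: imp; rewrite ?groupV.
Qed.

(* The sum of the conjugates of t over a set Om of cosets of P that
   is stable under H is a trace from Q, as soon as Om fibres H-equivariantly
   over H / Q. *)
Lemma fiber_trace H Q P M N (t : M -> N) (Om : {set {set gT}})
    (p : {set gT} -> {set gT}) x :
  H \subset A -> Q \subset H -> P \subset A -> equivariant P t ->
  Om \subset lcosets P A ->
  (forall h C, h \in H -> C \in Om -> (h *: C)%g \in Om) ->
  (forall C, C \in Om -> p C \in lcosets Q H) ->
  (forall h C, h \in H -> C \in Om -> p (h *: C)%g = (h *: p C)%g) ->
  \sum_(C in Om) conjt t (repr C) x =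
  tr H Q (fun y => \sum_(C in Om | p C == Q) conjt t (repr C) y) x.
Proof.
move=> HA QH PA tP OmA OmH pQ pH.
rewrite (partition_big p (mem (lcosets Q H))) //=; apply: eq_bigr => K KQ.
set g := repr K.
have [h hH KE] := lcosetsP KQ.
have gh : g \in (h *: Q)%g by rewrite -KE (mem_repr h) // KE lcoset_refl.
have gK : (g *: Q)%g = K.
  by case/lcosetP: gh => y yQ ->; rewrite lcosetM lcoset_id.
have gH : g \in H.
  by case/lcosetP: gh => y yQ ->; rewrite groupM // (subsetP QH).
have gA := subsetP HA _ gH.
rewrite /conjt act_sum //.
rewrite (reindex_onto (fun C => (g *: C)%g) (fun C => (g^-1 *: C)%g)) /=; last first.
  by move=> C _; rewrite lcosetKV.
apply: eq_big => [C|C /andP[/andP[gCOm _] /eqP gC]].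
  rewrite lcosetK eqxx andbT.
  have -> : ((g *: C)%g \in Om) = (C \in Om).
    apply/idP/idP; last exact: OmH.
    by move/(OmH g^-1%g _ (groupVr gH)); rewrite lcosetK.
  case: (boolP (C \in Om)) => //= COm; rewrite pH // -{1}gK.
  by apply/eqP/eqP => [/(can_inj (lcosetK g))|->].
have COm : C \in Om by rewrite -gC; apply: OmH; rewrite ?groupV.
rewrite -[LHS]/(conjt _ _ _) (conjt_lmul _ PA) //.
by apply: (subsetP OmA).
Qed.


(** The map C |-> CH makes G/P fibre over G/H, and the fibre over H is H/P. *)
Lemma tr_trans G H P M N (t : M -> N) x :
  G \subset A -> H \subset G -> P \subset H -> equivariant P t ->
  tr G H (tr H P t) x = tr G P t x.
Proof.
move=> GA HG PH tP; have PG := subset_trans PH HG.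
have PA := subset_trans PG GA.
have pE g : ((g *: P) * H)%g = (g *: H)%g by rewrite -mulgA mulSGid.
rewrite [RHS]/tr (@fiber_trace G H P _ _ t _ (fun C => C * H)%g) //.
- apply: eq_bigr => K _; apply: conjt_eq => y.
  apply: eq_bigl => C; apply/idP/idP => [/lcosetsP[h hH ->]|].
    rewrite pE (lcoset_id hH) eqxx andbT.
    by apply/lcosetsP; exists h => //; apply: (subsetP HG).
  case/andP=> /lcosetsP[g gG ->]; rewrite pE => /eqP gH.
  by apply/lcosetsP; exists g; rewrite // -gH lcoset_refl.
- exact: lcosetsS.
- by move=> h C hG; rewrite lcosets_lmul.
- by move=> C /lcosetsP[g gG ->]; rewrite pE; apply/lcosetsP; exists g.
- by move=> h C _ _; rewrite -!mulgA.
Qed.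

(** The stabiliser of gP in H is H cap gPg^-1. It lies in Q, so hgP |-> hQ is a well-defined H-map
    from the orbit to H/Q, and its fibre over Q is the Q-orbit of gP. *)
Lemma orbit_trace G H Q P M N (t : M -> N) g :
  G \subset A -> H \subset G -> Q \subset H -> P \subset G -> equivariant P t ->
  g \in G -> (H :&: P :^ g^-1)%g \subset Q ->
  forall x, \sum_(C in [set (h *: (g *: P))%g | h in H]) conjt t (repr C) x =
  tr H Q (fun y => \sum_(C in [set (h *: (g *: P))%g | h in Q])
    conjt t (repr C) y) x.
Proof.
move=> GA HG QH PG tP gG HPQ x.
have HA := subset_trans HG GA; have PA := subset_trans PG GA.
(* As a set operation this makes sense for every C: for C = hgP, the part of Cg^-1 in H is h times
   the stabiliser, and Q absorbs the latter. *)
pose p (C : {set gT}) := (((C :* g^-1) :&: H) * Q)%g.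
have pE h : h \in H -> p (h *: (g *: P))%g = (h *: Q)%g.
  move=> hH; apply/setP => y; apply/mulsgP/lcosetP.
    case=> z q /setIP[zC zH] qQ ->; exists (h^-1 * z * q)%g; last first.
      by rewrite !mulgA mulgV mul1g.
    rewrite groupM // (subsetP HPQ) // inE groupM ?groupV //=.
    rewrite mem_conjg invgK conjgE; move: zC.
    by rewrite mem_rcoset invgK !mem_lcoset !mulgA.
  case=> q qQ ->; exists h q => //; rewrite inE hH andbT.
  by rewrite mem_rcoset invgK !mem_lcoset !mulgA mulgKV mulVg group1.
rewrite (@fiber_trace H Q P _ _ t _ p) //.
- apply: eq_bigr => K _; apply: conjt_eq => y; apply: eq_bigl => C.
  apply/idP/idP; last first.
    case/imsetP=> h hQ ->; rewrite pE ?(subsetP QH) // (lcoset_id hQ) eqxx andbT.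
    by apply: imset_f; apply: (subsetP QH).
  case/andP=> /imsetP[h hH ->]; rewrite pE // => /eqP hQ.
  by apply: imset_f; rewrite -hQ lcoset_refl.
- apply/subsetP => C /imsetP[h hH ->]; rewrite -lcosetM.
  apply/lcosetsP; exists (h * g)%g => //.
  by rewrite groupM // ?(subsetP HA _ hH) // (subsetP GA).
- move=> h C hH /imsetP[h' h'H ->]; apply/imsetP.
  by exists (h * h')%g; rewrite ?groupM // lcosetM.
- by move=> C /imsetP[h hH ->]; rewrite pE //; apply/lcosetsP; exists h.
- move=> h C hH /imsetP[h' h'H ->].
  by rewrite -[(h *: _)%g]lcosetM !pE ?groupM // lcosetM.
Qed.

Lemma tr_ext D P M N (t t' : M -> N) x :
  (forall x, t x = t' x) -> tr D P t x = tr D P t' x.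
Proof. by move=> tt; apply: eq_bigr => C _; apply: conjt_eq. Qed.

Lemma conjtD M N (t u : M -> N) g x : g \in A ->
  conjt (fun y => t y + u y) g x = conjt t g x + conjt u g x.
Proof. by move=> gA; rewrite /conjt (linear_add (act_linear gA)). Qed.

Lemma reprA D P (C : {set gT}) : D \subset A -> P \subset D ->
  C \in lcosets P D -> repr C \in D.
Proof.
move=> DA PD /lcosetsP[g gD ->].
have /lcosetP[h hP ->] := mem_repr g (lcoset_refl P g).
by rewrite groupM // (subsetP PD).
Qed.

Lemma tr_sum D P M N (I : Type) (r : seq I) (S : pred I) (t : I -> M -> N) x :
  D \subset A -> P \subset D ->
  tr D P (fun y => \sum_(i <- r | S i) t i y) x =
  \sum_(i <- r | S i) tr D P (t i) x.
Proof.
move=> DA PD; rewrite /tr exchange_big /=; apply: eq_bigr => C CD.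
by rewrite /conjt act_sum //; apply: (subsetP DA); apply: (reprA _ PD).
Qed.

Lemma trD D P M N (t u : M -> N) x : D \subset A -> P \subset D ->
  tr D P (fun y => t y + u y) x = tr D P t x + tr D P u x.
Proof.
move=> DA PD; rewrite /tr -big_split /=; apply: eq_bigr => C CD.
by rewrite conjtD //; apply: (subsetP DA); apply: (reprA _ PD).
Qed.

Lemma tr_compl D P M N L (t : M -> N) (u : N -> L) x :
  D \subset A -> P \subset D -> linear u -> equivariant D u ->
  u (tr D P t x) = tr D P (fun y => u (t y)) x.
Proof.
move=> DA PD lu uD; rewrite /tr lin_sum //; apply: eq_bigr => C CD.
by rewrite /conjt uD //; apply: (reprA _ PD).
Qed.

Lemma tr_compr D P M N L (t : N -> L) (u : M -> N) x :
  D \subset A -> P \subset D -> equivariant D u ->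
  tr D P t (u x) = tr D P (fun y => t (u y)) x.
Proof.
move=> DA PD uD; apply: eq_bigr => C CD.
by rewrite /conjt uD // groupV; apply: (reprA _ PD).
Qed.

Lemma conjt_linear M N (t : M -> N) g : g \in A -> linear t ->
  linear (conjt t g).
Proof.
move=> gA lt a x y; rewrite /conjt.
by rewrite (act_linear (groupVr gA)) lt (act_linear gA).
Qed.

Lemma tr_linear D P M N (t : M -> N) : D \subset A -> P \subset D ->
  linear t -> linear (tr D P t).
Proof.
move=> DA PD lt a x y; rewrite /tr scaler_sumr -big_split /=.
apply: eq_bigr => C CD; apply: conjt_linear => //.
by apply: (subsetP DA); apply: (reprA _ PD).
Qed.

Lemma coset_sum_equivariant H P M N (t : M -> N) (Om : {set {set gT}}) :
  H \subset A -> P \subset A -> equivariant P t -> Om \subset lcosets P A ->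
  (forall h C, h \in H -> C \in Om -> (h *: C)%g \in Om) ->
  equivariant H (fun x => \sum_(C in Om) conjt t (repr C) x).
Proof.
move=> HA PA tP OmA OmH g gH x; have gA := subsetP HA _ gH.
rewrite act_sum //.
rewrite (reindex_onto (fun C => g *: C)%g (fun C => g^-1 *: C)%g) /=; last first.
  by move=> C _; rewrite lcosetKV.
have OmE C : ((g *: C)%g \in Om) = (C \in Om).
  apply/idP/idP; last exact: OmH.
  by move/(OmH g^-1%g _ (groupVr gH)); rewrite lcosetK.
apply: eq_big => [C|C /andP[gC _]]; first by rewrite lcosetK eqxx andbT OmE.
rewrite (conjt_lmul _ PA) //; last by rewrite OmE in gC; apply: (subsetP OmA).
by rewrite /conjt actK.
Qed.

Lemma tr_equivariant D P M N (t : M -> N) : D \subset A -> P \subset D ->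
  equivariant P t -> equivariant D (tr D P t).
Proof.
move=> DA PD tP; apply: (coset_sum_equivariant (P := P)) => //.
- exact: subset_trans PD DA.
- exact: lcosetsS.
- by move=> h C hD; rewrite lcosets_lmul.
Qed.

End ModuleTrace.

(** * Degreewise maps of complexes and sums of traces *)

Notation cx k A := (complex (Mod k A)).

Definition dif (k : comPzRingType) (gT : finGroupType) (A : {group gT})
    (X : cx k A) (n : int) : X n -> X (n + 1) :=
  kfun (diff X n : khom (X n) (X (n + 1))).

Definition ev (k : comPzRingType) (gT : finGroupType) (A : {group gT})
    (X Y : cx k A) (f : chain_map X Y) (n : int) : X n -> Y n :=
  kfun (f n : khom (X n) (Y n)).

(* Degreewise maps between complexes over possibly different groups: only
   is_map says for which group they are chain maps. *)
Definition raw (k : comPzRingType) (gT : finGroupType) (A B : {group gT})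
    (X : cx k A) (Y : cx k B) : Type :=
  forall n : int, X n -> Y n.

Definition is_map (k : comPzRingType) (gT : finGroupType)
    (P A B : {group gT}) (X : cx k A) (Y : cx k B) (t : raw X Y) : Prop :=
  [/\ forall n, linear (@t n), forall n, equivariant P (@t n)
    & forall n x, t (n + 1) (dif x) = dif (t n x)].

Section RawMaps.
Variables (k : comPzRingType) (gT : finGroupType).
Implicit Types (A B D G H P Q : {group gT}).

Lemma dif_linear A (X : cx k A) n : linear (@dif k gT A X n).
Proof. exact: khom_linear. Qed.

Lemma dif0 A (X : cx k A) n : dif (0 : X n) = 0.
Proof. exact: (linear_zero (@dif_linear A X n)). Qed.

Lemma dif_sum A (X : cx k A) n (I : Type) (r : seq I) (S : pred I)
    (F : I -> X n) :
  dif (\sum_(i <- r | S i) F i) = \sum_(i <- r | S i) dif (F i).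
Proof. exact: (@lin_sum _ _ _ (@dif k gT A X n) _ _ _ _ (@dif_linear A X n)). Qed.

Lemma is_map_ev A P (X Y : cx k A) (f : chain_map X Y) :
  P \subset A -> is_map P (ev f).
Proof.
move=> PA; split=> [n|n g gP x|n x].
- exact: khom_linear.
- by apply: khom_act; apply: (subsetP PA).
- have E := cmapP f n.
  exact: (esym (congr1 (fun h : khom (X n) (Y (n + 1)) => kfun h x) E)).
Qed.

Lemma is_map_linear A (X Y : cx k A) (t : raw X Y) : is_map A t ->
  forall n, linear (@t n).
Proof. by case. Qed.

Lemma is_map_act A (X Y : cx k A) (t : raw X Y) : is_map A t ->
  forall n, equivariant A (@t n).
Proof. by case. Qed.

Lemma mkmap_subproof A (X Y : cx k A) (t : raw X Y) (ht : is_map A t) n :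
  diff Y n \oc (Khom (is_map_linear ht (n := n)) (is_map_act ht (n := n)) :
    hom (X n) (Y n)) =
  (Khom (is_map_linear ht (n := n + 1)) (is_map_act ht (n := n + 1)) :
    hom (X (n + 1)) (Y (n + 1))) \oc diff X n.
Proof. by have [_ _ dt] := ht; apply: khom_eq => x; apply: esym (dt n x). Qed.

Definition mkmap A (X Y : cx k A) (t : raw X Y) (ht : is_map A t) :
  chain_map X Y := ChainMap (mkmap_subproof ht).

Lemma mkmapE A (X Y : cx k A) (t : raw X Y) (ht : is_map A t) n x :
  ev (mkmap ht) x = t n x.
Proof. by []. Qed.

Lemma ev_eq A (X Y : cx k A) (f g : chain_map X Y) :
  (forall n (x : X n), ev f x = ev g x) -> f = g.
Proof. by move=> fg; apply: chain_map_eq => n; apply: khom_eq => x; apply: fg. Qed.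

Lemma is_map_comp P A B D (X : cx k A) (Y : cx k B) (Z : cx k D)
    (t : raw X Y) (u : raw Y Z) :
  is_map P t -> is_map P u -> is_map P (fun n x => u n (t n x)).
Proof.
move=> [lt et dt] [lu eu du]; split=> [n a x y|n g gP x|n x].
- by rewrite lt lu.
- by rewrite et // eu.
- by rewrite dt du.
Qed.

Lemma is_mapS P Q A B (X : cx k A) (Y : cx k B) (t : raw X Y) :
  Q \subset P -> is_map P t -> is_map Q t.
Proof.
move=> /subsetP QP [lt et dt]; split=> // n g /QP; exact: et.
Qed.

Lemma is_map_ext P A B (X : cx k A) (Y : cx k B) (t t' : raw X Y) :
  (forall n x, t' n x = t n x) -> is_map P t -> is_map P t'.
Proof.
move=> tt [lt et dt]; split=> [n a x y|n g gP x|n x].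
- by rewrite !tt lt.
- by rewrite !tt et.
- by rewrite !tt dt.
Qed.

Lemma is_map_sum P A B (X : cx k A) (Y : cx k B) (I : Type) (r : seq I)
    (S : pred I) (t : I -> raw X Y) : P \subset B ->
  (forall i, S i -> is_map P (t i)) ->
  is_map P (fun n x => \sum_(i <- r | S i) t i n x).
Proof.
move=> PB ht; split=> [n a x y|n g gP x|n x].
- rewrite scaler_sumr -big_split /=; apply: eq_bigr => i Si.
  by have [lt _ _] := ht i Si; rewrite lt.
- rewrite act_sum ?(subsetP PB) //; apply: eq_bigr => i Si.
  by have [_ et _] := ht i Si; rewrite et.
- rewrite dif_sum.
  by apply: eq_bigr => i Si; have [_ _ dt] := ht i Si; rewrite dt.
Qed.

Lemma is_mapD P A B (X : cx k A) (Y : cx k B) (t u : raw X Y) : P \subset B ->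
  is_map P t -> is_map P u -> is_map P (fun n x => t n x + u n x).
Proof.
move=> PB ht hu.
apply: (is_map_ext (t := fun n x => \sum_(b : bool) (if b then t else u) n x)).
  by move=> n x; rewrite big_bool.
by apply: is_map_sum => // -[].
Qed.

Definition rtr D P A (X Y : cx k A) (t : raw X Y) : raw X Y :=
  fun n => tr D P (@t n).

Lemma is_map_cosets H P A (X Y : cx k A) (t : raw X Y) (Om : {set {set gT}}) :
  H \subset A -> P \subset A -> is_map P t -> Om \subset lcosets P A ->
  (forall h C, h \in H -> C \in Om -> (h *: C)%g \in Om) ->
  is_map H (fun n x => \sum_(C in Om) conjt (@t n) (repr C) x).
Proof.
move=> HA PA [lt et dt] OmA OmH.
have cA C : C \in Om -> repr C \in A.
  by move=> /(subsetP OmA) CA; apply: (reprA _ PA CA).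
split=> [n a x y|n|n x].
- rewrite scaler_sumr -big_split /=; apply: eq_bigr => C /cA CA.
  exact: conjt_linear.
- exact: (coset_sum_equivariant (P := P)).
- rewrite dif_sum.
  apply: eq_bigr => C /cA CA.
  have dX (Z : cx k A) g (z : Z n) : g \in A -> dif (act g z) = act g (dif z).
    by move=> gA; apply: khom_act.
  by rewrite /conjt -dX ?groupV // dt -dX.
Qed.

Lemma is_map_rtr D P A (X Y : cx k A) (t : raw X Y) : D \subset A ->
  P \subset D -> is_map P t -> is_map D (rtr D P t).
Proof.
move=> DA PD tP; apply: (is_map_cosets (P := P)) => //.
- exact: subset_trans PD DA.
- exact: lcosetsS.
- by move=> h C hD; rewrite lcosets_lmul.
Qed.

(** One map per member of U is enough, since traces from the same group add up. *)
Definition trsum D (U : {set {group gT}}) A (X Y : cx k A) (t : raw X Y) :=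
  exists2 tt : {group gT} -> raw X Y, forall Q, Q \in U -> is_map Q (tt Q)
    & forall n x, t n x = \sum_(Q in U) rtr D Q (tt Q) x.
Arguments trsum D U {A X Y} t.

Lemma trsum_ext D U A (X Y : cx k A) (t t' : raw X Y) :
  (forall n x, t' n x = t n x) -> trsum D U t -> trsum D U t'.
Proof.
by move=> tt [u uP ut]; exists u => // n x; rewrite tt ut.
Qed.

Lemma tr0 D P A (M N : kmod k A) (x : M) : D \subset A -> P \subset D ->
  tr D P (fun _ => 0 : N) x = 0.
Proof.
move=> DA PD; rewrite /tr big1 // => C CD; rewrite /conjt.
by apply: linear_zero; apply: act_linear; apply: (subsetP DA); apply: (reprA _ PD).
Qed.

Lemma is_map0 P A B (X : cx k A) (Y : cx k B) : P \subset B ->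
  is_map P ((fun n _ => 0) : raw X Y).
Proof.
move=> PB; split=> [n a x y|n g gP x|n x]; first by rewrite scaler0 addr0.
  by rewrite (linear_zero (act_linear (subsetP PB _ gP))).
by rewrite dif0.
Qed.

Variables (D : {group gT}) (U : {set {group gT}}) (A : {group gT}).
Hypotheses (DA : D \subset A) (UD : forall Q, Q \in U -> Q \subset D).

Lemma trsum0 (X Y : cx k A) : trsum D U ((fun n _ => 0) : raw X Y).
Proof.
exists (fun _ n _ => 0) => [Q QU|n x].
  by apply: is_map0; apply: subset_trans (UD QU) DA.
by rewrite big1 // => Q QU; apply: tr0 => //; apply: UD.
Qed.

Lemma trsumD (X Y : cx k A) (t u : raw X Y) : trsum D U t -> trsum D U u ->
  trsum D U (fun n x => t n x + u n x).
Proof.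
case=> t' t'P tE [u' u'P uE]; exists (fun Q n x => t' Q n x + u' Q n x).
  move=> Q QU; apply: is_mapD; [|exact: t'P|exact: u'P].
  by apply: subset_trans (UD QU) DA.
move=> n x; rewrite tE uE -big_split /=; apply: eq_bigr => Q QU.
rewrite [RHS](trD _ _ _ DA) //. by apply: UD.
Qed.

Lemma trsum_sum (X Y : cx k A) (I : Type) (r : seq I) (S : pred I)
    (t : I -> raw X Y) : (forall i, S i -> trsum D U (t i)) ->
  trsum D U (fun n x => \sum_(i <- r | S i) t i n x).
Proof.
move=> tU; elim: r => [|i r IH].
  by apply: trsum_ext (trsum0 X Y) => n x; rewrite big_nil.
case: (boolP (S i)) => Si.
  apply: trsum_ext (trsumD (tU i Si) IH) => n x.
  by rewrite big_cons Si.
by apply: trsum_ext IH => n x; rewrite big_cons (negPf Si).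
Qed.

Lemma trsum_tr Q (X Y : cx k A) (t : raw X Y) : Q \in U -> is_map Q t ->
  trsum D U (rtr D Q t).
Proof.
move=> QU tQ; have QD := UD QU.
exists (fun P n x => if P == Q then t n x else 0) => [P PU|n x].
  case: eqP => [->//|_]; apply: is_map0; exact: subset_trans (UD PU) DA.
rewrite (bigD1 Q) //= big1 ?addr0 => [|P /andP[PU /negPf PQ]]; last first.
  by rewrite PQ; apply: tr0 => //; apply: UD.
by apply: tr_ext => y; rewrite eqxx.
Qed.

Lemma trsum_compl (X Y Z : cx k A) (t : raw X Y) (u : raw Y Z) :
  is_map D u -> trsum D U t -> trsum D U (fun n x => u n (t n x)).
Proof.
move=> uD [t' t'P tE]; have [lu eu du] := uD.
exists (fun P n x => u n (t' P n x)) => [P PU|n x].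
  by apply: is_map_comp (t'P P PU) _; apply: is_mapS uD; apply: UD.
rewrite tE lin_sum //; apply: eq_bigr => P PU.
by rewrite /rtr (tr_compl _ _ DA) // UD.
Qed.

Lemma trsum_compr (X Y Z : cx k A) (t : raw Y Z) (u : raw X Y) :
  is_map D u -> trsum D U t -> trsum D U (fun n x => t n (u n x)).
Proof.
move=> uD [t' t'P tE]; have [lu eu du] := uD.
exists (fun P n x => t' P n (u n x)) => [P PU|n x].
  by apply: is_map_comp _ (t'P P PU); apply: is_mapS uD; apply: UD.
rewrite tE; apply: eq_bigr => P PU.
by rewrite /rtr (tr_compr _ _ DA) // UD.
Qed.

Lemma trsum_is_map (X Y : cx k A) (t : raw X Y) : trsum D U t -> is_map D t.
Proof.
case=> t' t'P tE; apply: (is_map_ext tE); apply: is_map_sum => // P PU.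
by apply: is_map_rtr => //; [apply: UD | apply: t'P].
Qed.

Lemma trsum_trans G (X Y : cx k A) (t : raw X Y) : G \subset A ->
  D \subset G -> trsum D U t -> trsum G U (rtr G D t).
Proof.
move=> GA DG [t' t'P tE]; exists t' => // n x.
rewrite /rtr (tr_ext _ _ _ (tE n)) tr_sum //; apply: eq_bigr => P PU.
by rewrite [LHS]tr_trans ?UD //; have [] := t'P P PU.
Qed.

(** Tr_P^D = Tr_Q^D Tr_P^Q, so a trace from P is also one from any Q of U above P. *)
Lemma trsum_sub (U' : {set {group gT}}) (X Y : cx k A) (t : raw X Y) :
  (forall P, P \in U' -> exists2 Q, Q \in U & P \subset Q) ->
  trsum D U' t -> trsum D U t.
Proof.
move=> UU [t' t'P tE]; apply: trsum_ext tE _; apply: trsum_sum => P PU.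
have [Q QU PQ] := UU P PU; have [_ et _] := t'P P PU.
have QA := subset_trans (UD QU) DA.
apply: (trsum_ext (t := rtr D Q (rtr Q P (t' P)))).
  by move=> n x; rewrite [RHS]tr_trans // UD.
by apply: trsum_tr => //; apply: is_map_rtr => //; apply: t'P.
Qed.

(* Mackey's formula: the H-orbit of gP contributes a trace from the
   stabiliser of gP, which is H cap gPg^-1. *)
Lemma mackey G P (X Y : cx k A) (t : raw X Y) (Om : {set {set gT}}) :
  G \subset A -> D \subset G -> P \subset G -> is_map P t ->
  Om \subset lcosets P G ->
  (forall h C, h \in D -> C \in Om -> (h *: C)%g \in Om) ->
  (forall g, g \in G -> (g *: P)%g \in Om ->
     exists2 Q : {group gT}, Q \in U & (D :&: P :^ g^-1)%g \subset Q) ->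
  trsum D U (fun n x => \sum_(C in Om) conjt (@t n) (repr C) x).
Proof.
move=> GA DG PG tP OmG; have [_ et _] := tP.
have [m] := ubnP #|Om|; elim: m Om OmG => // m IH Om OmG cardOm OmD OmU.
have [->|[C0 C0Om]] := set_0Vmem Om.
  by apply: trsum_ext (trsum0 X Y) => n x; rewrite big_set0.
have [g gG gC0] := lcosetsP (subsetP OmG _ C0Om).
have [Q QU gQ] : exists2 Q : {group gT}, Q \in U & (D :&: P :^ g^-1)%g \subset Q.
  by apply: OmU; rewrite -?gC0.
pose O := [set (h *: (g *: P))%g | h in D].
have OOm : O \subset Om.
  by apply/subsetP => C /imsetP[h hD ->]; apply: OmD; rewrite // -gC0.
apply: (trsum_ext (t := fun n x => \sum_(C in O) conjt (@t n) (repr C) x +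
    \sum_(C in Om :\: O) conjt (@t n) (repr C) x)).
  move=> n x; rewrite (big_setID O) /=; congr (_ + _).
  by rewrite (setIidPr OOm).
apply: trsumD; last first.
  apply: IH.
  - exact: subset_trans (subsetDl _ _) OmG.
  - apply: leq_trans (proper_card _) _; last exact: cardOm.
    apply/properP; split; first exact: subsetDl.
    exists C0 => //; rewrite inE C0Om andbT negbK; apply/imsetP.
    by exists 1%g; rewrite ?group1 // gC0 mul1g.
  - move=> h C hD /setDP[COm CO]; rewrite inE OmD // andbT.
    apply: contra CO => /imsetP[h' h'D hC]; apply/imsetP.
    exists (h^-1 * h')%g; first by rewrite groupM ?groupV.
    by rewrite lcosetM -hC lcosetK.
  - by move=> x xG /setDP[xOm _]; apply: OmU.
have QD := UD QU.
apply: (trsum_ext (t := rtr D Q (fun n y =>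
    \sum_(C in [set (h *: (g *: P))%g | h in Q]) conjt (@t n) (repr C) y))).
  by move=> n x; apply: (orbit_trace GA DG QD PG (et n) gG gQ).
apply: trsum_tr => //; apply: (is_map_cosets (P := P)) => //.
- exact: subset_trans QD DA.
- exact: subset_trans PG GA.
- apply: subset_trans (lcosetsS _ GA); apply: subset_trans OmG.
  by apply: subset_trans OOm; apply: imsetS.
- move=> h C hQ /imsetP[h' h'Q ->]; apply/imsetP.
  by exists (h * h')%g; rewrite ?groupM // lcosetM.
Qed.

End RawMaps.

(** * Induced modules *)

Section PureTensors.
Variables (k : comPzRingType) (gT : finGroupType) (P : {set gT}).
Variables (A N W : lmodType k) (ra : gT -> A -> A) (la : gT -> N -> N).
Notation tns := (tens P ra la).

Definition pt (a : A) (x : N) : tns := tpi P ra la [:: (a, x)].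

Lemma ptDl a a' x : pt (a + a') x = pt a x + pt a' x.
Proof. by rewrite -tpiD; apply/tpiP; apply: teq_Dl. Qed.

Lemma ptDr a x x' : pt a (x + x') = pt a x + pt a x'.
Proof. by rewrite -tpiD; apply/tpiP; apply: teq_Dr. Qed.

Lemma ptZl c a x : pt (c *: a) x = c *: pt a x.
Proof. by rewrite -tpiZ. Qed.

Lemma ptZr c a x : pt a (c *: x) = c *: pt a x.
Proof. by rewrite -ptZl; apply/tpiP; apply: teq_sym; apply: teq_Z. Qed.

Lemma pt_bal h a x : h \in P -> pt (ra h a) x = pt a (la h x).
Proof. by move=> hP; apply/tpiP; apply: teq_bal. Qed.

Lemma pt_linearl x : linear (pt^~ x).
Proof. by move=> c a b /=; rewrite ptDl ptZl. Qed.

Lemma pt_linearr a : linear (pt a).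
Proof. by move=> c x y; rewrite ptDr ptZr. Qed.

Lemma tens_sum (u : tns) : u = \sum_(p <- trepr u) pt p.1 p.2.
Proof.
rewrite -[LHS]treprK; elim: (trepr u) => [|[a x] s IH].
  by rewrite big_nil.
by rewrite big_cons -IH -tpiD.
Qed.

Lemma tens_ext (f g : tns -> W) : linear f -> linear g ->
  (forall a x, f (pt a x) = g (pt a x)) -> f =1 g.
Proof.
move=> lf lg fg u; rewrite [u]tens_sum !lin_sum //.
by apply: eq_bigr => p _; apply: fg.
Qed.

Variable (b : A -> N -> W).
Hypotheses (b_linl : forall x, linear (b^~ x)) (b_linr : forall a, linear (b a)).
Hypothesis b_bal : forall h a x, h \in P -> b (ra h a) x = b a (la h x).

(** The universal property: the value on a chosen formal sum does not depend on the choice, because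
    b respects every generator of [teq]. *)
Definition tlift (u : tns) : W := \sum_(p <- trepr u) b p.1 p.2.

Lemma tlift_teq s t : teq P ra la s t ->
  \sum_(p <- s) b p.1 p.2 = \sum_(p <- t) b p.1 p.2.
Proof.
have bZ c s' : \sum_(p <- tscale_seq c s') b p.1 p.2 =
    c *: \sum_(p <- s') b p.1 p.2.
  rewrite scaler_sumr big_map; apply: eq_bigr => p _ /=.
  exact: (linear_scale (b_linl p.2)).
elim=> {s t} //=.
- by move=> s t u _ -> _ ->.
- by move=> s s' t t' _ ss _ tt; rewrite !big_cat ss tt.
- by move=> c s t _ st; rewrite !bZ st.
- by move=> s t; rewrite !big_cat /= addrC.
- by move=> x; rewrite big_seq1 big_nil /=; apply: (linear_zero (b_linl x)).
- move=> a a' x; rewrite !big_cons big_nil /= !addr0.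
  exact: (linear_add (b_linl x)).
- move=> a x x'; rewrite !big_cons big_nil /= !addr0.
  exact: (linear_add (b_linr a)).
- move=> c a x; rewrite !big_seq1 /= (linear_scale (b_linr a)).
  exact: (linear_scale (b_linl x)).
- by move=> h a x hP; rewrite !big_seq1 /= b_bal.
Qed.

Lemma tlift_tpi s : tlift (tpi P ra la s) = \sum_(p <- s) b p.1 p.2.
Proof. by apply: tlift_teq; apply: trepr_pi. Qed.

Lemma tlift_pt a x : tlift (pt a x) = b a x.
Proof. by rewrite tlift_tpi big_seq1. Qed.

Lemma tlift_linear : linear tlift.
Proof.
move=> c u v; rewrite -[u]treprK -[v]treprK -tpiZ -tpiD !tlift_tpi.
rewrite big_cat /=; congr (_ + _); rewrite scaler_sumr big_map.
by apply: eq_bigr => p _ /=; apply: (linear_scale (b_linl p.2)).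
Qed.

End PureTensors.

Lemma tmap_pt (k : comPzRingType) (gT : finGroupType) (P : {set gT})
    (A N A' N' : lmodType k) (ra : gT -> A -> A) (la : gT -> N -> N)
    (ra' : gT -> A' -> A') (la' : gT -> N' -> N') (f : A -> A') (h : N -> N') :
  tensor_compatible P ra la ra' la' f h ->
  forall a x, tmap f h (pt P ra la a x) = pt P ra' la' (f a) (h x).
Proof. by move=> fh a x; rewrite /pt tmapE. Qed.

Section InductionMaps.
Variables (k : comPzRingType) (gT : finGroupType) (P D : {group gT}).
Hypothesis PD : P \subset D.
Implicit Types (M N : kmod k P).

Local Notation ipt M := (@pt k gT P (galg k D) M (@galg_r k gT D) (@act _ _ _ M)).

Lemma subg_inv h : h \in D -> subg D h^-1 = (subg D h)^-1%g.
Proof. exact: (morphV (subg_morphism D)). Qed.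

Lemma subg_one : subg D 1 = 1%g.
Proof. exact: (morph1 (subg_morphism D)). Qed.

Definition gdelta (g : gT) : galg k D := [ffun y => (y == subg D g)%:R : k^o].

Definition ieta M (x : M) : indM D M := ipt M (gdelta 1) x.

(** Keeping only the coefficients of a on P projects the induced module onto its summand 1 (x) M;
    this is the retraction of [ieta]. *)
Definition ipi_fun M (a : galg k D) (x : M) : M :=
  \sum_(h in P) (a (subg D h) : k) *: act h x.

Definition ipi M (u : indM D M) : M := tlift (@ipi_fun M) u.

Lemma act_ipt M g a x : g \in D -> act g (ipt M a x : indM D M) = ipt M (galg_l g a) x.
Proof.
move=> gD; apply: tmap_pt; apply: ind_compatible => //.
  exact: galg_l_linear.
exact: galg_lr.
Qed.

Lemma galg_l_delta g h : g \in D -> h \in D ->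
  galg_l g (gdelta h) = gdelta (g * h)%g.
Proof.
move=> gD hD; apply/ffunP => y; rewrite !ffunE; congr (_%:R).
rewrite subgM //; congr nat_of_bool; apply/eqP/eqP => E. 
  by rewrite -E mulKVg.
by rewrite E mulKg.
Qed.

Lemma galg_r_delta h : h \in D -> galg_r h (gdelta 1) = gdelta h.
Proof.
move=> hD; apply/ffunP => y; rewrite !ffunE; congr (_%:R).
congr nat_of_bool; rewrite subg_one; apply/eqP/eqP => [yh|->].
  by rewrite -[y](mulgKV (subg D h)) yh mul1g.
by rewrite mulgV.
Qed.

Lemma galg_decomp (a : galg k D) :
  a = \sum_(g in D) (a (subg D g) : k) *: gdelta g.
Proof.
apply/ffunP => y; rewrite sum_ffunE (bigD1 (sgval y)) ?subgP //=.
rewrite big1 => [|g /andP[gD gy]].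
  by rewrite addr0 !ffunE sgvalK eqxx [RHS]mulr1.
rewrite !ffunE; case: eqP => [yg|_]; last exact: mulr0.
by rewrite yg subgK ?eqxx in gy.
Qed.

Lemma ieta_linear M : linear (@ieta M).
Proof. exact: pt_linearr. Qed.

Lemma ieta_equi M : equivariant P (@ieta M).
Proof.
move=> g gP x; have gD := subsetP PD _ gP.
by rewrite /ieta act_ipt // galg_l_delta // mulg1 -pt_bal // galg_r_delta.
Qed.

Lemma ipi_linl M (x : M) : linear (@ipi_fun M ^~ x).
Proof.
move=> c a b; rewrite /ipi_fun scaler_sumr -big_split /=; apply: eq_bigr => h _.
by rewrite !ffunE scalerDl scalerA.
Qed.

Lemma ipi_linr M a : linear (@ipi_fun M a).
Proof.
move=> c x y; rewrite /ipi_fun scaler_sumr -big_split /=.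
apply: eq_bigr => h hP; rewrite (act_linear hP) scalerDr !scalerA.
by rewrite mulrC.
Qed.

Lemma ipi_bal M h a x : h \in P ->
  ipi_fun (galg_r h a) x = ipi_fun a (act h x) :> M.
Proof.
move=> hP; rewrite /ipi_fun.
rewrite (reindex_onto (fun g => g * h)%g (fun g => g * h^-1)%g) /=; last first.
  by move=> g _; rewrite mulgKV.
apply: eq_big => [g|g /andP[ghP _]]; first by rewrite mulgK eqxx andbT groupMr.
have gP : g \in P by rewrite groupMr in ghP.
rewrite ffunE -actM //; congr ((_ : k) *: _); congr (a _).
by rewrite subgM ?(subsetP PD) // mulgK.
Qed.

Lemma ipi_linear M : linear (@ipi M).
Proof. exact: (tlift_linear (@ipi_linl M) (@ipi_linr M) (@ipi_bal M)). Qed.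

Lemma ipi_pt M a x : ipi (ipt M a x : indM D M) = ipi_fun a x.
Proof. exact: (tlift_pt (@ipi_linl M) (@ipi_linr M) (@ipi_bal M)). Qed.

Lemma ipi_equi M : equivariant P (@ipi M).
Proof.
move=> g gP; have gD := subsetP PD _ gP.
apply: (tens_ext (f := fun u => ipi (act g (u : indM D M))) (g := fun u => act g (ipi u))).
- by move=> c u v; rewrite (act_linear gD) ipi_linear.
- by move=> c u v; rewrite ipi_linear (act_linear gP).
move=> a x; rewrite act_ipt // !ipi_pt /ipi_fun act_sum //.
rewrite (reindex_onto (fun h => g * h)%g (fun h => g^-1 * h)%g) /=; last first.
  by move=> h _; rewrite mulKVg.
apply: eq_big => [h|h /andP[ghP _]]; first by rewrite mulKg eqxx andbT groupMl.
have hP : h \in P by rewrite groupMl in ghP.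
rewrite actM // (linear_scale (act_linear gP)) ffunE subgM ?(subsetP PD) //.
by rewrite mulKg.
Qed.

Lemma ipi_eta M x : ipi (ieta x) = x :> M.
Proof.
rewrite ipi_pt /ipi_fun (bigD1 1%g) //= big1 => [|h /andP[hP h1]].
  by rewrite ffunE eqxx act1 addr0 scale1r.
rewrite ffunE; case: eqP => [/(can_in_inj (@subgK _ D))|_]; last by rewrite scale0r.
by rewrite (subsetP PD) // group1 => /(_ isT isT) h1'; rewrite h1' eqxx in h1.
Qed.

Lemma ipi_act_eta M g x : g \in D -> g \notin P ->
  ipi (act g (ieta x)) = 0 :> M.
Proof.
move=> gD gP; rewrite act_ipt // galg_l_delta // mulg1 ipi_pt /ipi_fun big1 //.
move=> h hP; rewrite ffunE; case: eqP => [/(can_in_inj (@subgK _ D))|_].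
  by rewrite gD (subsetP PD) // => /(_ isT isT) hg; rewrite -hg hP in gP.
by rewrite scale0r.
Qed.

(** Ind M is the direct sum of its translates g (x) M over the cosets gP, and the conjugate by g of
    [ieta] after [ipi] is the projection to the translate of gP. Thus the identity of an induced
    module is a trace from P. *)
Lemma tr_eta_pi M (u : indM D M) : tr D P (fun v => ieta (ipi v)) u = u.
Proof.
move: u; apply: (tens_ext (f := tr D P (fun v => ieta (ipi v))) (g := id)) => //.
  apply: (@tr_linear _ _ D D P (indM D M) (indM D M)) => // c v w.
  by rewrite ipi_linear ieta_linear.
move=> a x; rewrite [in RHS](galg_decomp a) (lin_sum _ _ _ (pt_linearl _ _ _ _)).
(* The coefficients of a are grouped by the coset of their group element; those of gP make up the
   term of the trace at g. *)
rewrite (partition_big (fun g => g *: P)%g (mem (lcosets P D))) /=; last first.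
  by move=> g gD; apply/lcosetsP; exists g.
apply: eq_bigr => C CD; rewrite /conjt; set g := repr C.
have gD : g \in D := reprA (subxx D) PD CD.
have gC : (g *: P)%g = C.
  have [h hD CE] := lcosetsP CD.
  have : g \in (h *: P)%g by rewrite -CE (mem_repr h) // CE lcoset_refl.
  by rewrite CE => /lcosetP[y yP ->]; rewrite lcosetM lcoset_id.
rewrite act_ipt ?groupV // ipi_pt /ipi_fun /ieta.
rewrite (lin_sum _ _ _ (pt_linearr _ _ _ _)) act_sum //.
transitivity (\sum_(h in P) (a (subg D (g * h)%g) : k) *:
    ipt M (gdelta (g * h)%g) x).
  apply: eq_bigr => h hP; have hD := subsetP PD _ hP.
  rewrite ptZr (linear_scale (act_linear gD)) ffunE subg_inv // invgK -subgM //.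
  rewrite -pt_bal // galg_r_delta // [X in _ *: X]act_ipt //.
  by rewrite galg_l_delta.
rewrite (reindex_onto (fun h => g^-1 * h)%g (fun h => g * h)%g) /=; last first.
  by move=> h _; rewrite mulKg.
apply: eq_big => [h|h _].
  rewrite mulKVg eqxx andbT -gC -mem_lcoset.
  apply/idP/andP => [/lcosetP[y yP ->]|[hD /eqP <-]]; last exact: lcoset_refl.
  by rewrite groupM // ?(subsetP PD) // lcosetM lcoset_id.
by rewrite mulKVg ptZl.
Qed.

Lemma ieta_nat M N (f : khom M N) x :
  ieta (f x) = ind_khom D f (ieta x).
Proof.
apply: esym; apply: tmap_pt; apply: ind_compatible => //.
  exact: khom_linear.
exact: khom_act.
Qed.

Lemma ipi_nat M N (f : khom M N) u : ipi (ind_khom D f u) = f (ipi u).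
Proof.
move: u; apply: (tens_ext (f := fun u => ipi (ind_khom D f u)) (g := fun u => f (ipi u))).
- by move=> c u v; rewrite khom_linear ipi_linear.
- by move=> c u v; rewrite ipi_linear khom_linear.
move=> a x; rewrite ipi_pt.
have -> : ind_khom D f (ipt M a x) = ipt N a (f x).
  apply: tmap_pt; apply: ind_compatible => //.
    exact: khom_linear.
  exact: khom_act.
rewrite ipi_pt /ipi_fun lin_sum; last exact: khom_linear.
by apply: eq_bigr => h hP; rewrite (linear_scale (khom_linear f)) khom_act.
Qed.

End InductionMaps.

Definition mapp (k : comPzRingType) (gT : finGroupType) (A : {group gT})
    (M N : Mod k A) (f : hom M N) : M -> N := kfun (f : khom M N).

Lemma Mod_eq (k : comPzRingType) (gT : finGroupType) (A : {group gT})
    (M N : Mod k A) (f g : hom M N) : (forall x, mapp f x = mapp g x) -> f = g.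
Proof. exact: khom_eq. Qed.

Lemma cpx_app (k : comPzRingType) (gT : finGroupType) (A : {group gT})
    (X Y : Cpx (Mod k A)) (f g : hom X Y) : f = g ->
  forall n (x : X n), mapp (cmap f n) x = mapp (cmap g n) x.
Proof. by move=> ->. Qed.

(** * Extending maps and splittings along induction *)

Section Transfer.
Variables (k : comPzRingType) (gT : finGroupType) (H G : {group gT}).
Hypothesis HG : H \subset G.
Variables (FH : functor (Mod k H) (Mod k H)) (FG : functor (Mod k G) (Mod k G)).
Local Notation I := (ind H G).
Variables (e : forall M : kmod k H, FH M -> FG (I M))
  (p : forall M : kmod k H, FG (I M) -> FH M).
Hypotheses (e_lin : forall M, linear (@e M)) (p_lin : forall M, linear (@p M)).
Hypotheses (e_equi : forall M, equivariant H (@e M))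
  (p_equi : forall M, equivariant H (@p M)).
Hypothesis e_nat : forall (M N : Mod k H) (f : hom M N) x,
  e (mapp (fmap FH f) x) = mapp (fmap FG (fmap I f)) (e x).
Hypothesis p_nat : forall (M N : Mod k H) (f : hom M N) u,
  p (mapp (fmap FG (fmap I f)) u) = mapp (fmap FH f) (p u).
Hypothesis tr_ep : forall (M : Mod k H) u, tr G H (fun v => e (p v)) u = u :> FG (I M).

(** This is Ind(r) read through the Frobenius isomorphism between FG (Ind M) and Ind (FH M). The
    maps e, p and the equation [tr_ep] stand for that isomorphism, which never has to be written
    down. The pair FH, FG will be the identity or V (x) -. *)
Definition ext_fun (M N : Mod k H) (r : FH M -> FH N) : FG (I M) -> FG (I N) :=
  tr G H (fun v => e (r (p v))).

Lemma ext_linear (M N : Mod k H) (r : FH M -> FH N) : linear r ->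
  linear (ext_fun r).
Proof. by move=> lr; apply: tr_linear => // c v w; rewrite p_lin lr e_lin. Qed.

Lemma ext_equi (M N : Mod k H) (r : FH M -> FH N) : equivariant H r ->
  equivariant G (ext_fun r).
Proof.
move=> er; apply: tr_equivariant => // h hH x.
by rewrite p_equi // er // e_equi.
Qed.

Lemma ext_indr (M N L : Mod k H) (f : hom M N) (r : FH N -> FH L) u :
  ext_fun r (mapp (fmap FG (fmap I f)) u) =
  ext_fun (fun x => r (mapp (fmap FH f) x)) u.
Proof.
rewrite /ext_fun (tr_compr _ _ (subxx G)) //; last exact: khom_act.
by apply: tr_ext => v; rewrite p_nat.
Qed.

Lemma ext_indl (M N L : Mod k H) (f : hom M N) (r : FH L -> FH M) u :
  mapp (fmap FG (fmap I f)) (ext_fun r u) =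
  ext_fun (fun x => mapp (fmap FH f) (r x)) u.
Proof.
rewrite /ext_fun (tr_compl _ _ (subxx G)) //.
- by apply: tr_ext => v; rewrite e_nat.
- exact: khom_linear.
- exact: khom_act.
Qed.

Lemma ext_ext (M N : Mod k H) (r r' : FH M -> FH N) u :
  (forall x, r x = r' x) -> ext_fun r u = ext_fun r' u.
Proof. by move=> rr; apply: tr_ext => v; rewrite rr. Qed.

Lemma ext_id (M : Mod k H) (u : FG (I M)) : ext_fun (fun x : FH M => x) u = u.
Proof. exact: tr_ep. Qed.

Lemma ext_D (M N : Mod k H) (r r' : FH M -> FH N) u :
  ext_fun (fun x => r x + r' x) u = ext_fun r u + ext_fun r' u.
Proof.
rewrite /ext_fun -(trD _ _ _ (subxx G)) //; apply: tr_ext => v.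
exact: (linear_add (@e_lin _)).
Qed.

Definition ext_hom (M N : Mod k H) (r : hom (FH M) (FH N)) :
    hom (FG (I M)) (FG (I N)) :=
  Khom (ext_linear (khom_linear r)) (ext_equi (khom_act r)).

Lemma split_ind (X Y Z : Mod k H) (f : hom X Y) (g : hom Y Z) :
  split_sequence (fmap FH f) (fmap FH g) ->
  split_sequence (fmap FG (fmap I f)) (fmap FG (fmap I g)).
Proof.
case=> r [s [rf gs frsg]]; exists (ext_hom r), (ext_hom s); split.
- apply: Mod_eq => u; rewrite -[RHS]ext_id; rewrite -[LHS]/(ext_fun _ (mapp _ u)).
  rewrite ext_indr; apply: ext_ext => x.
  exact: (congr1 (fun h : khom _ _ => kfun h x) rf).
- apply: Mod_eq => u; rewrite -[RHS]ext_id; rewrite -[LHS]/(mapp _ (ext_fun _ u)).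
  rewrite ext_indl; apply: ext_ext => x.
  exact: (congr1 (fun h : khom _ _ => kfun h x) gs).
- apply: Mod_eq => u; rewrite -[RHS]ext_id.
  rewrite -[LHS]/(mapp _ (ext_fun _ u) + ext_fun _ (mapp _ u)).
  rewrite ext_indl ext_indr -ext_D; apply: ext_ext => x.
  exact: (congr1 (fun h : khom _ _ => kfun h x) frsg).
Qed.

Local Notation CH := (cpx_functor FH).
Local Notation CG := (cpx_functor FG).
Local Notation CI := (cpx_functor I).

Program Definition ext_chain (X Y : Cpx (Mod k H)) (r : hom (CH X) (CH Y)) :
    hom (CG (CI X)) (CG (CI Y)) :=
  @ChainMap (Mod k G) (CG (CI X)) (CG (CI Y))
    (fun n => @ext_hom (X n) (Y n) (cmap r n)) _.
Next Obligation.
move=> X Y r n; apply: Mod_eq => u.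
rewrite -[LHS]/(mapp (fmap FG (fmap I (diff Y n))) (ext_fun _ u)).
rewrite -[RHS]/(ext_fun _ (mapp (fmap FG (fmap I (diff X n))) u)).
rewrite ext_indl ext_indr; apply: ext_ext => x.
exact: (congr1 (fun h : khom _ _ => kfun h x) (cmapP r n)).
Qed.

Lemma split_ind_cpx (X Y Z : Cpx (Mod k H)) (f : hom X Y) (g : hom Y Z) :
  split_sequence (fmap CH f) (fmap CH g) ->
  split_sequence (fmap CG (fmap CI f)) (fmap CG (fmap CI g)).
Proof.
case=> r [s [rf gs frsg]]; exists (ext_chain r), (ext_chain s); split.
- apply: chain_map_eq => n; apply: Mod_eq => u; rewrite -[RHS]ext_id.
  rewrite -[LHS]/(ext_fun _ (mapp (fmap FG (fmap I (cmap f n))) u)).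
  rewrite ext_indr; apply: ext_ext => x.
  exact (cpx_app rf (x : carrier (CH _ n))).
- apply: chain_map_eq => n; apply: Mod_eq => u; rewrite -[RHS]ext_id.
  rewrite -[LHS]/(mapp (fmap FG (fmap I (cmap g n))) (ext_fun _ u)).
  rewrite ext_indl; apply: ext_ext => x.
  exact (cpx_app gs (x : carrier (CH _ n))).
- apply: chain_map_eq => n; apply: Mod_eq => u; rewrite -[RHS]ext_id.
  rewrite -[LHS]/(mapp (fmap FG (fmap I (cmap f n))) (ext_fun _ u) +
    ext_fun _ (mapp (fmap FG (fmap I (cmap g n))) u)).
  rewrite ext_indl ext_indr -ext_D; apply: ext_ext => x.
  exact (cpx_app frsg (x : carrier (CH _ n))).
Qed.

End Transfer.

Section Induced.
Variables (k : comPzRingType) (gT : finGroupType) (H G : {group gT}).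
Hypothesis HG : H \subset G.
Local Notation I := (ind H G).
Variable V : kmod k G.
Local Notation VH := (resM HG V).

Lemma split_ind_id (X Y Z : Mod k H) (f : hom X Y) (g : hom Y Z) :
  split_sequence f g -> split_sequence (fmap I f) (fmap I g).
Proof.
apply: (@split_ind _ _ _ _ HG (functor_id _) (functor_id _)
  (fun M => @ieta k gT H G M) (fun M => @ipi k gT H G M)).
- exact: ieta_linear.
- exact: ipi_linear.
- exact: ieta_equi.
- exact: ipi_equi.
- by move=> M N f' x; apply: ieta_nat.
- by move=> M N f' x; apply: ipi_nat.
- by move=> M u; apply: tr_eta_pi.
Qed.

Lemma vcompat (W W' M N : lmodType k) (i : W -> W') (t : M -> N) :
  linear i -> linear t ->
  tensor_compatible (set0 : {set gT}) (fun _ (v : W) => v) (fun _ (x : M) => x)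
    (fun _ (v : W') => v) (fun _ (y : N) => y) i t.
Proof. by move=> li lt; split=> // g; rewrite inE. Qed.

Lemma tmap_square (W1 W2 W2' W3 M1 M2 M2' M3 : lmodType k)
    (i1 : W1 -> W2) (t1 : M1 -> M2) (i2 : W2 -> W3) (t2 : M2 -> M3)
    (i1' : W1 -> W2') (t1' : M1 -> M2') (i2' : W2' -> W3) (t2' : M2' -> M3)
    (u : tens (set0 : {set gT}) (fun _ (v : W1) => v) (fun _ (x : M1) => x)) :
  linear i2 -> linear t2 -> linear i2' -> linear t2' ->
  (forall v, i2 (i1 v) = i2' (i1' v)) -> (forall x, t2 (t1 x) = t2' (t1' x)) ->
  tmap i2 t2 (tmap i1 t1 u : tens (set0 : {set gT}) (fun _ (v : W2) => v)
    (fun _ (x : M2) => x)) =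
  tmap i2' t2' (tmap i1' t1' u : tens (set0 : {set gT}) (fun _ (v : W2') => v)
    (fun _ (x : M2') => x)) :> tens (set0 : {set gT}) (fun _ (v : W3) => v)
    (fun _ (x : M3) => x).
Proof.
move=> li2 lt2 li2' lt2' ii tt.
rewrite -(@tmap_comp _ _ _ _ _ _ _ _ _ _ _ _ _ _ _ i1 t1 i2 t2
  (fun v => i2 (i1 v)) (fun x => t2 (t1 x))) //.
by apply: tmap_comp => //; apply: vcompat.
Qed.

(** V (x) Ind M behaves as the module induced from V_H (x) M, with 1 (x) [ieta] and 1 (x) [ipi] as
    structure maps. The property Q is left open so that these are checked once, for modules and for
    complexes. *)
Lemma split_ind_V_gen (Q : forall (FH : functor (Mod k H) (Mod k H))
    (FG : functor (Mod k G) (Mod k G)), Prop) :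
  (forall (FH : functor (Mod k H) (Mod k H)) (FG : functor (Mod k G) (Mod k G))
     (e : forall M : kmod k H, FH M -> FG (I M))
     (p : forall M : kmod k H, FG (I M) -> FH M),
     (forall M, linear (@e M)) -> (forall M, linear (@p M)) ->
     (forall M, equivariant H (@e M)) -> (forall M, equivariant H (@p M)) ->
     (forall (M N : Mod k H) (f : hom M N) x,
        e _ (mapp (fmap FH f) x) = mapp (fmap FG (fmap I f)) (e _ x)) ->
     (forall (M N : Mod k H) (f : hom M N) u,
        p _ (mapp (fmap FG (fmap I f)) u) = mapp (fmap FH f) (p _ u)) ->
     (forall (M : Mod k H) u, tr G H (fun v => e _ (p _ v)) u = u :> FG (I M)) ->
     Q FH FG) ->
  Q (diag VH) (diag V).
Proof.
have lid (W : lmodType k) : linear (@id W) by [].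
have ce (M : kmod k H) := vcompat (lid (VH : lmodType k)) (@ieta_linear k gT H G M).
have cp (M : kmod k H) := vcompat (lid (VH : lmodType k)) (@ipi_linear k gT H G HG M).
have lact (A : {group gT}) (W : kmod k A) g : g \in A -> linear (act g : W -> W).
  by move=> gA; apply: act_linear.
apply; first by move=> M; apply: (tmap_linear (ce M)).
- by move=> M; apply: (tmap_linear (cp M)).
- move=> M g gH u; have gG := subsetP HG _ gH.
  apply: tmap_square => //; try exact: lact; try exact: ieta_linear.
  by move=> x; apply: ieta_equi.
- move=> M g gH u; have gG := subsetP HG _ gH.
  apply: tmap_square => //; try exact: lact; try exact: ipi_linear.
  by move=> x; apply: ipi_equi.
- move=> M N f u; apply: tmap_square => //; try exact: ieta_linear.
    exact: khom_linear.
  by move=> x; apply: ieta_nat.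
- move=> M N f u; apply: tmap_square => //; try exact: ipi_linear.
    exact: khom_linear.
  by move=> x; apply: ipi_nat.
- move=> M; pose E (u : diagM V (indM G M)) := tmap id (@ieta k gT H G M) (tmap id (@ipi k gT H G M) u : diagM VH M) : diagM V (indM G M).
  have lE : linear E by move=> c u v; rewrite /E (tmap_linear (cp M)) (tmap_linear (ce M)).
  apply: (tens_ext (f := tr G H E) (g := id)) => //.
    by apply: (@tr_linear _ _ G G H (diagM V (indM G M)) (diagM V (indM G M))).
  (* On v (x) u the actions of g and g^-1 on v cancel, which leaves the trace of [ieta] after [ipi]
     on u. *)
  move=> v u; rewrite -[u in RHS](tr_eta_pi HG) /tr.
  rewrite (lin_sum _ _ _ (pt_linearr _ _ _ _)); apply: eq_bigr => C CG.
  have gG : repr C \in G := reprA (subxx G) HG CG.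
  have ca g : g \in G -> tensor_compatible (set0 : {set gT})
      (fun _ (v : V) => v) (fun _ (x : indM G M) => x) (fun _ (v : V) => v)
      (fun _ (x : indM G M) => x) (act g) (act g).
    by move=> gG'; apply: vcompat; apply: act_linear.
  pose D v u : diagM V (indM G M) := pt set0 (fun _ (v : V) => v)
    (fun _ (x : indM G M) => x) v u.
  have Dact g v' u' : g \in G -> act g (D v' u') = D (act g v') (act g u').
    by move=> gG'; rewrite /D -(tmap_pt (ca _ gG')).
  have DE v' u' : E (D v' u') = D v' (ieta G (ipi u')).
    by rewrite /E /D (tmap_pt (cp M)) (tmap_pt (ce M)).
  rewrite -[pt _ _ _ v u]/(D v u) /conjt Dact ?groupV // DE Dact //.
  by rewrite actKV.
Qed.

Lemma split_ind_V (X Y Z : Mod k H) (f : hom X Y) (g : hom Y Z) :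
  split_sequence (fmap (diag VH) f) (fmap (diag VH) g) ->
  split_sequence (fmap (diag V) (fmap I f)) (fmap (diag V) (fmap I g)).
Proof.
by apply: (@split_ind_V_gen (fun FH FG =>
  split_sequence (fmap FH f) (fmap FH g) ->
  split_sequence (fmap FG (fmap I f)) (fmap FG (fmap I g)))) => *;
  apply: split_ind.
Qed.

Lemma split_ind_V_cpx (X Y Z : Cpx (Mod k H)) (f : hom X Y) (g : hom Y Z) :
  split_sequence (fmap (cpx_functor (diag VH)) f) (fmap (cpx_functor (diag VH)) g) ->
  split_sequence (fmap (cpx_functor (diag V)) (fmap (cpx_functor I) f))
    (fmap (cpx_functor (diag V)) (fmap (cpx_functor I) g)).
Proof.
by apply: (@split_ind_V_gen (fun FH FG =>
  split_sequence (fmap (cpx_functor FH) f) (fmap (cpx_functor FH) g) ->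
  split_sequence (fmap (cpx_functor FG) (fmap (cpx_functor I) f))
    (fmap (cpx_functor FG) (fmap (cpx_functor I) g)))) => *;
  apply: split_ind_cpx.
Qed.

End Induced.

(** * Descent of induction and restriction *)

Lemma mod_app (k : comPzRingType) (gT : finGroupType) (A : {group gT})
    (M N : Mod k A) (f g : hom M N) : f = g ->
  forall x, mapp f x = mapp g x.
Proof. by move=> ->. Qed.

Section Lifting.
Variables (k : comPzRingType) (gT : finGroupType) (A : {group gT}).
Variable V : kmod k A.

(** Preimages under f exist degreewise by exactness; as f is injective they are unique, hence
    automatically linear, equivariant and compatible with the differentials. *)
Lemma ev_inj_lift (Q X Y Z : Cpx (Mod k A)) (f : hom X Y) (g : hom Y Z)
    (v : hom Q Y) : short_exact f g -> g \oc v = 0 -> exists u, f \oc u = v.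
Proof.
move=> fg gv.
have gv0 n x : ev g (ev v x : Y n) = 0.
  exact (cpx_app gv (x : carrier (Q n))).
have fI n : injective (@ev k gT A X Y f n) by case: (fg n).
have [u uP] : exists u : raw Q X, forall n x, ev f (u n x) = ev v x.
  have uex (i : {n : int & Q n}) :
      {y : X (tag i) | ev f y = ev v (tagged i)}.
    apply: cid; case: (fg (tag i)) => _ ex _.
    by have [/(_ (gv0 _ _)) [y <-] _] := ex (ev v (tagged i)); exists y.
  by exists (fun n x => sval (uex (Tagged (fun n => Q n) x))) => n x; case: uex.
have [lf ef df] := is_map_ev f (subxx A); have [lv evv dv] := is_map_ev v (subxx A).
have hu : is_map A u.
  split=> [n a x y|n h hA x|n x]; apply: fI.
  - by rewrite lf !uP lv.
  - by rewrite ef // !uP evv.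
  - by rewrite df !uP dv.
exists (mkmap hu); apply: ev_eq => n x.
by rewrite -[LHS]/(ev f (ev (mkmap hu) x)) mkmapE uP.
Qed.

Variables (fl : bool) (b : boundedness) (c : seq_class).

(** Hom(Q, -) is left exact on every degreewise exact sequence, so that only lifting along g is a
    condition. *)
Lemma E_projectiveP (Q : C_cat k A fl b) : E_projective V fl b c Q <->
  forall (X Y Z : C_cat k A fl b) (f : hom X Y) (g : hom Y Z),
    @in_class _ _ _ V c (sval X) (sval Y) (sval Z) f g ->
    forall w : hom Q Z, exists v : hom Q Y, g \oc v = w.
Proof.
split=> [Qp X Y Z f g fg|Ql X Y Z f g fg]; first by case: (Qp X Y Z f g fg).
have [se _] := fg; split; last exact: Ql fg.
- move=> u v uv; apply: ev_eq => n x; case: (se n) => fI _ _; apply: fI.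
  exact (cpx_app uv (x : carrier (sval Q n))).
- move=> v; split=> [gv|[u <-]].
    exact: (ev_inj_lift se gv).
  apply: ev_eq => n x; case: (se n) => _ ex _.
  by apply/ex; exists (ev u x).
Qed.

End Lifting.

Section Descend.
Variables (k : comPzRingType) (gT : finGroupType) (H G : {group gT}).
Hypothesis HG : H \subset G.
Local Notation CI := (cpx_functor (ind H G)).
Local Notation CR := (cpx_functor (res k HG)).
Variable V : kmod k G.
Local Notation VH := (resM HG V).

Definition reta (X : cx k H) : raw X (cpx_fobj (ind H G) X) :=
  fun n x => @ieta k gT H G (X n) x.
Definition rpi (X : cx k H) : raw (cpx_fobj (ind H G) X) X :=
  fun n u => @ipi k gT H G (X n) u.

Lemma is_map_reta X : is_map H (@reta X).
Proof.
split=> [n|n|n x]; first exact: ieta_linear.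
  exact: ieta_equi.
exact: ieta_nat.
Qed.

Lemma is_map_rpi X : is_map H (@rpi X).
Proof.
split=> [n|n|n x]; first exact: ipi_linear.
  exact: ipi_equi.
exact: (ipi_nat HG (diff X n : khom (X n) (X (n + 1)))).
Qed.

Lemma reta_nat (X Y : cx k H) (f : chain_map X Y) n x :
  reta (ev f x : Y n) = ev (cpx_fmap (ind H G) f) (reta x).
Proof. exact: ieta_nat. Qed.

Lemma rpi_nat (X Y : cx k H) (f : chain_map X Y) n
    (u : cpx_fobj (ind H G) X n) :
  rpi (ev (cpx_fmap (ind H G) f) u) = ev f (rpi u).
Proof. exact: (ipi_nat HG (f n : khom (X n) (Y n))). Qed.

Lemma rpi_reta (X : cx k H) n (x : X n) : rpi (reta x) = x.
Proof. exact: ipi_eta. Qed.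

Lemma rpi_act_reta (X : cx k H) n (x : X n) g : g \in G -> g \notin H ->
  rpi (act g (reta x)) = 0.
Proof. exact: ipi_act_eta. Qed.

Lemma rtr_reta_rpi (X : cx k H) n (u : cpx_fobj (ind H G) X n) :
  rtr G H (fun n v => reta (rpi v)) u = u.
Proof. exact: tr_eta_pi. Qed.

Lemma lcosets_repr (C : {set gT}) : C \in lcosets H G -> C != H ->
  repr C \in G /\ repr C \notin H.
Proof.
move=> CG CH; split; first exact: (reprA (subxx G) HG CG).
apply: contra CH => rH; have [g gG CE] := lcosetsP CG.
have : repr C \in C by rewrite CE (mem_repr g) // lcoset_refl.
rewrite {2}CE => /lcosetP[h hH hE]; rewrite CE lcoset_id //.
by rewrite -(mulgK h g) -hE groupM // groupV.
Qed.

(** Half of Frobenius reciprocity: the trace of [reta] after w is the map X -> Ind Y that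
    corresponds to w : Res X -> Y. Under [rpi] only the coset H of the trace survives. *)
Lemma rpi_rtr_reta (X : cx k G) (Y : cx k H) (w : raw X Y) n x :
  is_map H w -> rpi (rtr G H ((fun n x => reta (w n x)) :
    raw X (cpx_fobj (ind H G) Y)) x) = w n x.
Proof.
move=> [_ ew _]; have [lp ep _] := is_map_rpi Y.
rewrite /rtr /tr lin_sum // (bigD1 (H : {set gT})) /=; last first.
  by apply/lcosetsP; exists 1%g; rewrite ?group1 // mul1g.
rewrite big1 ?addr0 => [|C /andP[CG CH]].
  rewrite /conjt; have rH : repr H \in H by apply: mem_repr (group1 H).
  by rewrite ep // rpi_reta ew ?groupV // actKV // (subsetP HG).
by have [rG rH] := lcosets_repr CG CH; apply: rpi_act_reta.
Qed.

(** The other half of Frobenius reciprocity: the trace of w after [rpi] is the map Ind X -> Y that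
    extends w : X -> Res Y along [reta]. *)
Lemma rtr_rpi_reta (X : cx k H) (Y : cx k G) (w : raw X Y) n (x : X n) :
  is_map H w -> rtr G H ((fun n u => w n (rpi u)) :
    raw (cpx_fobj (ind H G) X) Y) (reta x) = w n x.
Proof.
move=> [lw ew _]; have [lp ep _] := is_map_rpi X; have [_ ee _] := is_map_reta X.
rewrite /rtr /tr (bigD1 (H : {set gT})) /=; last first.
  by apply/lcosetsP; exists 1%g; rewrite ?group1 // mul1g.
rewrite big1 ?addr0 => [|C /andP[CG CH]].
  rewrite /conjt; have rH : repr H \in H by apply: mem_repr (group1 H).
  by rewrite -ee ?groupV // rpi_reta ew ?groupV // actKV // (subsetP HG).
have [rG rH] := lcosets_repr CG CH; rewrite /conjt rpi_act_reta ?groupV //.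
by rewrite (linear_zero (lw n)) (linear_zero (act_linear rG)).
Qed.

(** Ind f is a copy of f on each translate g (x) X. Injectivity and exactness are therefore tested
    on the coordinates [rpi (act (repr C)^-1 u)], one for each coset C. *)
Lemma short_exact_ind (X Y Z : Cpx (Mod k H)) (f : hom X Y) (g : hom Y Z) :
  short_exact f g -> short_exact (fmap CI f) (fmap CI g).
Proof.
move=> fg n; have [fI ex gs] := fg n.
have [lf ef _] := is_map_ev (cpx_fmap (ind H G) f) (subxx G).
have [lg eg _] := is_map_ev (cpx_fmap (ind H G) g) (subxx G).
have eta0 (W : cx k H) : reta (0 : W n) = 0.
  by have [l _ _] := is_map_reta W; apply: (linear_zero (l n)).
have pi0 (W : cx k H) : rpi (0 : cpx_fobj (ind H G) W n) = 0.
  by have [l _ _] := is_map_rpi W; apply: (linear_zero (l n)).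
have act0 (W : cx k H) h : h \in G -> act h (0 : cpx_fobj (ind H G) W n) = 0.
  by move=> hG; apply: (linear_zero (act_linear hG)).
have cG C : C \in lcosets H G -> repr C \in G by apply: (reprA (subxx G) HG).
pose F := ev (cpx_fmap (ind H G) f) (n := n).
pose K := ev (cpx_fmap (ind H G) g) (n := n).
have F0 u : F u = 0 -> u = 0.
  move=> Fu; rewrite -[u]rtr_reta_rpi /rtr /tr big1 // => C /cG CG.
  rewrite /conjt; suff -> : rpi (act (repr C)^-1 u) = 0 by rewrite eta0 act0.
  apply: fI; rewrite -[LHS]/(ev f _) -rpi_nat ef ?groupV //.
  rewrite -[ev _ u]/(F u) Fu act0 ?groupV // pi0.
  by apply: esym; apply: (linear_zero (khom_linear (cmap f n))).
split.
- move=> u v uv; apply/eqP; rewrite -subr_eq0; apply/eqP; apply: F0.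
  rewrite /F (linear_add (lf n)) (linear_opp (lf n)).
  by apply/eqP; rewrite subr_eq0; apply/eqP.
- move=> y; split=> [Ky|[x <-]]; last first.
    rewrite -[LHS]/(K (F x)) -[x]rtr_reta_rpi.
    rewrite /F (tr_compl _ _ (subxx G)) // /K (tr_compl _ _ (subxx G)) //.
    rewrite -[RHS](tr0 (M := cpx_fobj (ind H G) X n) _ x (subxx G) HG).
    apply: tr_ext => v; rewrite -!reta_nat.
    suff -> : ev g (ev f (rpi v)) = 0 by rewrite eta0.
    by apply/ex; exists (rpi v).
  have xex C : {x | C \in lcosets H G -> ev f x = rpi (act (repr C)^-1 y)}.
    (* 0 is a dummy value away from the cosets, where nothing is asked. *)
    apply: cid; case: (boolP (C \in _)) => [CG|]; last by exists 0.
    have [[x xE] _] : (exists x, f n x = rpi (act (repr C)^-1 y)) /\ True.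
      split=> //; apply/ex; rewrite -[LHS]/(ev g _) -rpi_nat eg ?groupV ?cG //.
      by rewrite -[ev _ y]/(K y) [K y]Ky act0 ?groupV ?cG // pi0.
    by exists x.
  exists (\sum_(C in lcosets H G) act (repr C) (reta (sval (xex C)))).
  rewrite -[LHS]/(F _) /F lin_sum // -[RHS]rtr_reta_rpi.
  apply: eq_bigr => C CG; rewrite ef ?cG // -reta_nat.
  by case: (xex C) => x /= ->.
- move=> z.
  have xex C : {x | ev g x = rpi (act (repr C)^-1 z)}.
    by apply: cid; have [x] := gs (rpi (act (repr C)^-1 z)); exists x.
  exists (\sum_(C in lcosets H G) act (repr C) (reta (sval (xex C)))).
  rewrite -[LHS]/(K _) /K lin_sum // -[RHS]rtr_reta_rpi.
  apply: eq_bigr => C CG; rewrite eg ?cG // -reta_nat.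
  by case: (xex C) => x /= ->.
Qed.

Lemma in_class_ind c (X Y Z : Cpx (Mod k H)) (f : hom X Y) (g : hom Y Z) :
  in_class VH c f g -> in_class V c (fmap CI f) (fmap CI g).
Proof.
case=> se cl; split; first exact: short_exact_ind.
case: c cl => [ts|vs|vts|[ts vs]].
- by move=> n; apply: (split_ind_id HG (ts n)).
- exact: split_ind_V_cpx.
- by move=> n; apply: (split_ind_V (vts n)).
- by split; [move=> n; apply: (split_ind_id HG (ts n)) | apply: split_ind_V_cpx].
Qed.

Lemma split_res (X Y Z : Mod k G) (f : hom X Y) (g : hom Y Z) :
  split_sequence f g -> split_sequence (fmap (res k HG) f) (fmap (res k HG) g).
Proof.
case=> r [s [rf gs frsg]]; exists (fmap (res k HG) r), (fmap (res k HG) s).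
by rewrite -!fmapM -fmapD rf gs frsg !fmap1.
Qed.

(** V_H (x) X_H and the restriction of V (x) X have the same carrier and action by conversion, so
    the function stays as it is. *)
Definition diag_res (X Y : kmod k G) (r : khom (diagM V X) (diagM V Y)) :
    khom (diagM VH (resM HG X)) (diagM VH (resM HG Y)) :=
  @Khom k gT H (diagM VH (resM HG X)) (diagM VH (resM HG Y)) r (khom_linear r)
    (fun g gH => khom_act r (subsetP HG g gH)).

Lemma split_res_V (X Y Z : Mod k G) (f : hom X Y) (g : hom Y Z) :
  split_sequence (fmap (diag V) f) (fmap (diag V) g) ->
  split_sequence (fmap (diag VH) (fmap (res k HG) f))
    (fmap (diag VH) (fmap (res k HG) g)).
Proof.
case=> r [s [rf gs frsg]]; exists (diag_res r), (diag_res s).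
split; apply: Mod_eq => x.
- exact (mod_app rf (x : carrier (diagM V X))).
- exact (mod_app gs (x : carrier (diagM V Z))).
- exact (mod_app frsg (x : carrier (diagM V Y))).
Qed.

Program Definition diag_res_cpx (X Y : Cpx (Mod k G))
    (r : hom (cpx_functor (diag V) X) (cpx_functor (diag V) Y)) :
    hom (cpx_functor (diag VH) (CR X)) (cpx_functor (diag VH) (CR Y)) :=
  @ChainMap (Mod k H) (cpx_functor (diag VH) (CR X)) (cpx_functor (diag VH) (CR Y))
    (fun n => @diag_res (X n) (Y n) (cmap r n)) _.
Next Obligation.
move=> X Y r n; apply: Mod_eq => x.
exact (mod_app (cmapP r n) (x : carrier (diagM V (X n)))).
Qed.

Lemma split_res_V_cpx (X Y Z : Cpx (Mod k G)) (f : hom X Y) (g : hom Y Z) :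
  split_sequence (fmap (cpx_functor (diag V)) f) (fmap (cpx_functor (diag V)) g) ->
  split_sequence (fmap (cpx_functor (diag VH)) (fmap CR f))
    (fmap (cpx_functor (diag VH)) (fmap CR g)).
Proof.
case=> r [s [rf gs frsg]]; exists (diag_res_cpx r), (diag_res_cpx s).
split; apply: chain_map_eq => n; apply: Mod_eq => x.
- exact (cpx_app rf (x : carrier (cpx_functor (diag V) X n))).
- exact (cpx_app gs (x : carrier (cpx_functor (diag V) Z n))).
- exact (cpx_app frsg (x : carrier (cpx_functor (diag V) Y n))).
Qed.

Lemma in_class_res c (X Y Z : Cpx (Mod k G)) (f : hom X Y) (g : hom Y Z) :
  in_class V c f g -> in_class VH c (fmap CR f) (fmap CR g).
Proof.
case=> se cl; split; first by move=> n; case: (se n).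
case: c cl => [ts|vs|vts|[ts vs]].
- by move=> n; apply: (split_res (ts n)).
- exact: split_res_V_cpx.
- by move=> n; apply: (split_res_V (vts n)).
- by split; [move=> n; apply: (split_res (ts n)) | apply: split_res_V_cpx].
Qed.

Variables (fl : bool) (b : boundedness).
Hypothesis allow_ind : forall X : Cpx (Mod k H), allowed fl b X -> allowed fl b (CI X).
Hypothesis allow_res : forall X : Cpx (Mod k G), allowed fl b X -> allowed fl b (CR X).

(** Ind is left adjoint to Res, and Res preserves the class of sequences: transpose w to X -> Res C,
    lift it there, and transpose back by a trace. *)
Lemma descends_ind o : descends CI VH V fl b o.
Proof.
exists allow_ind => c _ X /E_projectiveP Xp; apply/E_projectiveP.
move=> A B C f g fg w.
pose r (Y : C_cat k G fl b) : C_cat k H fl b := exist _ (CR (sval Y)) (allow_res (svalP Y)).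
have hw : is_map H ((fun n x => ev w (reta x)) : raw (sval X) (sval (r C))).
  apply: is_map_comp (@is_map_reta _) (is_mapS HG _).
  exact: is_map_ev.
have [v vE] := Xp (r A) (r B) (r C) (fmap CR f) (fmap CR g) (in_class_res fg) (mkmap hw).
have hv : is_map G (rtr G H ((fun n u => ev v (rpi u)) :
    raw (cpx_fobj (ind H G) (sval X)) (sval B))).
  apply: is_map_rtr => //.
  by apply: is_map_comp (@is_map_rpi _) _; exact: (is_map_ev v).
exists (mkmap hv); apply: ev_eq => n u.
rewrite -[LHS]/(ev g (ev (mkmap hv) u)) mkmapE /rtr.
have [lg eg _] := is_map_ev g (subxx G).
have [lw ew _] := is_map_ev w (subxx G).
rewrite (tr_compl _ _ (subxx G)) // -[u in RHS]rtr_reta_rpi /rtr.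
rewrite (tr_compl _ _ (subxx G)) //; apply: tr_ext => y.
have := cpx_app vE (rpi y : carrier (sval X n)).
by rewrite -[RHS]/(ev (mkmap hw) (rpi y)) mkmapE.
Qed.

(** Induction from a subgroup of finite index is also right adjoint to restriction: the lifting
    problem is transposed to one for X along Ind g, and [rpi] brings the solution back. *)
Lemma descends_res o : descends CR V VH fl b o.
Proof.
exists allow_res => c _ X /E_projectiveP Xp; apply/E_projectiveP.
move=> A B C f g fg w.
pose i (Y : C_cat k H fl b) : C_cat k G fl b := exist _ (CI (sval Y)) (allow_ind (svalP Y)).
have hw : is_map G (rtr G H ((fun n x => reta (ev w x)) :
    raw (sval X) (cpx_fobj (ind H G) (sval C)))).
  apply: is_map_rtr => //.
  by apply: is_map_comp (is_map_ev w (subxx H)) (@is_map_reta _).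
have [v vE] := Xp (i A) (i B) (i C) (fmap CI f) (fmap CI g) (in_class_ind fg) (mkmap hw).
have hv : is_map H ((fun n u => rpi (ev v u)) : raw (CR (sval X)) (sval B)).
  apply: is_map_comp _ (@is_map_rpi _).
  exact: (is_mapS HG (is_map_ev v (subxx G))).
exists (mkmap hv); apply: ev_eq => n u.
rewrite -[LHS]/(ev g (ev (mkmap hv) u)) mkmapE -rpi_nat.
have := cpx_app vE (u : carrier (sval X n)).
rewrite -[X in X = _]/(ev (cpx_fmap (ind H G) g) (ev v u)) => ->.
rewrite -[X in rpi X]/(ev (mkmap hw) u) mkmapE.
by apply: (rpi_rtr_reta (w := (fun n x => ev w x))); exact (is_map_ev w (subxx H)).
Qed.

End Descend.

(** * Finite length under induction and restriction *)

Section Rank.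
Variable k : comPzRingType.

Definition ksub (M : lmodType k) (S : M -> Prop) : Prop :=
  [/\ S 0, forall x y, S x -> S y -> S (x + y) & forall a x, S x -> S (a *: x)].

Lemma ksubB (M : lmodType k) (S : M -> Prop) x y : ksub S ->
  S x -> S y -> S (x - y).
Proof. by move=> [_ SD SZ] Sx Sy; apply: SD => //; rewrite -scaleN1r; apply: SZ. Qed.

(* M has a bounded rank function on its k-submodules that is strictly
   increasing on their intersections with K; for K = M this is finite length
   over k. *)
Definition ranked (M : lmodType k) (K : M -> Prop) : Prop :=
  exists (n : nat) (r : (M -> Prop) -> nat),
    (forall S, ksub S -> (r S <= n)%N) /\
    forall S S', ksub S -> ksub S' -> (forall x, S x -> S' x) ->
      (r S <= r S')%N /\ ((r S' <= r S)%N -> forall x, S' x -> K x -> S x).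

Lemma ranked0 (M : lmodType k) (K : M -> Prop) : (forall x, K x -> x = 0) ->
  ranked K.
Proof.
move=> K0; exists 0%N, (fun _ => 0%N); split=> // S S' [S0 _ _] _ _.
by split=> // _ x _ /K0 ->.
Qed.

Lemma ranked_ext (M : lmodType k) (K K' : M -> Prop) :
  (forall x, K' x -> K x) -> ranked K -> ranked K'.
Proof.
move=> KK [n [r [rn rP]]]; exists n, r; split=> // S S' sS sS' SS'.
by have [le imp] := rP S S' sS sS' SS'; split=> // /imp h x S'x /KK; apply: h.
Qed.

(** An element of K outside K' generates K over K', so beyond K' there is at most one more step: the
    bit [h S] records whether S meets K outside K'. *)
Lemma ranked_simple (M : lmodType k) (K K' : M -> Prop) : ksub K -> ksub K' ->
  (forall x, K' x -> K x) ->
  (forall t x, K t -> ~ K' t -> K x -> exists c, K' (x - c *: t)) ->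
  ranked K' -> ranked K.
Proof.
move=> sK sK' K'K Ks [n [r [rn rP]]].
pose h (S : M -> Prop) : bool := `[< exists t, [/\ S t, K t & ~ K' t] >].
exists n.+1, (fun S => (r S + h S)%N); split=> [S sS|S S' sS sS' SS'].
  by rewrite -addn1 leq_add ?rn // leq_b1.
have [le imp] := rP S S' sS sS' SS'.
have hh : (h S <= h S')%N.
  case: (boolP (h S)) => // /asboolP[t [St Kt K't]].
  suff -> : h S' by [].
  by apply/asboolP; exists t; split=> //; apply: SS'.
split; first exact: leq_add.
move=> le'; have rr : (r S' <= r S)%N.
  by rewrite -(leq_add2r (h S')) (leq_trans le') // leq_add2l.
have {}hh : (h S' <= h S)%N.
  by rewrite -(leq_add2l (r S')) (leq_trans le') // leq_add2r.
move=> x S'x Kx; have [K'x|nK'x] := pselect (K' x); first exact: (imp rr).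
have /asboolP[t [St Kt K't]] : h S.
  apply: contraTT hh => /negbTE ->; rewrite -ltnNge.
  by suff -> : h S' by []; apply/asboolP; exists x.
have [c cP] := Ks t x Kt K't Kx.
have [_ SD SZ] := sS; rewrite -(subrK (c *: t) x); apply: SD; last exact: SZ.
by apply: (imp rr) => //; apply: ksubB => //; have [_ _ S'Z] := sS'; apply/S'Z/SS'.
Qed.

(** Additivity of length: to the rank on the kernel of u in K is added the rank of the image under u
    of the elements of S that lie in K. *)
Lemma ranked_ker (M N : lmodType k) (u : M -> N) (K : M -> Prop) : ksub K ->
  linear u -> ranked (fun _ : N => True) ->
  ranked (fun x => K x /\ u x = 0) -> ranked K.
Proof.
move=> sK lu [m [q [qm qP]]] [n [r [rn rP]]].
pose im (S : M -> Prop) (y : N) := exists x, [/\ S x, K x & y = u x].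
have sim S : ksub S -> ksub (im S).
  have [K0 KD KZ] := sK; case=> S0 SD SZ; split.
  - by exists 0; rewrite (linear_zero lu).
  - move=> _ _ [x [Sx Kx ->]] [y [Sy Ky ->]]; exists (x + y).
    by rewrite (linear_add lu); split; [apply: SD|apply: KD|].
  - move=> a _ [x [Sx Kx ->]]; exists (a *: x).
    by rewrite (linear_scale lu); split; [apply: SZ|apply: KZ|].
exists (n + m)%N, (fun S => (r S + q (im S))%N); split=> [S sS|S S' sS sS' SS'].
  by rewrite leq_add ?rn ?qm //; apply: sim.
have [le imp] := rP S S' sS sS' SS'.
have [ |le2 imp2] := qP (im S) (im S') (sim _ sS) (sim _ sS').
  by move=> _ [x [Sx Kx ->]]; exists x; split=> //; apply: SS'.
split; first exact: leq_add.
move=> le'; have rr : (r S' <= r S)%N.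
  by rewrite -(leq_add2r (q (im S'))) (leq_trans le') // leq_add2l.
have qq : (q (im S') <= q (im S))%N.
  by rewrite -(leq_add2l (r S')) (leq_trans le') // leq_add2r.
move=> x S'x Kx.
have [//|y [Sy Ky uxy]] := imp2 qq (u x) _ I; first by exists x.
have [_ SD _] := sS; rewrite -(subrK y x); apply: SD => //.
apply: (imp rr); first by apply: ksubB => //; apply: SS'.
split; first exact: ksubB.
by rewrite (linear_add lu) (linear_opp lu) uxy subrr.
Qed.

(** The maps u i embed M into a finite power of N; their kernels are cut out one at a time with
    [ranked_ker]. *)
Lemma ranked_joint (M N : lmodType k) (I : eqType) (s : seq I) (u : I -> M -> N) :
  (forall i, i \in s -> linear (u i)) -> ranked (fun _ : N => True) ->
  (forall x, (forall i, i \in s -> u i x = 0) -> x = 0) ->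
  ranked (fun _ : M => True).
Proof.
move=> lu rN u0.
suff gen (s' : seq I) : {subset s' <= s} -> ranked (fun x : M =>
    forall i, i \in s -> i \notin s' -> u i x = 0).
  by have := gen s (fun _ h => h); apply: ranked_ext => x _ i ->.
elim: s' => [|j s' IH] s's.
  by apply: ranked0 => x ux; apply: u0 => i si; apply: ux.
have js : j \in s by apply: s's; rewrite mem_head.
apply: (ranked_ker (u := u j)) => //.
- split=> [i si _|x y ux uy i si ni|a x ux i si ni].
  + exact: linear_zero (lu i si).
  + by rewrite (linear_add (lu i si)) ux // uy // addr0.
  + by rewrite (linear_scale (lu i si)) ux // scaler0.
- exact: lu.
have := IH (fun i (s'i : i \in behead (j :: s')) => s's i (mem_behead s'i)).
apply: ranked_ext => x [ux ujx] i si ni.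
by case: (eqVneq i j) => [->//|ij]; apply: ux; rewrite // inE negb_or ij.
Qed.

Lemma ranked_inj (M N : lmodType k) (u : M -> N) : linear u ->
  (forall x, u x = 0 -> x = 0) -> ranked (fun _ : N => True) ->
  ranked (fun _ : M => True).
Proof.
move=> lu u0 rN; apply: (@ranked_joint _ _ _ [:: tt] (fun _ => u)) => //.
by move=> x ux; apply: u0; apply: (ux tt); rewrite mem_head.
Qed.

Variables (gT : finGroupType) (D : {group gT}).
Implicit Type M : kmod k D.

Lemma submodule_ksub M (S : M -> Prop) : submodule S -> ksub S.
Proof. by case. Qed.

(* Among finitely many generators of S' over S, adjoin as many as possible
   without reaching S'. *)
Lemma last_generator M (S S' : M -> Prop) (s : seq M) : ksub S -> ksub S' ->
  (forall x, S x -> S' x) -> (exists2 x, S' x & ~ S x) ->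
  (forall y, y \in s -> S' y) ->
  (forall T, ksub T -> (forall x, S x -> T x) -> (forall y, y \in s -> T y) ->
     forall x, S' x -> T x) ->
  exists (N : M -> Prop) (y : M), [/\ ksub N, forall x, S x -> N x,
    forall x, N x -> S' x, S' y /\ ~ N y
    & forall x, S' x -> exists c, N (x - c *: y)].
Proof.
elim: s S => [|y s IH] S sS sS' SS' [x0 S'x0 Sx0] sS'' gen.
  by case: Sx0; apply: (gen S).
pose S1 x := exists c, S (x - c *: y).
have S'y : S' y by apply: sS''; rewrite mem_head.
have [S0 SD SZ] := sS; have [S'0 S'D S'Z] := sS'.
have sS1 : ksub S1.
  split=> [|u v [c Sc] [d Sd]|a u [c Sc]]; first by exists 0; rewrite scale0r subr0.
  - by exists (c + d); rewrite scalerDl opprD addrACA; apply: SD.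
  - by exists (a * c); rewrite -scalerA -scalerBr; apply: SZ.
have SS1 x : S x -> S1 x by move=> Sx; exists 0; rewrite scale0r subr0.
have S1y : S1 y by exists 1; rewrite scale1r subrr.
have [full|nfull] := pselect (forall x, S' x -> S1 x).
  exists S, y; split=> //; split=> // Sy; apply: Sx0.
  have [c Sc] := full _ S'x0; rewrite -(subrK (c *: y) x0); apply: SD => //.
  exact: SZ.
have [x1 S'x1 S1x1] : exists2 x, S' x & ~ S1 x.
  by apply: contrapT => h; apply: nfull => x S'x; apply: contrapT => nx; apply: h; exists x.
have [||||N [z [sN S1N NS' zP zgen]]] := IH S1 sS1 sS'.
- move=> x [c Sc]; rewrite -(subrK (c *: y) x); apply: S'D; first exact: SS'.
  exact: S'Z.
- by exists x1.
- by move=> z sz; apply: sS''; rewrite inE sz orbT.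
- move=> T sT S1T sT'; apply: gen => // [x /SS1 /S1T //|z].
  by rewrite inE => /predU1P[->|/sT' //]; apply: S1T.
by exists N, z; split=> // x /SS1 /S1N.
Qed.

(** The simple kD-module S'/S is generated over k by the translates of one element, so S' has a
    proper k-submodule N above S with cyclic quotient. Simplicity forces N to be maximal and the
    conjugates of N to intersect in S; so S'/S embeds into finitely many simple k-modules. *)
Lemma ranked_factor M (S S' : M -> Prop) : submodule S -> submodule S' ->
  simple_factor S S' -> ranked S -> ranked S'.
Proof.
move=> dS dS' [SS' [x0 S'x0 Sx0] simp] rS.
have sS := submodule_ksub dS; have sS' := submodule_ksub dS'.
have [S0 SD SZ SA] := dS; have [S'0 S'D S'Z S'A] := dS'.
pose gens := [seq act g x0 | g <- enum D].
have [||N [y [sN SN NS' [S'y Ny] ygen]]] :=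
    @last_generator M S S' gens sS sS' SS' (ex_intro2 _ _ x0 S'x0 Sx0).
- by move=> z /mapP[g]; rewrite mem_enum => gD ->; apply: S'A.
- move=> T sT ST gT'.
  (* [T1] is the largest D-submodule inside T and S'. It contains x0, which is not in S, so it is
     all of S'. *)
  pose T1 x := S' x /\ forall g, g \in D -> T (act g x).
  have [T0 TD TZ] := sT.
  have dT1 : submodule T1.
    split.
    + by split=> // g gD; rewrite (linear_zero (act_linear gD)).
    + move=> u v [S'u Tu] [S'v Tv]; split; first exact: S'D.
      by move=> g gD; rewrite (linear_add (act_linear gD)); apply: TD; auto.
    + move=> a u [S'u Tu]; split; first exact: S'Z.
      by move=> g gD; rewrite (linear_scale (act_linear gD)); apply: TZ; auto.
    + move=> h hD u [S'u Tu]; split; first exact: S'A.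
      by move=> g gD; rewrite -actM //; apply: Tu; apply: groupM.
  have [||h|h] := simp T1 dT1.
  + by move=> x Sx; split; [apply: SS' | move=> g gD; apply/ST/SA].
  + by move=> x [].
  + case: Sx0; apply: h; split=> // g gD; apply: gT'.
    by apply: map_f; rewrite mem_enum.
  + by move=> x /h[_ /(_ 1%g (group1 D))]; rewrite act1.
(* N is maximal in S': a scalar a with a y outside N maps S' onto S' / S. *)
have Nmax t x : S' t -> ~ N t -> S' x -> exists c, N (x - c *: t).
  have [N0 ND NZ] := sN.
  move=> S't Nt S'x; have [a Na] := ygen t S't.
  have Nay : ~ N (a *: y).
    by move=> Nay; apply: Nt; rewrite -(subrK (a *: y) t); apply: ND.
  pose T z := exists w, S' w /\ S (z - a *: w).
  have dT : submodule T.
    split.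
    + by exists 0; rewrite scaler0 subr0.
    + move=> u v [w [S'w Su]] [w' [S'w' Sv]]; exists (w + w').
      by split; [apply: S'D | rewrite scalerDr opprD addrACA; apply: SD].
    + move=> c u [w [S'w Su]]; exists (c *: w); split; first exact: S'Z.
      by rewrite scalerA mulrC -scalerA -scalerBr; apply: SZ.
    + move=> g gD u [w [S'w Su]]; exists (act g w); split; first exact: S'A.
      have lg := @act_linear _ _ _ M _ gD; rewrite -(linear_scale lg) -(linear_opp lg).
      by rewrite -(linear_add lg); apply: SA.
  have ST z : S z -> T z by move=> Sz; exists 0; rewrite scaler0 subr0.
  have TS' z : T z -> S' z.
    move=> [w [S'w Sz]]; rewrite -(subrK (a *: w) z); apply: S'D; first exact: SS'.
    exact: S'Z.
  have [h|h] := simp T dT ST TS'.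
    by case: Nay; apply/SN/h; exists y; rewrite subrr.
  have [w [S'w Sw]] := h y S'y.
  have [c Nc] := ygen w S'w.
  (* Modulo N one has y = aw, w = cy and t = ay, hence y = ct. *)
  have Ny' : N (y - c *: t).
    have -> : y - c *: t = (y - a *: w) + a *: (w - c *: y) - c *: (t - a *: y).
      rewrite !scalerBr opprB !scalerA (mulrC c a) !addrA subrK.
      by rewrite subrK.
    apply: ksubB => //; last exact: NZ.
    by apply: ND; [apply: SN | apply: NZ].
  have [d Nd] := ygen x S'x; exists (d * c).
  have -> : x - (d * c) *: t = (x - d *: y) + d *: (y - c *: t).
    by rewrite scalerBr scalerA addrA subrK.
  by apply: ND => //; apply: NZ.
(* The intersection of the conjugates of N is S; cut them out one by one. *)
pose K (s : seq gT) x := S' x /\ forall g, g \in s -> N (act g^-1 x).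
have sK s : {subset s <= D} -> ksub (K s).
  move=> sD; have [N0 ND NZ] := sN.
  split.
  - by split=> // g /sD gD; rewrite (linear_zero (act_linear (groupVr gD))).
  - move=> u v [S'u Nu] [S'v Nv]; split; first exact: S'D.
    by move=> g gs; rewrite (linear_add (act_linear (groupVr (sD _ gs)))); apply: ND; auto.
  - move=> a u [S'u Nu]; split; first exact: S'Z.
    by move=> g gs; rewrite (linear_scale (act_linear (groupVr (sD _ gs)))); apply: NZ; auto.
have KS : ranked (K (enum D)).
  move: rS; apply: ranked_ext => x [S'x Nx].
  pose T z := S' z /\ forall g, g \in D -> N (act g^-1 z).
  have dT : submodule T.
    have [|T0 TD TZ] := sK (enum D); first by move=> g; rewrite mem_enum.
    have KT z : K (enum D) z <-> T z.
      by split=> -[S'z Nz]; split=> // g gD; apply: Nz; rewrite mem_enum in gD *.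
    split; [exact/KT|by move=> u v /KT Tu /KT Tv; apply/KT/TD|
      by move=> a u /KT Tu; apply/KT/TZ|].
    move=> h hD u [S'u Nu]; split; first exact: S'A.
    move=> g gD; rewrite -actM ?groupV // -[h]invgK -invMg.
    by apply: Nu; rewrite groupM ?groupV.
  have [||h|h] := simp T dT.
  - by move=> z Sz; split; [apply: SS' | move=> g gD; apply/SN/SA; rewrite ?groupV].
  - by move=> z [].
  - by apply: h; split=> // g gD; apply: Nx; rewrite mem_enum.
  - by case: Ny; have [_ /(_ 1%g (group1 D))] := h y S'y; rewrite invg1 act1.
suff gen (s : seq gT) : {subset s <= D} -> ranked (K s) -> ranked S'.
  by apply: gen KS => g; rewrite mem_enum.
elim: s => [|g s IH] sD rK; first by move: rK; apply: ranked_ext => x S'x; split.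
have sD' : {subset s <= D} by move=> h hs; apply: sD; rewrite inE hs orbT.
have gD : g \in D by apply: sD; rewrite mem_head.
apply: IH => //; apply: ranked_simple rK => //; try exact: sK.
  by move=> x [S'x Nx]; split=> // h hs; apply: Nx; rewrite inE hs orbT.
move=> t x [S't Nt] nK [S'x Nx].
have Ngt : ~ N (act g^-1 t).
  by move=> Ng; apply: nK; split=> // h; rewrite inE => /predU1P[->|/Nt].
have [c Nc] := Nmax _ _ (S'A _ (groupVr gD) _ S't) Ngt (S'A _ (groupVr gD) _ S'x).
exists c.
have [_ _ S'ZZ] := sS'.
split; first by apply: (ksubB sS') => //; apply: S'Z.
have lV h : h \in D -> act h^-1 (x - c *: t) = act h^-1 x - c *: act h^-1 t.
  move=> hD; have lh := @act_linear _ _ _ M _ (groupVr hD).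
  by rewrite (linear_add lh) (linear_opp lh) (linear_scale lh).
move=> h; rewrite inE => /predU1P[->|hs]; first by rewrite lV.
rewrite lV; last exact: sD'.
by have [_ _ NZ] := sN; apply: ksubB => //; [apply: Nx | apply/NZ/Nt].
Qed.

Lemma finite_length_ranked M : finite_length M -> ranked (fun _ : M => True).
Proof.
case=> n [S [sub S0 Sn simp]].
suff gen i : (i <= n)%N -> ranked (S i).
  by have := gen n (leqnn n); apply: ranked_ext => x _; apply: Sn.
elim: i => [|i IH] ile; first exact: ranked0.
by apply: ranked_factor (IH (ltnW ile)) => //; apply: simp.
Qed.

(** The series climbs from 0: above S comes a submodule S' of least rank among those strictly
    larger. A submodule of S' that is strictly larger than S then has the rank of S', hence equals
    it. The bound n stops the climb. *)
Lemma ranked_finite_length M : ranked (fun _ : M => True) -> finite_length M.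
Proof.
case=> n [r [rn rP]].
pose step (S S' : M -> Prop) := simple_factor S S'.
suff gen m (S : M -> Prop) : submodule S -> (n - r S < m)%N ->
    exists (l : nat) (F : nat -> M -> Prop), [/\ forall i, submodule (F i),
      forall x, F 0%N x <-> S x, forall x, F l x
      & forall i, (i < l)%N -> simple_factor (F i) (F i.+1)].
  have s0 : submodule (fun x : M => x = 0).
    split=> // [x y -> ->|a x ->|g gD x ->]; first exact: addr0.
      exact: scaler0.
    exact: linear_zero (act_linear gD).
  have [l [F [sF F0 Fl Fs]]] := gen _ _ s0 (ltnSn _).
  by exists l, F; split=> // x /F0.
elim: m S => // m IH S dS lt.
have sS := submodule_ksub dS.
have [full|nfull] := pselect (forall x, S x).
  by exists 0%N, (fun _ => S); split.
pose good (j : nat) := exists S', [/\ submodule S', forall x, S x -> S' x,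
  exists x, ~ S x /\ S' x & r S' = j].
have sT : submodule (fun _ : M => True) by [].
have ex : exists j, `[< good j >].
  exists (r (fun _ => True)); apply/asboolP; exists (fun _ => True); split=> //.
  by apply: contrapT => h; apply: nfull => x; apply: contrapT => nx; apply: h; exists x.
case: (ex_minnP ex) => j /asboolP[S' [dS' SS' [x [nSx S'x]] rj]] minj.
have sS' := submodule_ksub dS'.
have [le imp] := rP S S' sS sS' SS'.
have rlt : (r S < r S')%N.
  by rewrite ltnNge; apply/negP => le'; apply: nSx; apply: imp.
have [l [F [sF F0 Fl Fs]]] : exists (l : nat) (F : nat -> M -> Prop),
    [/\ forall i, submodule (F i), forall x, F 0%N x <-> S' x, forall x, F l x
      & forall i, (i < l)%N -> simple_factor (F i) (F i.+1)].
  apply: IH => //; apply: leq_trans (_ : n - r S <= m)%N; last by [].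
  by rewrite ltn_sub2l // (leq_trans rlt) // rn.
exists l.+1, (fun i => if i is i'.+1 then F i' else S); split=> //.
  by case.
move=> [_|i]; last exact: Fs.
split; first by move=> z /SS' /F0.
  by exists x => //; apply/F0.
move=> T dT ST TF; have sT' := submodule_ksub dT.
have TS' z : T z -> S' z by move=> /TF /F0.
have [|nTS] := pselect (forall x, T x -> S x); [by left | right].
have [w Tw nSw] : exists2 w, T w & ~ S w.
  by apply: contrapT => h; apply: nTS => z Tz; apply: contrapT => nz; apply: h; exists z.
have jT : (j <= r T)%N.
  by apply: minj; apply/asboolP; exists T; split=> //; exists w.
have [_ impT] := rP T S' sT' sS' TS'.
by move=> z /F0 S'z; apply: impT => //; rewrite rj.
Qed.

End Rank.

Section Allowed.
Variables (k : comPzRingType) (gT : finGroupType) (H G : {group gT}).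
Hypothesis HG : H \subset G.

Lemma finite_length_res (M : kmod k G) : finite_length M -> finite_length (resM HG M).
Proof. by move=> /finite_length_ranked rM; apply: ranked_finite_length. Qed.

(** Over k, the coordinates at the cosets embed Ind M into a finite power of M. *)
Lemma finite_length_ind (M : kmod k H) : finite_length M -> finite_length (indM G M).
Proof.
move=> /finite_length_ranked rM; apply: ranked_finite_length.
apply: (@ranked_joint k (indM G M) M _ (enum (lcosets H G))
  (fun C u => ipi (act (repr C)^-1 u))) => //.
- move=> C; rewrite mem_enum => CG; have rG := reprA (subxx G) HG CG.
  by move=> a x y; rewrite (act_linear (groupVr rG)) ipi_linear.
- move=> u u0; rewrite -[u](tr_eta_pi HG) /tr big1 // => C CG.
  rewrite /conjt u0 ?mem_enum // (linear_zero (@ieta_linear _ _ _ _ _)).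
  exact: linear_zero (act_linear (reprA (subxx G) HG CG)).
Qed.

Lemma zero_module_ind (M : kmod k H) : zero_module M -> zero_module (indM G M).
Proof.
move=> M0 u; rewrite -[u](tr_eta_pi HG) /tr big1 // => C CG.
rewrite /conjt (M0 (ipi _)) (linear_zero (@ieta_linear _ _ _ _ _)).
exact: linear_zero (act_linear (reprA (subxx G) HG CG)).
Qed.

Lemma has_bounds_mono (A B : {group gT}) b (X : Cpx (Mod k A)) (Y : Cpx (Mod k B)) :
  (forall n, zero_module (X n) -> zero_module (Y n)) ->
  has_bounds b X -> has_bounds b Y.
Proof.
move=> XY.
have ab : bounded_above X -> bounded_above Y.
  by case=> N h; exists N => n /h /XY.
have bb : bounded_below X -> bounded_below Y.
  by case=> N h; exists N => n /h /XY.
by case: b => //= -[/ab hY /bb hY'].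
Qed.

Lemma allowed_res fl b (X : Cpx (Mod k G)) : allowed fl b X ->
  allowed fl b (cpx_functor (res k HG) X).
Proof.
case=> hb hf; split=> [|/hf h n]; last exact: finite_length_res.
by apply: has_bounds_mono hb.
Qed.

Lemma allowed_ind fl b (X : Cpx (Mod k H)) : allowed fl b X ->
  allowed fl b (cpx_functor (ind H G) X).
Proof.
case=> hb hf; split=> [|/hf h n]; last exact: finite_length_ind.
by apply: has_bounds_mono hb => n; apply: zero_module_ind.
Qed.

End Allowed.

(** * Additive quotients *)

Section Additive.
Variable C : category.

Lemma compBl (X Y Z : C) (g g' : hom Y Z) (f : hom X Y) :
  (g - g') \oc f = g \oc f - g' \oc f.
Proof. by rewrite compDl compNl. Qed.

Lemma compBr (X Y Z : C) (g : hom Y Z) (f f' : hom X Y) :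
  g \oc (f - f') = g \oc f - g \oc f'.
Proof. by rewrite compDr compNr. Qed.

Definition biproducts : Prop := forall X Y : C,
  exists (S : C) (i1 : hom X S) (i2 : hom Y S) (p1 : hom S X) (p2 : hom S Y),
    [/\ p1 \oc i1 = idm X, p2 \oc i2 = idm Y, p1 \oc i2 = 0, p2 \oc i1 = 0
      & i1 \oc p1 + i2 \oc p2 = idm S].

Definition zero_object (Z : C) : Prop := idm Z = 0.

Definition idem_split : Prop := forall (X : C) (e : hom X X), e \oc e = e ->
  exists (Y : C) (i : hom Y X) (p : hom X Y), p \oc i = idm Y /\ i \oc p = e.

(** Weaker than [idem_split]: only the complement of a split monomorphism has to exist. A quotient
    has this property when idempotents split in the category above it ([quot_mono_split]), and it
    suffices to turn retracts into direct summands. *)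
Definition mono_split : Prop := forall (X Y : C) (j : hom X Y) (r : hom Y X),
  r \oc j = idm X -> exists (Z : C) (i : hom Z Y) (p : hom Y Z),
    p \oc i = idm Z /\ i \oc p = idm Y - j \oc r.

Lemma idem_compl (X Y : C) (j : hom X Y) (r : hom Y X) : r \oc j = idm X ->
  (idm Y - j \oc r) \oc (idm Y - j \oc r) = idm Y - j \oc r.
Proof.
move=> rj; rewrite compBl comp1m compBr compm1 -compA (compA r) rj comp1m.
by rewrite subrr subr0.
Qed.

Lemma idem_mono_split : idem_split -> mono_split.
Proof. by move=> is_ X Y j r rj; apply: is_; apply: idem_compl. Qed.

Variable S : C -> Prop.
Definition factors1 (X Y : C) (f : hom X Y) : Prop :=
  exists (Z : C) (a : hom X Z) (b : hom Z Y), S Z /\ f = b \oc a.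

(** The single equation i1 p1 + i2 p2 = 1 says that W is a retract of a sum of X and Y, so closure
    under direct summands of such sums is included. *)
Definition sum_closed : Prop :=
  (exists2 Z, S Z & zero_object Z) /\
  forall (X Y W : C) (i1 : hom X W) (i2 : hom Y W) (p1 : hom W X) (p2 : hom W Y),
    i1 \oc p1 + i2 \oc p2 = idm W -> S X -> S Y -> S W.

Lemma factors1P : biproducts -> sum_closed ->
  forall (X Y : C) (f : hom X Y), factors S f -> factors1 f.
Proof.
move=> bi [[Z0 SZ0 Z0P] Ssum] X Y f; elim=> [|{}f Z a b SZ _ [W [c [d [SW ->]]]]].
  by exists Z0, 0, 0; rewrite comp0l.
have [B [i1 [i2 [p1 [p2 [p11 p22 p12 p21 e]]]]]] := bi W Z.
exists B, (i1 \oc c + i2 \oc a), (d \oc p1 + b \oc p2).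
split; first exact: Ssum e SW SZ.
rewrite compDl !compDr -!compA !(compA p1) !(compA p2) p11 p22 p12 p21.
by rewrite !comp0l !comp1m !comp0r addr0 add0r.
Qed.

Lemma factors1W (X Y : C) (f : hom X Y) : factors1 f -> factors S f.
Proof.
move=> [Z [a [b [SZ ->]]]]; rewrite -[_ \oc _]add0r.
by apply: factorsD => //; apply: factors0.
Qed.

Lemma quot_pi0 (X Y : C) (f : hom X Y) : quot_pi S f = 0 <-> factors S f.
Proof.
have -> : (0 : quot_hom S X Y) = quot_pi S 0 by rewrite /quot_pi !piE.
by rewrite quot_piP subr0.
Qed.

Lemma quot_piB (X Y : C) (f g : hom X Y) :
  quot_pi S (f - g) = quot_pi S f - quot_pi S g.
Proof. by rewrite /quot_pi !piE. Qed.

End Additive.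

Section QuotientSplit.
Variables (C : category) (S : C -> Prop).
Hypotheses (bi : biproducts C) (Ssum : sum_closed S) (spl : idem_split C).
Notation Q := (quot S).

Definition qp (X Y : C) (f : hom X Y) : @hom Q X Y := quot_pi S f.

Lemma qpM (X Y Z : C) (g : hom Y Z) (f : hom X Y) :
  qp (g \oc f) = @comp Q X Y Z (qp g) (qp f).
Proof. exact: esym (quot_compE S g f). Qed.

Lemma qp1 (X : C) : qp (idm X) = @idm Q X.
Proof. by []. Qed.

Lemma qpD (X Y : C) (f g : hom X Y) : qp (f + g) = qp f + qp g.
Proof. exact: quot_piD. Qed.

Lemma qpB (X Y : C) (f g : hom X Y) : qp (f - g) = qp f - qp g.
Proof. exact: quot_piB. Qed.

Lemma qp0 (X Y : C) (f : hom X Y) : qp f = 0 <-> factors S f.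
Proof. exact: quot_pi0. Qed.

Lemma quot_lift (X Y : C) (u : @hom Q X Y) : exists f : hom X Y, qp f = u.
Proof. by exists (quot_repr u); apply: quot_reprK. Qed.

Lemma qp_factor (X Y Z : C) (b : hom Z Y) (a : hom X Z) : S Z ->
  @comp Q X Z Y (qp b) (qp a) = 0.
Proof.
move=> SZ; rewrite -qpM; apply/qp0; rewrite -[_ \oc _]add0r.
by apply: factorsD => //; apply: factors0.
Qed.

(* If 1 - rj = ba factors through W, then (j, a) : X -> Y + W is split
   by (r, b) on the nose. *)
Lemma quot_mono_split : mono_split Q.
Proof.
change (forall (X Y : C) (j : @hom Q X Y) (r : @hom Q Y X),
  @comp Q X Y X r j = @idm Q X -> exists (Z : C) (i : @hom Q Z Y) (p : @hom Q Y Z),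
  @comp Q Z Y Z p i = @idm Q Z /\ @comp Q Y Z Y i p = @idm Q Y - @comp Q Y X Y j r).
move=> X Y j0 r0; have [j <-] := quot_lift j0; have [r <-] := quot_lift r0.
rewrite -qpM -qp1 => rj.
have : factors S (idm X - r \oc j) by apply/quot_piP; apply: esym.
move/(factors1P bi Ssum) => [W [a [b [SW rjba]]]].
have [B [i1 [i2 [p1 [p2 [p11 p22 p12 p21 e]]]]]] := bi Y W.
pose J := i1 \oc j + i2 \oc a; pose R := r \oc p1 + b \oc p2.
have RJ : R \oc J = idm X.
  rewrite /R /J compDl !compDr -!compA !(compA p1) !(compA p2) p11 p22 p12 p21.
  by rewrite !comp0l !comp1m !comp0r addr0 add0r -rjba addrC subrK.
have p1J : p1 \oc J = j by rewrite compDr !compA p11 p12 comp1m comp0l addr0.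
have Ri1 : R \oc i1 = r by rewrite compDl -!compA p11 p21 compm1 comp0r addr0.
have [Z [i [p [pi ip]]]] := spl (idem_compl RJ).
exists Z, (qp (p1 \oc i)), (qp (p \oc i1)).
rewrite -!qpM -qp1 -qpB; split.
- have -> : p \oc i1 \oc (p1 \oc i) = idm Z - p \oc i2 \oc (p2 \oc i).
    have E : p \oc i = p \oc i1 \oc (p1 \oc i) + p \oc i2 \oc (p2 \oc i).
      by rewrite -[i in LHS]comp1m -e compDl compDr !compA.
    by rewrite -pi E addrK.
  by rewrite qpB [qp (_ \oc i2 \oc _)]qpM qp_factor // subr0.
- congr qp; rewrite -compA (compA i) ip compBl comp1m compBr p11.
  by rewrite -compA Ri1 compA p1J.
Qed.

Lemma quot_idem_split_lift :
  (forall (X : C) (f : hom X X), factors S (f - f \oc f) ->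
     exists e : hom X X, e \oc e = e /\ factors S (f - e)) ->
  idem_split Q.
Proof.
move=> lift.
change (forall (X : C) (f0 : @hom Q X X), @comp Q X X X f0 f0 = f0 ->
  exists (Z : C) (i : @hom Q Z X) (p : @hom Q X Z),
  @comp Q Z X Z p i = @idm Q Z /\ @comp Q X Z X i p = f0).
move=> X f0; have [f <-] := quot_lift f0; rewrite -qpM => /esym/quot_piP ff.
have [e [ee fe]] := lift X f ff.
have [Z [i [p [pi ip]]]] := spl ee.
exists Z, (qp i), (qp p); rewrite -!qpM pi ip; split=> //.
by apply: esym; apply/quot_piP.
Qed.

(* For T X = X + X + ..., with s the shift, s' its left inverse and i0, p0
   the first summand, an idempotent e gives j = s T(e) + T(1 - e) with left
   inverse r = T(e) s' + T(1 - e), and the complement 1 - jr = i0 e p0 is a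
   copy of the image of e. *)
Lemma quot_idem_split_swindle (T : functor C C)
    (s s' : forall X : C, hom (T X) (T X)) (i0 : forall X : C, hom X (T X))
    (p0 : forall X : C, hom (T X) X) :
  (forall X, S X -> S (T X)) ->
  (forall X, s' X \oc s X = idm (T X)) ->
  (forall X, p0 X \oc i0 X = idm X) ->
  (forall X, s X \oc s' X + i0 X \oc p0 X = idm (T X)) ->
  (forall X Y (f : hom X Y), s Y \oc fmap T f = fmap T f \oc s X) ->
  (forall X Y (f : hom X Y), s' Y \oc fmap T f = fmap T f \oc s' X) ->
  (forall X Y (f : hom X Y), i0 Y \oc f = fmap T f \oc i0 X) ->
  (forall X Y (f : hom X Y), p0 Y \oc fmap T f = f \oc p0 X) ->
  idem_split Q.
Proof.
move=> TS s's p0i0 ss' sT s'T i0T p0T.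
change (forall (X : C) (f0 : @hom Q X X), @comp Q X X X f0 f0 = f0 ->
  exists (Z : C) (i : @hom Q Z X) (p : @hom Q X Z),
  @comp Q Z X Z p i = @idm Q Z /\ @comp Q X Z X i p = f0).
move=> X f0; have [f <-] := quot_lift f0.
rewrite -qpM => ee.
pose TX : Q := T X.
pose F (g : hom X X) : @hom Q TX TX := qp (fmap T g).
have FM g h : qp (g \oc h) = qp g -> F (g \oc h) = F g.
  rewrite /F => /quot_piP gh; apply/quot_piP; rewrite -fmapN -fmapD.
  exact: fmap_factors gh.
pose e : @hom Q TX TX := F f; pose e' : @hom Q TX TX := F (idm X - f).
pose u : @hom Q TX TX := qp (s X); pose u' : @hom Q TX TX := qp (s' X).
have eE : @comp Q _ _ _ e e = e by rewrite /e /F -qpM -fmapM; apply: FM.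
have e'E : e' = @idm Q TX - e by rewrite /e' /F fmapD fmapN fmap1 qpB.
have ee' : @comp Q _ _ _ e e' = 0 by rewrite e'E compBr compm1 eE subrr.
have e'e : @comp Q _ _ _ e' e = 0 by rewrite e'E compBl comp1m eE subrr.
have e'e' : @comp Q _ _ _ e' e' = e' by rewrite {2}e'E compBr compm1 e'e subr0.
have u'u : @comp Q _ _ _ u' u = @idm Q TX by rewrite -qpM s's.
have uF g : @comp Q _ _ _ u (F g) = @comp Q _ _ _ (F g) u by rewrite /F -!qpM sT.
have u'F g : @comp Q _ _ _ u' (F g) = @comp Q _ _ _ (F g) u' by rewrite /F -!qpM s'T.
pose j : @hom Q TX TX := @comp Q _ _ _ u e + e'.
pose r : @hom Q TX TX := @comp Q _ _ _ e u' + e'.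
have rj : @comp Q _ _ _ r j = @idm Q TX.
  rewrite /r /j compDl !compDr -!compA (compA u') u'u comp1m eE.
  rewrite (u'F (idm X - f)) (compA e) ee' comp0l.
  by rewrite (uF f) (compA e') e'e comp0l e'e' addr0 add0r e'E addrC subrK.
have [Z [i [p [pi ip]]]] := quot_mono_split rj.
pose i0' : @hom Q X TX := qp (i0 X); pose p0' : @hom Q TX X := qp (p0 X).
pose g : @hom Q X X := qp f.
have gg : @comp Q _ _ _ g g = g by rewrite -qpM.
have p0i0' : @comp Q _ _ _ p0' i0' = @idm Q X by rewrite -qpM p0i0.
have jr : @idm Q TX - @comp Q _ _ _ j r = @comp Q _ _ _ (@comp Q _ _ _ i0' g) p0'.
  have -> : @comp Q _ _ _ j r = @comp Q _ _ _ (@comp Q _ _ _ u e) u' + e'.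
    rewrite /r /j compDl !compDr -!compA (compA e e) eE ee' comp0r addr0.
    by rewrite (compA e' e) e'e comp0l add0r e'e'.
  rewrite uF e'E opprD opprB addrCA [idm _ + _]addrCA subrr addr0 addrC.
  have -> : @comp Q _ _ _ i0' g = @comp Q _ _ _ e i0' by rewrite -!qpM i0T.
  rewrite -!compA -[X in X - _]compm1 -compBr; congr comp.
  have <- : qp (s X \oc s' X + i0 X \oc p0 X) = @idm Q TX by rewrite ss'.
  by rewrite qpD !qpM addrC addKr.
rewrite jr in ip.
exists Z, (@comp Q _ _ _ (@comp Q _ _ _ g p0') i),
  (@comp Q _ _ _ p (@comp Q _ _ _ i0' g)); split.
  rewrite -!compA (compA g g) gg (compA g p0' i) (compA i0' _ i).
  by rewrite (compA i0' g p0') -ip -compA pi compm1 pi.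
rewrite -!compA (compA i) ip -!compA (compA p0') p0i0' comp1m.
by rewrite (compA p0') p0i0' comp1m !gg.
Qed.

End QuotientSplit.

(** * Natural isomorphisms and equivalences *)

Section Equivalences.

Lemma nat_iso_trans (A B : category) (F F' F'' : functor A B) :
  nat_iso F F' -> nat_iso F' F'' -> nat_iso F F''.
Proof.
case=> a [b [an ba ab]] [c [d [cn dc cd]]].
exists (fun X => c X \oc a X), (fun X => b X \oc d X); split=> [X Y f|X|X].
- by rewrite -compA an compA cn -compA.
- by rewrite -compA (compA (d X)) dc comp1m ba.
- by rewrite -compA (compA (a X)) ab comp1m cd.
Qed.

Lemma nat_iso_sym (A B : category) (F F' : functor A B) :
  nat_iso F F' -> nat_iso F' F.
Proof.
case=> a [b [an ba ab]]; exists b, a; split=> // X Y f.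
by rewrite -[LHS]compm1 -ab compA -(compA _ _ (a X)) -an compA ba comp1m.
Qed.

Lemma nat_iso_compl (A B C : category) (K : functor B C) (F F' : functor A B) :
  nat_iso F F' -> nat_iso (functor_comp K F) (functor_comp K F').
Proof.
case=> a [b [an ba ab]]; exists (fun X => fmap K (a X)), (fun X => fmap K (b X)).
by split=> [X Y f|X|X] /=; rewrite -!fmapM ?an ?ba ?ab ?fmap1.
Qed.

Lemma nat_iso_compr (A B C : category) (K : functor A B) (F F' : functor B C) :
  nat_iso F F' -> nat_iso (functor_comp F K) (functor_comp F' K).
Proof.
case=> a [b [an ba ab]]; exists (fun X => a (K X)), (fun X => b (K X)).
by split=> [X Y f|X|X] /=; rewrite ?an ?ba ?ab.
Qed.

Lemma ff_es_equivalence (A B : category) (F : functor A B) :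
  (forall X Y (u : hom (F X) (F Y)), exists f, fmap F f = u) ->
  (forall X Y (f : hom X Y), fmap F f = 0 -> f = 0) ->
  (forall Y, exists X (a : hom (F X) Y) (b : hom Y (F X)),
     a \oc b = idm Y /\ b \oc a = idm (F X)) ->
  exists F' : functor B A, inverse_equivalences F F'.
Proof.
move=> full faithful es.
have inj X Y (f g : hom X Y) : fmap F f = fmap F g -> f = g.
  move=> fg; apply/eqP; rewrite -subr_eq0; apply/eqP; apply: faithful.
  by rewrite fmapD fmapN fg subrr.
have pick Y : {X : A & {ab : hom (F X) Y * hom Y (F X) |
    ab.1 \oc ab.2 = idm Y /\ ab.2 \oc ab.1 = idm (F X)}}.
  have /cid[X /cid[a /cid[b ab]]] := es Y.
  by exists X, (a, b).
pose ob Y := projT1 (pick Y).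
pose a Y : hom (F (ob Y)) Y := (sval (projT2 (pick Y))).1.
pose b Y : hom Y (F (ob Y)) := (sval (projT2 (pick Y))).2.
have ab Y : a Y \oc b Y = idm Y by case: (svalP (projT2 (pick Y))).
have ba Y : b Y \oc a Y = idm (F (ob Y)) by case: (svalP (projT2 (pick Y))).
pose m Y Y' (g : hom Y Y') : hom (ob Y) (ob Y') :=
  sval (cid (full _ _ (b Y' \oc g \oc a Y))).
have mE Y Y' (g : hom Y Y') : fmap F (m Y Y' g) = b Y' \oc g \oc a Y.
  by rewrite /m; case: cid.
have mD Y Y' (g h : hom Y Y') : m _ _ (g + h) = m _ _ g + m _ _ h.
  by apply: inj; rewrite fmapD !mE compDr compDl.
have m1 Y : m _ _ (idm Y) = idm (ob Y).
  by apply: inj; rewrite fmap1 mE compm1 ba.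
have mM X Y Z (g : hom Y Z) (h : hom X Y) : m _ _ (g \oc h) = m _ _ g \oc m _ _ h.
  apply: inj; rewrite fmapM !mE -!compA (compA (a Y)) ab comp1m.
  by rewrite !compA.
exists (@Functor B A ob m mD m1 mM); split.
- exists (fun X => sval (cid (full _ _ (a (F X))))),
    (fun X => sval (cid (full _ _ (b (F X))))).
  split=> [X Y f|X|X].
  + case: cid => u uE; case: cid => v vE /=; apply: inj.
    by rewrite !fmapM uE vE mE !compA ab comp1m.
  + case: cid => u uE; case: cid => v vE /=; apply: inj.
    by rewrite !fmapM uE vE ba fmap1.
  + case: cid => u uE; case: cid => v vE /=; apply: inj.
    by rewrite !fmapM uE vE ab fmap1.
- exists a, b; split=> // X Y f.
  by rewrite /= mE !compA ab comp1m.
Qed.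

End Equivalences.

(** * Countable sums and images of idempotents *)

Section ModuleConstructions.
Variables (k : comPzRingType) (gT : finGroupType) (A : {group gT}).
Implicit Types M N : kmod k A.

Program Definition sumM M N : kmod k A :=
  @Kmod k gT A (M * N)%type (fun g x => (act g x.1, act g x.2)) _ _ _.
Next Obligation.
by move=> M N g gA a x y; congr pair => /=; rewrite (act_linear gA).
Qed.
Next Obligation. by move=> M N [x y]; rewrite /= !act1. Qed.
Next Obligation. by move=> M N g h gA hA [x y]; rewrite /= !actM. Qed.

Program Definition zeroM : kmod k A :=
  @Kmod k gT A {ffun void -> k^o} (fun _ x => x) _ _ _.
Next Obligation. by []. Qed.
Next Obligation. by []. Qed.
Next Obligation. by []. Qed.

Lemma zeroMP : zero_module zeroM.
Proof. by move=> x; apply/ffunP => -[]. Qed.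

Section Fixed.
Variables (M : kmod k A) (e : khom M M).

(** For an idempotent e this is its image, cut out by an equation. *)
Definition fixed : pred M := fun x => e x == x.

Lemma fixed_closed : submod_closed fixed.
Proof.
split=> [|a x y /eqP ex /eqP ey]; apply/eqP.
  exact: linear_zero (khom_linear e).
by rewrite khom_linear ex ey.
Qed.

HB.instance Definition _ := GRing.isSubmodClosed.Build k M fixed
  (GRing.submod_closed_semi fixed_closed).

Definition fixT : Type := {x : M | fixed x}.
HB.instance Definition _ := SubType.copy fixT {x : M | fixed x}.
HB.instance Definition _ := Choice.copy fixT {x : M | fixed x}.
HB.instance Definition _ := [SubChoice_isSubLmodule of fixT by <:].

Lemma fixed_act g x : g \in A -> fixed x -> fixed (act g x).
Proof. by move=> gA /eqP ex; apply/eqP; rewrite khom_act // ex. Qed.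

(** For g outside A nothing is known of [act g], which may leave the fixed points; [insubd] then
    falls back to 0. *)
Definition fix_act (g : gT) (x : fixT) : fixT :=
  insubd (0 : fixT) (act g (val x)).

Lemma val_fix_act g x : g \in A -> val (fix_act g x) = act g (val x).
Proof.
move=> gA; rewrite val_insubd; case: ifP => // /negP[].
exact: fixed_act (valP x).
Qed.

Lemma val_fixP a (x y : fixT) : val (a *: x + y) = a *: val x + val y.
Proof. by rewrite GRing.valD GRing.valZ. Qed.

Program Definition fixM : kmod k A := @Kmod k gT A fixT fix_act _ _ _.
Next Obligation.
move=> g gA a x y; apply: val_inj.
by rewrite val_fixP !val_fix_act // val_fixP (act_linear gA).
Qed.
Next Obligation.
by move=> x; apply: val_inj; rewrite val_fix_act ?group1 // act1.
Qed.
Next Obligation.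
move=> g h gA hA x; apply: val_inj.
by rewrite !val_fix_act ?groupM // actM.
Qed.

Definition fix_in (x : fixM) : M := val (x : fixT).

Lemma fix_in_linear : linear fix_in.
Proof. by move=> a x y; rewrite /fix_in val_fixP. Qed.

Lemma fix_in_act g (x : fixM) : g \in A -> fix_in (act g x) = act g (fix_in x).
Proof. exact: val_fix_act. Qed.

Lemma fix_in_inj : injective fix_in.
Proof. exact: val_inj. Qed.

Lemma fix_in_e (x : fixM) : e (fix_in x) = fix_in x.
Proof. by apply/eqP; apply: (valP (x : fixT)). Qed.

Definition fix_out (x : M) : fixM := insubd (0 : fixT) (e x).

Lemma fix_outK (x : M) : e (e x) = e x -> fix_in (fix_out x) = e x.
Proof.
by move=> ee; rewrite /fix_in val_insubd; case: ifP => // /negP[]; apply/eqP.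
Qed.
End Fixed.

Section Sequences.
Variable M : kmod k A.

(** This gives the countable direct sum and not the product: maps out of it are determined on the
    summands, which is what lets it preserve E-projectivity. *)
Definition finsupp : pred (nat -> M) :=
  fun f => `[< exists m : nat, forall n, (m <= n)%N -> f n = 0 >].

Lemma finsupp_closed : submod_closed finsupp.
Proof.
split=> [|a f g /asboolP[m fm] /asboolP[n gn]]; apply/asboolP; first by exists 0%N.
exists (maxn m n) => i; rewrite geq_max => /andP[mi ni].
rewrite -[LHS]/(a *: f i + g i).
by rewrite fm // gn // scaler0 addr0.
Qed.

HB.instance Definition _ := GRing.isSubmodClosed.Build k (nat -> M) finsupp
  (GRing.submod_closed_semi finsupp_closed).

Definition seqT : Type := {f : nat -> M | finsupp f}.
HB.instance Definition _ := SubType.copy seqT {f : nat -> M | finsupp f}.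
HB.instance Definition _ := Choice.copy seqT {f : nat -> M | finsupp f}.
HB.instance Definition _ := [SubChoice_isSubLmodule of seqT by <:].

Definition nthT (f : seqT) (n : nat) : M := val f n.

Lemma nthT_inj (f g : seqT) : (forall n, nthT f n = nthT g n) -> f = g.
Proof. by move=> fg; apply: val_inj; apply: funext. Qed.

Lemma nthT_linear n : linear (nthT^~ n).
Proof. by move=> a f g; rewrite /nthT GRing.valD GRing.valZ. Qed.

Lemma nthT_supp (f : seqT) : exists m : nat, forall n, (m <= n)%N -> nthT f n = 0.
Proof. by apply/asboolP; apply: (valP f). Qed.

Definition mkT (f : nat -> M) : seqT := insubd (0 : seqT) f.

Lemma mkTE (f : nat -> M) n : (exists m : nat, forall n, (m <= n)%N -> f n = 0) ->
  nthT (mkT f) n = f n.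
Proof.
by move=> hf; rewrite /nthT val_insubd; case: ifP => // /negP[]; apply/asboolP.
Qed.

Lemma act_supp (f : seqT) g : g \in A ->
  exists m : nat, forall n, (m <= n)%N -> act g (nthT f n) = 0.
Proof.
move=> gA; have [m fm] := nthT_supp f; exists m => n /fm ->.
exact: linear_zero (act_linear gA).
Qed.

Program Definition seqM : kmod k A :=
  @Kmod k gT A seqT (fun g f => mkT (fun n => act g (nthT f n))) _ _ _.
Next Obligation.
move=> g gA a f h; apply: nthT_inj => n; rewrite nthT_linear !mkTE; try exact: act_supp.
by rewrite nthT_linear (act_linear gA).
Qed.
Next Obligation.
move=> f; apply: nthT_inj => n; rewrite mkTE ?act1 //.
exact: (act_supp _ (group1 A)).
Qed.
Next Obligation.
move=> g h gA hA f; apply: nthT_inj => n; rewrite !mkTE; try exact: act_supp.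
  by rewrite actM.
exact: (act_supp _ (groupM gA hA)).
Qed.

Lemma nth_act g (f : seqM) n : g \in A ->
  nthT (act g f : seqM) n = act g (nthT f n).
Proof. by move=> gA; rewrite mkTE //; apply: act_supp. Qed.

End Sequences.

Section SequenceMaps.
Variables M N : kmod k A.

Definition map_seq (t : M -> N) (f : seqM M) : seqM N := mkT (fun n => t (nthT f n)).

Lemma map_seqE (t : M -> N) (f : seqM M) n : t 0 = 0 ->
  nthT (map_seq t f) n = t (nthT f n).
Proof.
by move=> t0; rewrite mkTE //; have [m fm] := nthT_supp f; exists m => i /fm ->.
Qed.

Lemma map_seq_linear (t : M -> N) : linear t -> linear (map_seq t).
Proof.
move=> lt a f h; have t0 := linear_zero lt; apply: nthT_inj => n.
by rewrite nthT_linear !map_seqE // nthT_linear lt.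
Qed.

Lemma map_seq_equi (P : {group gT}) (t : M -> N) : P \subset A -> linear t -> equivariant P t ->
  equivariant P (map_seq t).
Proof.
move=> PA lt et g gP f; have t0 := linear_zero lt; have gA := subsetP PA _ gP.
by apply: nthT_inj => n; rewrite map_seqE // !nth_act // map_seqE // et.
Qed.

End SequenceMaps.

Section Shift.
Variable M : kmod k A.

Definition shift (f : seqM M) : seqM M :=
  mkT (fun n => if n is n'.+1 then nthT f n' else 0).
Definition unshift (f : seqM M) : seqM M := mkT (fun n => nthT f n.+1).
Definition seq_in (j : nat) (x : M) : seqM M := mkT (fun n => if n == j then x else 0).
Definition seq_out (f : seqM M) : M := nthT f 0.

Lemma shiftE f n : nthT (shift f) n = if n is n'.+1 then nthT f n' else 0.
Proof.
by rewrite mkTE //; have [m fm] := nthT_supp f; exists m.+1 => -[|i] // /fm.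
Qed.
Lemma unshiftE f n : nthT (unshift f) n = nthT f n.+1.
Proof.
rewrite mkTE //; have [m fm] := nthT_supp f; exists m => i mi.
by apply: fm; apply: leqW.
Qed.
Lemma seq_inE j x n : nthT (seq_in j x) n = if n == j then x else 0.
Proof.
rewrite mkTE //; exists j.+1 => i ji; case: eqP => // ij.
by rewrite ij ltnn in ji.
Qed.

Lemma shift_linear : linear shift.
Proof.
move=> a f g; apply: nthT_inj => n; rewrite nthT_linear !shiftE.
by case: n => [|n]; rewrite ?nthT_linear // scaler0 addr0.
Qed.
Lemma unshift_linear : linear unshift.
Proof.
by move=> a f g; apply: nthT_inj => n; rewrite nthT_linear !unshiftE nthT_linear.
Qed.
Lemma seq_in_linear j : linear (seq_in j).
Proof.
move=> a x y; apply: nthT_inj => n; rewrite nthT_linear !seq_inE.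
by case: eqP => // _; rewrite scaler0 addr0.
Qed.

Lemma shift_equi : equivariant A shift.
Proof.
move=> g gA f; apply: nthT_inj => n; rewrite nth_act // !shiftE.
case: n => [|n]; last by rewrite nth_act.
by rewrite (linear_zero (act_linear gA)).
Qed.
Lemma unshift_equi : equivariant A unshift.
Proof.
by move=> g gA f; apply: nthT_inj => n; rewrite nth_act // !unshiftE nth_act.
Qed.
Lemma seq_in_equi j : equivariant A (seq_in j).
Proof.
move=> g gA x; apply: nthT_inj => n; rewrite nth_act // !seq_inE.
by case: eqP => // _; rewrite (linear_zero (act_linear gA)).
Qed.

End Shift.
End ModuleConstructions.

Section ComplexConstructions.
Variables (k : comPzRingType) (gT : finGroupType) (A : {group gT}).

Lemma dif2 (X : cx k A) n (x : X n) : dif (dif x) = 0.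
Proof. exact (mod_app (diff2 X n) x). Qed.

Program Definition mkC (X : int -> kmod k A) (d : forall n, X n -> X (n + 1))
    (ld : forall n, linear (@d n)) (ed : forall n, equivariant A (@d n))
    (dd : forall n x, d (n + 1) (d n x) = 0) : cx k A :=
  @Complex (Mod k A) X (fun n => Khom (ld n) (ed n)) _.
Next Obligation. by move=> X d ld ed dd n; apply: Mod_eq => x; apply: dd. Qed.

Lemma ev_dif (X Y : cx k A) (f : chain_map X Y) n (x : X n) :
  ev f (dif x) = dif (ev f x).
Proof. by have [_ _ ->] := is_map_ev f (subxx A). Qed.

Lemma ev_lin (X Y : cx k A) (f : chain_map X Y) n : linear (@ev _ _ _ _ _ f n).
Proof. by have [] := is_map_ev f (subxx A). Qed.

Lemma ev_act (X Y : cx k A) (f : chain_map X Y) n g (x : X n) : g \in A ->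
  ev f (act g x) = act g (ev f x).
Proof. by have [_ + _] := is_map_ev f (subxx A) => /[apply]; apply. Qed.

Lemma ev0 (X Y : cx k A) (f : chain_map X Y) n : ev f (0 : X n) = 0.
Proof. exact (linear_zero (@ev_lin X Y f n)). Qed.

Section Sum.
Variables X Y : cx k A.

Program Definition sumC : cx k A :=
  @mkC (fun n => sumM (X n) (Y n)) (fun n x => (dif x.1, dif x.2)) _ _ _.
Next Obligation.
by move=> n a x y; congr pair => /=; rewrite dif_linear.
Qed.
Next Obligation.
move=> n g gA [x y]; congr pair => /=.
  exact: (khom_act (diff X n : khom _ _) gA).
exact: (khom_act (diff Y n : khom _ _) gA).
Qed.
Next Obligation. by move=> n [x y]; rewrite /= !dif2. Qed.

Lemma sum_in1 : is_map A ((fun n x => (x, 0)) : raw X sumC).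
Proof.
split=> [n a x y|n g gA x|n x].
- by congr pair; rewrite /= scaler0 addr0.
- by congr pair; rewrite /= (linear_zero (act_linear gA)).
- by congr pair; rewrite /= dif0.
Qed.

Lemma sum_in2 : is_map A ((fun n y => (0, y)) : raw Y sumC).
Proof.
split=> [n a x y|n g gA x|n x].
- by congr pair; rewrite /= scaler0 addr0.
- by congr pair; rewrite /= (linear_zero (act_linear gA)).
- by congr pair; rewrite /= dif0.
Qed.

Lemma sum_out1 : is_map A ((fun n x => x.1) : raw sumC X).
Proof. by split. Qed.

Lemma sum_out2 : is_map A ((fun n x => x.2) : raw sumC Y).
Proof. by split. Qed.

Lemma allowed_sum fl b : allowed fl b X -> allowed fl b Y -> allowed fl b sumC.
Proof.
have z n : zero_module (X n) -> zero_module (Y n) -> zero_module (sumC n).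
  by move=> x0 y0 [x y]; rewrite (x0 x) (y0 y).
have ab : bounded_above X -> bounded_above Y -> bounded_above sumC.
  move=> [M hM] [N hN]; exists (Num.max M N) => n; rewrite gt_max => /andP[Mn Nn].
  by apply: z; [apply: hM | apply: hN].
have bb : bounded_below X -> bounded_below Y -> bounded_below sumC.
  move=> [M hM] [N hN]; exists (Num.min M N) => n; rewrite lt_min => /andP[Mn Nn].
  by apply: z; [apply: hM | apply: hN].
move=> [bX fX] [bY fY]; split.
  case: b bX bY => //= -[aX bX] [aY bY]; split; [exact: ab | exact: bb].
move=> fl1 n; have rX := finite_length_ranked (fX fl1 n).
have rY := finite_length_ranked (fY fl1 n).
apply: ranked_finite_length; apply: (@ranked_ker _ (sumM (X n) (Y n)) (X n) fst) => //.
apply: (@ranked_ker _ (sumM (X n) (Y n)) (Y n) snd) => //.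
  split=> //= [x y [_ x1] [_ y1]|a x [_ x1]]; split=> //.
    by rewrite x1 y1 addr0.
  by rewrite x1 scaler0.
by apply: ranked0 => -[x y] /= [[_ ->] ->].
Qed.

End Sum.

Program Definition zeroC : cx k A :=
  @mkC (fun _ => zeroM k A) (fun n x => x) _ _ _.
Next Obligation. by []. Qed.
Next Obligation. by []. Qed.
Next Obligation. by move=> n x; apply: zeroMP. Qed.

Lemma allowed_zero fl b : allowed fl b zeroC.
Proof.
split=> [|_ n]; last by apply: ranked_finite_length; apply: ranked0 => x _; apply: zeroMP.
have z (n : int) : zero_module (zeroC n) by move=> x; apply: zeroMP.
by case: b => //=; try split; exists 0 => n _; apply: z.
Qed.

Section Fix.
Variables (X : cx k A) (e : chain_map X X).

Lemma dif_fixed n (x : fixM (e n : khom (X n) (X n))) :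
  ev e (dif (fix_in x)) = dif (fix_in x).
Proof. by rewrite ev_dif -[ev e _]/((e n : khom _ _) _) fix_in_e. Qed.

Definition fix_dif n (x : fixM (e n : khom (X n) (X n))) :
    fixM (e (n + 1) : khom (X (n + 1)) (X (n + 1))) :=
  fix_out _ (dif (fix_in x)).

Lemma fix_difE n (x : fixM (e n : khom (X n) (X n))) :
  fix_in (fix_dif x) = dif (fix_in x).
Proof.
have E := dif_fixed x; rewrite /fix_dif fix_outK -[LHS]/(ev e _) //.
by rewrite -[LHS]/(ev e (ev e _)) !E.
Qed.

Program Definition fixC : cx k A :=
  @mkC (fun n => fixM (e n : khom (X n) (X n))) fix_dif _ _ _.
Next Obligation.
move=> n a x y; apply: fix_in_inj.
by rewrite fix_in_linear !fix_difE fix_in_linear dif_linear.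
Qed.
Next Obligation.
move=> n g gA x; apply: fix_in_inj; rewrite fix_in_act // !fix_difE fix_in_act //.
exact: (khom_act (diff X n : khom _ _) gA).
Qed.
Next Obligation.
move=> n x; apply: fix_in_inj; rewrite !fix_difE dif2.
exact: (esym (linear_zero (@fix_in_linear _ _ _ _ _))).
Qed.

Lemma fix_incl : is_map A ((fun n x => fix_in x) : raw fixC X).
Proof.
split=> [n|n g gA x|n x]; first exact: fix_in_linear.
  exact: fix_in_act.
exact: fix_difE.
Qed.

Hypothesis ee : forall n (x : X n), ev e (ev e x) = ev e x.

Lemma fix_proj : is_map A ((fun n x => fix_out _ x) : raw X fixC).
Proof.
have E n (x : X n) : fix_in (fix_out (e n : khom (X n) (X n)) x) = ev e x.
  by rewrite fix_outK //; apply: ee.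
split=> [n a x y|n g gA x|n x]; apply: fix_in_inj.
- by rewrite fix_in_linear !E ev_lin.
- by rewrite fix_in_act // !E ev_act.
- by rewrite [RHS]fix_difE !E ev_dif.
Qed.

Lemma allowed_fix fl b : allowed fl b X -> allowed fl b fixC.
Proof.
case=> bX fX; split.
  apply: has_bounds_mono bX => n X0 x; apply: fix_in_inj.
  rewrite (linear_zero (@fix_in_linear _ _ _ _ _)); exact: X0.
move=> fl1 n; have rX := finite_length_ranked (fX fl1 n).
apply: ranked_finite_length; apply: ranked_inj rX; first exact: fix_in_linear.
move=> x x0; apply: fix_in_inj.
by rewrite x0 (linear_zero (@fix_in_linear _ _ _ _ _)).
Qed.

End Fix.

Variables (fl : bool) (b : boundedness).
Local Notation C := (C_cat k A fl b).

Lemma C_eq (X Y : C) (f g : hom X Y) :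
  (forall n (x : sval X n), ev f x = ev g x) -> f = g.
Proof. exact: ev_eq. Qed.

Lemma C_biproducts : biproducts C.
Proof.
move=> X Y; exists (exist _ _ (allowed_sum (svalP X) (svalP Y))).
exists (mkmap (@sum_in1 (sval X) (sval Y))), (mkmap (@sum_in2 (sval X) (sval Y))).
exists (mkmap (@sum_out1 (sval X) (sval Y))), (mkmap (@sum_out2 (sval X) (sval Y))).
split; apply: C_eq => n x //.
have pE (p : (sval X n * sval Y n)%type) : (p.1, 0) + (0, p.2) = p.
  by case: p => p q; congr pair; rewrite /= ?addr0 ?add0r.
exact: (pE x).
Qed.

Lemma C_zero : exists Z : C, zero_object Z.
Proof.
exists (exist _ _ (allowed_zero fl b)); apply: C_eq => n x.
exact: zeroMP.
Qed.

Lemma C_idem_split : idem_split C.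
Proof.
move=> X e eX; have ee n (x : sval X n) : ev e (ev e x) = ev e x.
  exact (cpx_app eX x).
exists (exist _ _ (allowed_fix e (svalP X))).
exists (mkmap (fix_incl e)), (mkmap (fix_proj ee)); split; apply: C_eq => n x.
  rewrite -[LHS]/(ev (mkmap (fix_proj ee)) (ev (mkmap (fix_incl e)) x)) !mkmapE.
  by apply: fix_in_inj; rewrite fix_outK; [apply: fix_in_e | apply: ee].
rewrite -[LHS]/(ev (mkmap (fix_incl e)) (ev (mkmap (fix_proj ee)) x)) !mkmapE.
by rewrite fix_outK; last exact: ee.
Qed.

End ComplexConstructions.

Arguments ev_lin {k gT A X Y} f n _ _ _.

(** * Fitting decomposition *)

Lemma linear_sub (k : comPzRingType) (M N : lmodType k) (f g : M -> N) :
  linear f -> linear g -> linear (fun x => f x - g x).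
Proof. by move=> lf lg a x y; rewrite lf lg scalerBr opprD addrACA. Qed.

Lemma linB (k : comPzRingType) (M N : lmodType k) (f : M -> N) : linear f ->
  {morph f : x y / x - y}.
Proof. by move=> lf x y; rewrite (linear_add lf) (linear_opp lf). Qed.

Section FittingModule.

Lemma bounded_step_up (f : nat -> nat) (n : nat) : (forall i, f i <= n)%N ->
  exists m, (f m.+1 <= f m)%N.
Proof.
move=> fn; apply: contrapT => h.
have lt i : (f i < f i.+1)%N by rewrite ltnNge; apply/negP => le; apply: h; exists i.
have ge i : (i <= f i)%N by elim: i => // i IH; apply: leq_ltn_trans IH (lt i).
by have := leq_trans (ge n.+1) (fn _); rewrite ltnn.
Qed.

Lemma bounded_step_down (f : nat -> nat) : exists m, (f m <= f m.+1)%N.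
Proof.
apply: contrapT => h.
have lt i : (f i.+1 < f i)%N by rewrite ltnNge; apply/negP => le; apply: h; exists i.
have ge i : (f i + i <= f 0)%N.
  by elim: i => [|i IH]; rewrite ?addn0 // addnS (leq_trans _ IH) // -addSn leq_add2r.
by have := leq_trans (leq_addl _ _) (ge (f 0).+1); rewrite ltnn.
Qed.

Variables (k : comPzRingType) (M : lmodType k) (f : M -> M).
Hypotheses (lf : linear f) (rM : ranked (fun _ : M => True)).

Lemma iter_linear j : linear (iter j f).
Proof. by elim: j => // j IH a x y; rewrite !iterS IH lf. Qed.

(** Kernels of the powers of f grow and images shrink. Since ranks are bounded, each chain has two
    equal consecutive terms, and from there on it is constant. *)
Lemma fitting_stable : exists m : nat,
  (forall j x, iter j f x = 0 -> iter m f x = 0) /\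
  (forall j x, exists y, iter m f x = iter (m + j) f y).
Proof.
have [n [r [rn rP]]] := rM.
pose K j x := iter j f x = 0; pose I j y := exists x, y = iter j f x.
have sK j : ksub (K j).
  have lj := @iter_linear j; split=> [|x y|a x]; rewrite /K.
  - exact: linear_zero lj.
  - by move=> x0 y0; rewrite (linear_add lj) x0 y0 addr0.
  - by move=> x0; rewrite (linear_scale lj) x0 scaler0.
have sI j : ksub (I j).
  have lj := @iter_linear j; split.
  - by exists 0; rewrite (linear_zero lj).
  - by move=> _ _ [x ->] [y ->]; exists (x + y); rewrite (linear_add lj).
  - by move=> a _ [x ->]; exists (a *: x); rewrite (linear_scale lj).
have KS j x : K j x -> K j.+1 x.
  by rewrite /K iterS => ->; apply: (linear_zero lf).
have IS j x : I j.+1 x -> I j x by move=> [y ->]; exists (f y); rewrite iterSr.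
have [m1 m1P] := bounded_step_up (fun j => rn _ (sK j)).
have [m2 m2P] := bounded_step_down (fun j => r (I j)).
have K1 x : K m1.+1 x -> K m1 x.
  by have [_ /(_ m1P) imp] := rP _ _ (sK m1) (sK m1.+1) (@KS m1); move/imp; apply.
have I1 x : I m2 x -> I m2.+1 x.
  by have [_ /(_ m2P) imp] := rP _ _ (sI m2.+1) (sI m2) (@IS m2); move/imp; apply.
have K2 j x : K (m1 + j)%N x -> K m1 x.
  elim: j x => [|j IH] x; first by rewrite addn0.
  by rewrite /K addnS iterSr => /IH; rewrite /K -iterSr; apply: K1.
have I2 j x : I m2 x -> I (m2 + j)%N x.
  elim: j x => [|j IH] x; first by rewrite addn0.
  move=> /I1[y ->]; rewrite iterS; have [|z ->] := IH (iter m2 f y); first by exists y.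
  by exists z; rewrite addnS iterS.
(* One exponent has to serve both chains, hence the sum. *)
exists (m1 + m2)%N; split=> [j x jx|j x].
  have : K m1 x.
    by apply: (K2 j); rewrite /K iterD jx; apply: linear_zero (@iter_linear m1).
  by rewrite /K addnC iterD => ->; apply: linear_zero (@iter_linear m2).
have [|y yE] := I2 j (iter m2 f x); first by exists x.
by exists y; rewrite iterD yE -iterD addnA.
Qed.

(** z is the value at x of the map that inverts f on the stable image and vanishes where f is
    nilpotent. The relation fixes no exponent, so it can be compared between degrees. *)
Definition fits (x z : M) : Prop :=
  (forall j, exists y, z = iter j f y) /\ exists j, iter j f (f z - x) = 0.

Lemma fits_ex x : exists z, fits x z.
Proof.
have [m [mK mI]] := fitting_stable.
have [y yE] := mI m.+1 x; exists (iter m f y); split=> [j|].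
  by have [w ->] := mI j y; exists (iter m f w); rewrite addnC iterD.
exists m; have lm := @iter_linear m.
by rewrite (linear_add lm) (linear_opp lm) yE -iterS -iterD subrr.
Qed.

(** z - z' lies in the stable image and is killed by a power of f, and these two parts meet in 0. *)
Lemma fits_unique x z z' : fits x z -> fits x z' -> z = z'.
Proof.
move=> [zI [j zj]] [z'I [j' z'j]]; have [m [mK mI]] := fitting_stable.
apply/eqP; rewrite -subr_eq0; apply/eqP.
have [y yE] : exists y, z - z' = iter m f y.
  have [u ->] := zI m; have [v ->] := z'I m; exists (u - v).
  by rewrite (linear_add (@iter_linear m)) (linear_opp (@iter_linear m)).
(* m leads from y to z - z', 1 stands for the f in f z, and the maximum kills both f z - x and f z'
   - x. *)
rewrite yE; apply: (mK (maxn j j' + 1 + m)%N).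
have up i i' w : (i <= i')%N -> iter i f w = 0 -> iter i' f w = 0.
  by move=> /subnK <- w0; rewrite iterD w0; apply: linear_zero (@iter_linear _).
have lJ := @iter_linear (maxn j j').
rewrite iterD -yE iterD /= (linear_add lf) (linear_opp lf).
have -> : f z - f z' = (f z - x) - (f z' - x) by rewrite opprB addrA subrK.
by rewrite (linear_add lJ) (linear_opp lJ) (up j) ?leq_maxl // (up j') ?leq_maxr // subrr.
Qed.

Lemma fits_kills x z : fits x z -> fits (f x) (f z).
Proof.
move=> [zI [j zj]]; split=> [i|].
  by have [y ->] := zI i; exists (f y); rewrite -iterS iterSr.
exists j; rewrite -(linear_opp lf) -(linear_add lf) -iterSr iterS zj.
exact: linear_zero lf.
Qed.

End FittingModule.

Section FittingComplex.
Variables (k : comPzRingType) (gT : finGroupType) (A : {group gT}).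

Lemma chain_inverse (X Y : cx k A) (f : chain_map X Y) :
  (forall n (x : X n), ev f x = 0 -> x = 0) ->
  (forall n (y : Y n), exists x : X n, ev f x = y) ->
  exists g : chain_map Y X, forall n (x : X n), ev g (ev f x) = x.
Proof.
move=> inj surj.
have inj' n (x y : X n) : ev f x = ev f y -> x = y.
  move=> xy; apply/eqP; rewrite -subr_eq0; apply/eqP; apply: inj.
  by rewrite (linB (ev_lin f n)) xy subrr.
pose g : raw Y X := fun n y => sval (cid (surj n y)).
have gE n (y : Y n) : ev f (g n y) = y by rewrite /g; case: cid.
have hg : is_map A g.
  split=> [n a x y|n h hA x|n x]; apply: inj'.
  - by rewrite ev_lin !gE.
  - by rewrite ev_act // !gE.
  - by rewrite ev_dif !gE.
by exists (mkmap hg) => n x; apply: inj'; rewrite mkmapE gE.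
Qed.

Variables (X : cx k A) (f : chain_map X X).
Hypothesis rX : forall n, ranked (fun _ : X n => True).
Local Notation F := (@ev k gT A X X f _).

Lemma iter_ev_dif n j (x : X n) : iter j F (dif x) = dif (iter j F x).
Proof. by elim: j => // j IH; rewrite !iterS IH ev_dif. Qed.

(** The exponent of [fitting_stable] depends on the degree. Uniqueness of [fits] still makes the
    degreewise values linear, equivariant and compatible with the differentials. *)
Lemma fitting_inverse : exists g : chain_map X X,
  forall n (x : X n), fits (@ev _ _ _ _ _ f n) x (ev g x).
Proof.
have ex n x := fits_ex (ev_lin f n) (rX n) x.
have un n x z z' := @fits_unique _ _ _ (ev_lin f n) (rX n) x z z'.
pose g : raw X X := fun n x => sval (cid (ex n x)).
have gP n (x : X n) : fits (@ev _ _ _ _ _ f n) x (g n x) by rewrite /g; case: cid.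
have hg : is_map A g.
  split=> [n a x y|n h hA x|n x]; apply: un; try exact: gP.
  - have [xI [i xi]] := gP n x; have [yI [j yj]] := gP n y.
    have lin m := iter_linear (ev_lin f n) m.
    split=> [m|].
      by have [u ->] := xI m; have [v ->] := yI m; exists (a *: u + v); rewrite lin.
    exists (i + j)%N; rewrite ev_lin.
    have -> : a *: F (g n x) + F (g n y) - (a *: x + y) =
        a *: (F (g n x) - x) + (F (g n y) - y).
      by rewrite opprD addrACA scalerBr.
    rewrite lin {1}addnC !iterD xi yj (linear_zero (lin _)) scaler0 add0r.
    by rewrite (linear_zero (lin _)).
  - have [xI [i xi]] := gP n x.
    have act_iter m (y : X n) : act h (iter m F y) = iter m F (act h y).
      by elim: m => // m IH; rewrite !iterS -IH ev_act.
    split=> [m|]; first by have [u ->] := xI m; exists (act h u); rewrite act_iter.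
    exists i; rewrite ev_act // -(linear_opp (act_linear hA)) -(linear_add (act_linear hA)).
    by rewrite -act_iter xi (linear_zero (act_linear hA)).
  - have [xI [i xi]] := gP n x.
    split=> [m|]; first by have [u ->] := xI m; exists (dif u); rewrite iter_ev_dif.
    exists i; rewrite ev_dif -(linear_opp (@dif_linear _ _ _ X n)).
    by rewrite -(linear_add (@dif_linear _ _ _ X n)) iter_ev_dif xi dif0.
by exists (mkmap hg) => n x; rewrite mkmapE.
Qed.

(* g inverts f on the Fitting component where f is bijective and vanishes on
   the one where f is nilpotent; the projection fg to the former is congruent
   to f modulo any ideal containing f - f^2, since 1 - (f - fgf) is
   invertible. *)
Lemma fitting_data : exists g h : chain_map X X,
  [/\ forall n (x : X n), ev g (ev f x) = ev f (ev g x),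
      forall n (x : X n), ev g (ev f (ev g x)) = ev g x
    & forall n (x : X n), ev h (x - (F x - F (F (ev g x)))) = x].
Proof.
have [g gP] := fitting_inverse.
have lF n := ev_lin f n; have lG n := ev_lin g n.
have un n x z z' := @fits_unique _ _ _ (lF n) (rX n) x z z'.
have gf n (x : X n) : ev g (F x) = F (ev g x).
  by apply: un (gP _ _) _; apply: fits_kills.
have gfg n (x : X n) : ev g (F (ev g x)) = ev g x.
  apply: un (gP _ _) _; split; first by have [] := gP n x.
  by exists 0%N; rewrite /= subrr.
pose E n (x : X n) := F (ev g x).
have lE n : linear (@E n) by move=> a x y; rewrite /E lG lF.
have EE n (x : X n) : E n (E n x) = E n x by rewrite /E gfg.
have FE n (x : X n) : F (E n x) = E n (F x) by rewrite /E gf.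
have hv : is_map A ((fun n x => x - (F x - F (E n x))) : raw X X).
  split=> [n a x y|n h hA x|n x].
  - exact: (linear_sub (fun _ _ _ => erefl) (linear_sub (lF n)
      (fun a x y => etrans (congr1 _ (lE n a x y)) (lF n a _ _)))).
  - have la (z z' : X n) : act h (z - z') = act h z - act h z'.
      exact: (linB (act_linear hA)).
    by rewrite /E !ev_act // !la.
  - have ld (z z' : X n) : dif (z - z') = dif z - dif z'.
      exact: (linB (@dif_linear _ _ _ X n)).
    by rewrite /E !ev_dif !ld.
have [||h hP] := chain_inverse (f := mkmap hv); last by exists g, h.
- move=> n x; rewrite mkmapE => /eqP; rewrite subr_eq0 => /eqP xE.
  have Ex : E n x = 0.
    rewrite xE -(linear_opp (lF n)) -(linear_add (lF n)) -FE.
    by rewrite (linear_add (lE n)) (linear_opp (lE n)) EE subrr (linear_zero (lF n)).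
  have xF : F x = x by rewrite {2}xE Ex (linear_zero (lF n)) subr0.
  have [_ [j]] := gP n x; rewrite -[F (ev g x)]/(E n x) Ex sub0r.
  rewrite (linear_opp (iter_linear (lF n) j)) => /eqP; rewrite oppr_eq0 => /eqP.
  by rewrite (_ : iter j F x = x) //; elim: j => //= j ->.
- move=> n x; have [_ [m mx]] := gP n x; rewrite -[F (ev g x)]/(E n x) in mx.
  pose y := x - E n x; have Ey : E n y = 0.
    by rewrite /y (linear_add (lE n)) (linear_opp (lE n)) EE subrr.
  have my : iter m F y = 0.
    apply/eqP; rewrite -oppr_eq0 -(linear_opp (iter_linear (lF n) m)).
    by rewrite opprB mx.
  (* The geometric series inverts 1 - f on the component where f is nilpotent. *)
  pose s := \sum_(i < m) iter i F y.
  have Es : E n s = 0.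
    rewrite lin_sum // big1 // => i _.
    by elim: {i}(i : nat) => //= i IH; rewrite -FE IH (linear_zero (lF n)).
  have Fs : F s = s - y.
    have sE : s = y + \sum_(i < m) iter i.+1 F y.
      have <- : \sum_(i < m.+1) iter i F y = s by rewrite big_ord_recr /= my addr0.
      by rewrite big_ord_recl.
    by rewrite [X in _ = X - y]sE [RHS]addrC addKr lin_sum.
  exists (E n x + s); rewrite mkmapE (linear_add (lE n)) EE Es addr0.
  rewrite (linear_add (lF n)) [F (E n x) + _]addrC addrK Fs.
  by rewrite opprB -addrA [s + _]addrC subrK /y addrC subrK.
Qed.

End FittingComplex.

(** * Lifting idempotents and countable sums of complexes *)

Section Splitting.
Variables (k : comPzRingType) (gT : finGroupType) (A : {group gT}).

Lemma fitting_lift b (S : C_cat k A true b -> Prop) (X : C_cat k A true b)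
    (f : hom X X) : factors S (f - f \oc f) ->
  exists e : hom X X, e \oc e = e /\ factors S (f - e).
Proof.
move=> Sf; have rX n : ranked (fun _ : sval X n => True).
  by apply: finite_length_ranked; case: (svalP X) => _ /(_ isT).
have [g [h [gf gfg hP]]] := fitting_data f rX.
have lF n := ev_lin f n; have lG n := ev_lin (g : chain_map (sval X) (sval X)) n.
pose g' : hom X X := g; pose h' : hom X X := h.
exists (f \oc g'); split.
  apply: C_eq => n x; rewrite -[LHS]/(ev f (ev g (ev f (ev g x)))) gfg //.
(* Let u = (1 - fg)x, which lies where f is nilpotent. There h undoes 1 - f, so fu = h(f - f^2)u;
   and (f - fg)x is fu minus (f - f^2)gx. *)
have -> : f - f \oc g' = h' \oc ((f - f \oc f) \oc (idm X - f \oc g')) -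
    (f - f \oc f) \oc g'.
  apply: C_eq => n x.
  rewrite -[LHS]/(ev f x - ev f (ev g x)).
  pose u := x - ev f (ev g x).
  rewrite -[RHS]/(ev h (ev f u - ev f (ev f u)) -
    (ev f (ev g x) - ev f (ev f (ev g x)))).
  have gu : ev g u = 0 by rewrite /u (linB (lG n)) gfg subrr.
  have := hP n (ev f u); rewrite gf gu !(linear_zero (lF n)) subr0 => ->.
  by rewrite /u (linB (lF n)) opprB addrA subrK.
apply: factors_add.
  by apply: factors_compl; apply: factors_compr.
by apply: factors_opp; apply: factors_compr.
Qed.

Section Seq.
Variables X Y : cx k A.

Program Definition seqC : cx k A :=
  @mkC k gT A (fun n => seqM (X n)) (fun n => map_seq (@dif k gT A X n)) _ _ _.
Next Obligation. by move=> n; apply: map_seq_linear; apply: dif_linear. Qed.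
Next Obligation.
move=> n; apply: map_seq_equi => //; first exact: dif_linear.
exact: (khom_act (diff X n : khom _ _)).
Qed.
Next Obligation.
by move=> n x; apply: nthT_inj => i; rewrite !map_seqE ?dif0 // dif2.
Qed.

Definition nthC n (f : seqC n) (i : nat) : X n := nthT (f : seqM (X n)) i.

Lemma nthC_inj n (f g : seqC n) : (forall i, nthC f i = nthC g i) -> f = g.
Proof. exact: nthT_inj. Qed.

Lemma nthC_linear n i : linear (fun f : seqC n => nthC f i).
Proof. exact: nthT_linear. Qed.

Lemma nthC_act n (f : seqC n) i g : g \in A -> nthC (act g f) i = act g (nthC f i).
Proof. exact: nth_act. Qed.

Lemma nthC_dif n (f : seqC n) i : nthC (dif f) i = dif (nthC f i).
Proof. by apply: map_seqE; apply: dif0. Qed.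

Lemma nthC_supp n (f : seqC n) : exists m, forall i, (m <= i)%N -> nthC f i = 0.
Proof. exact: nthT_supp. Qed.

Lemma allowed_seq b : allowed false b X -> allowed false b seqC.
Proof.
case=> bX _; split=> //; apply: has_bounds_mono bX => n X0 f.
by apply: nthC_inj => i; rewrite (X0 (nthC f i)); apply: esym; apply: X0.
Qed.

Lemma is_map_shift : is_map A ((fun n f => shift f) : raw seqC seqC).
Proof.
split=> [n|n|n f]; [exact: shift_linear|exact: shift_equi|].
apply: nthC_inj => -[|i]; rewrite nthC_dif /nthC !shiftE ?dif0 //.
by rewrite -[LHS]/(nthC (dif f) i) nthC_dif.
Qed.

Lemma is_map_unshift : is_map A ((fun n f => unshift f) : raw seqC seqC).
Proof.
split=> [n|n|n f]; [exact: unshift_linear|exact: unshift_equi|].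
apply: nthC_inj => i; rewrite nthC_dif /nthC !unshiftE.
by rewrite -[LHS]/(nthC (dif f) i.+1) nthC_dif.
Qed.

Lemma is_map_seq_in j : is_map A ((fun n x => seq_in j x) : raw X seqC).
Proof.
split=> [n|n|n x]; [exact: seq_in_linear|exact: seq_in_equi|].
apply: nthC_inj => i; rewrite nthC_dif /nthC !seq_inE.
by case: eqP => // _; rewrite dif0.
Qed.

Lemma is_map_seq_out : is_map A ((fun n f => seq_out f) : raw seqC X).
Proof. by split=> [n|n g gA f|n f]; [exact: nthT_linear|exact: nth_act|exact: nthC_dif]. Qed.

End Seq.

Lemma nthC_map (X Y : cx k A) (t : raw X Y) n (f : seqC X n) i :
  linear (@t n) -> nthC (map_seq (@t n) f : seqC Y n) i = t n (nthC f i).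
Proof. by move=> lt; apply: map_seqE; apply: linear_zero. Qed.

Lemma is_map_map_seq (P : {group gT}) (X Y : cx k A) (t : raw X Y) : P \subset A ->
  is_map P t -> is_map P ((fun n => map_seq (@t n)) : raw (seqC X) (seqC Y)).
Proof.
move=> PA [lt et dt]; have t0 n := linear_zero (lt n).
split=> [n|n|n f]; first exact: map_seq_linear.
  exact: map_seq_equi.
by apply: nthC_inj => i; rewrite nthC_dif !nthC_map // nthC_dif dt.
Qed.

Lemma nthC_sum (X : cx k A) n i (I : Type) (r : seq I) (S : pred I) (F : I -> seqC X n) :
  nthC (\sum_(j <- r | S j) F j) i = \sum_(j <- r | S j) nthC (F j) i.
Proof. exact: (lin_sum _ _ _ (@nthC_linear X n i)). Qed.

Lemma map_seq_rtr (D P : {group gT}) (X Y : cx k A) (t : raw X Y) n (f : seqC X n) :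
  D \subset A -> P \subset D -> is_map P t ->
  map_seq (@rtr k gT D P A X Y t n) f =
  rtr D P ((fun n => map_seq (@t n)) : raw (seqC X) (seqC Y)) f :> seqC Y n.
Proof.
move=> DA PD [lt _ _]; apply: nthC_inj => i.
rewrite nthC_map; last exact: tr_linear.
rewrite /rtr /tr nthC_sum; apply: eq_bigr => C CD.
have cA := subsetP DA _ (reprA DA PD CD).
by rewrite /conjt nthC_act // nthC_map // nthC_act // groupV.
Qed.

Section SeqFunctor.
Variable b : boundedness.
Local Notation C := (C_cat k A false b).

Definition seq_obj (X : C) : C := exist _ _ (allowed_seq (svalP X)).

Definition seq_mor (X Y : C) (f : hom X Y) : hom (seq_obj X) (seq_obj Y) :=
  mkmap (is_map_map_seq (subxx A) (is_map_ev f (subxx A))).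

Lemma nthC_mor (X Y : C) (f : hom X Y) n (x : sval (seq_obj X) n) i :
  nthC (ev (seq_mor f) x) i = ev f (nthC x i).
Proof. by apply: nthC_map; apply: ev_lin. Qed.

Lemma seq_C_eq (X Y : C) (f g : hom X (seq_obj Y)) :
  (forall n (x : sval X n) i, nthC (ev f x) i = nthC (ev g x) i) -> f = g.
Proof. by move=> fg; apply: C_eq => n x; apply: nthC_inj. Qed.

Program Definition seq_functor : functor C C := @Functor C C seq_obj seq_mor _ _ _.
Next Obligation.
move=> X Y f g; apply: seq_C_eq => n x i.
rewrite nthC_mor -[ev (f + g) _]/(ev f _ + ev g _).
rewrite -[ev (seq_mor f + _) x]/(ev (seq_mor f) x + ev (seq_mor g) x).
by rewrite (linear_add (@nthC_linear _ _ _)) !nthC_mor.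
Qed.
Next Obligation. by move=> X; apply: seq_C_eq => n x i; rewrite nthC_mor. Qed.
Next Obligation.
move=> X Y Z g f; apply: seq_C_eq => n x i.
by rewrite nthC_mor -[ev (seq_mor g \oc _) x]/(ev (seq_mor g) (ev (seq_mor f) x)) !nthC_mor.
Qed.

Lemma seq_swindle (S : C -> Prop) : (forall X, S X -> S (seq_obj X)) ->
  sum_closed S -> idem_split (quot S).
Proof.
move=> ST Ssum.
apply: (@quot_idem_split_swindle C S (@C_biproducts _ _ _ _ _) Ssum
  (@C_idem_split _ _ _ _ _) seq_functor
  (fun X => mkmap (is_map_shift (sval X))) (fun X => mkmap (is_map_unshift (sval X)))
  (fun X => mkmap (is_map_seq_in (sval X) 0)) (fun X => mkmap (is_map_seq_out (sval X)))) => //.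
- move=> X; apply: seq_C_eq => n x i.
  rewrite -[LHS]/(nthT (unshift (shift (x : seqM (sval X n)))) i).
  by rewrite unshiftE shiftE.
- move=> X; apply: C_eq => n x.
  by rewrite -[LHS]/(nthT (seq_in 0 x) 0) seq_inE.
- move=> X; apply: seq_C_eq => n x i.
  rewrite -[LHS]/(nthC ((shift (unshift (x : seqM (sval X n))) : seqC (sval X) n)
    + (seq_in 0 (nthC x 0) : seqC (sval X) n)) i).
  rewrite (linear_add (@nthC_linear _ _ _)) /nthC shiftE seq_inE.
  by case: i => [|i]; rewrite ?add0r // addr0 unshiftE.
- move=> X Y f; apply: seq_C_eq => n x i.
  rewrite -[RHS]/(nthC (ev (seq_mor f) (shift (x : seqM _) : sval (seq_obj X) n)) i) nthC_mor.
  rewrite -[LHS]/(nthT (shift (ev (seq_mor f) x : seqM _)) i) shiftE /nthC shiftE.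
  case: i => [|i]; first by rewrite ev0.
  exact: nthC_mor.
- move=> X Y f; apply: seq_C_eq => n x i.
  rewrite -[RHS]/(nthC (ev (seq_mor f) (unshift (x : seqM _) : sval (seq_obj X) n)) i) nthC_mor.
  rewrite -[LHS]/(nthT (unshift (ev (seq_mor f) x : seqM _)) i) unshiftE /nthC unshiftE.
  exact: nthC_mor.
- move=> X Y f; apply: seq_C_eq => n x i.
  rewrite -[RHS]/(nthC (ev (seq_mor f) (seq_in 0 x : sval (seq_obj X) n)) i) nthC_mor.
  rewrite -[LHS]/(nthT (seq_in 0 (ev f x)) i) /nthC !seq_inE.
  by case: eqP => // _; rewrite ev0.
- move=> X Y f; apply: C_eq => n x.
  exact: nthC_mor.
Qed.

(** Lift on each summand separately and add up; the sum is finite on every element because its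
    sequence is finitely supported. *)
Lemma seq_E_projective (V : kmod k A) c (X : C) : E_projective V false b c X ->
  E_projective V false b c (seq_obj X).
Proof.
move=> /E_projectiveP Xp; apply/E_projectiveP => X' Y Z f g fg w.
have ex j := Xp X' Y Z f g fg (w \oc (mkmap (is_map_seq_in (sval X) j) : hom X (seq_obj X))).
pose v j : hom X Y := sval (cid (ex j)).
have vE j n (x : sval X n) : ev g (ev (v j) x) = ev w (seq_in j x : seqC (sval X) n).
  have E : g \oc v j = w \oc (mkmap (is_map_seq_in (sval X) j) : hom X (seq_obj X)).
    by rewrite /v; case: cid.
  exact (cpx_app E (x : carrier (sval X n))).
pose sup n (x : seqC (sval X) n) : nat := sval (cid (nthC_supp x)).
pose u : raw (seqC (sval X)) (sval Y) := fun n x =>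
  \sum_(j < sup n x) ev (v j) (nthC x j).
(* The value is the same for every bound of the support, so that several sequences can share one
   bound. *)
have uE n x m : (forall i, (m <= i)%N -> nthC x i = 0) ->
    u n x = \sum_(j < m) ev (v j) (nthC x j).
  have key p q : (forall i, (p <= i)%N -> nthC x i = 0) -> (p <= q)%N ->
      \sum_(j < q) ev (v j) (nthC x j) = \sum_(j < p) ev (v j) (nthC x j).
    move=> p0 /subnK <-; elim: (q - p)%N => // d IH.
    by rewrite addSn big_ord_recr /= IH p0 ?leq_addl // ev0 addr0.
  move=> m0; have s0 : forall i, (sup n x <= i)%N -> nthC x i = 0.
    by rewrite /sup; case: cid.
  by rewrite /u; case: (leqP m (sup n x)) => [|/ltnW] le; [apply: key|apply: esym; apply: key].
have hu : is_map A u.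
  split=> [n a x y|n h hA x|n x].
  - have [p p0] := nthC_supp x; have [q q0] := nthC_supp y.
    have p0' i : (maxn p q <= i)%N -> nthC x i = 0.
      by rewrite geq_max => /andP[/p0].
    have q0' i : (maxn p q <= i)%N -> nthC y i = 0.
      by rewrite geq_max => /andP[_ /q0].
    rewrite !(@uE n _ (maxn p q)) //; last first.
      by move=> i le; rewrite nthC_linear p0' // q0' // scaler0 addr0.
    rewrite scaler_sumr -big_split /=; apply: eq_bigr => j _.
    by rewrite nthC_linear ev_lin.
  - have [p p0] := nthC_supp x.
    rewrite !(@uE n _ p) //; last first.
      by move=> i /p0 xi; rewrite nthC_act // xi (linear_zero (act_linear hA)).
    by rewrite act_sum //; apply: eq_bigr => j _; rewrite nthC_act // ev_act.
  - have [p p0] := nthC_supp x.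
    rewrite !(@uE _ _ p) //; last by move=> i /p0 xi; rewrite nthC_dif xi dif0.
    by rewrite dif_sum; apply: eq_bigr => j _; rewrite nthC_dif ev_dif.
exists (mkmap hu); apply: C_eq => n x.
have [p p0] := nthC_supp (x : seqC (sval X) n).
rewrite -[LHS]/(ev g (u n x)) (uE n x p p0).
rewrite (lin_sum _ _ _ (ev_lin g n)).
have xE : x = \sum_(j < p) (seq_in j (nthC (x : seqC (sval X) n) j) : seqC (sval X) n).
  apply: nthC_inj => i; rewrite nthC_sum.
  case: (ltnP i p) => ip; last first.
    rewrite p0 // big1 // => j _; rewrite /nthC seq_inE; case: eqP => // ij.
    by have := ltn_ord j; rewrite -ij ltnNge ip.
  rewrite (bigD1 (Ordinal ip)) //= big1 ?addr0 => [|j ji].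
    by rewrite /nthC seq_inE eqxx.
  by rewrite /nthC seq_inE; case: eqP => // ij; case/eqP: ji; apply: val_inj.
rewrite [in RHS]xE (lin_sum _ _ _ (ev_lin w n)).
by apply: eq_bigr => j _; apply: vE.
Qed.

End SeqFunctor.
End Splitting.

(** * The trace ideals *)

Definition quot_proj (C : category) (S : C -> Prop) : functor C (quot S) :=
  @Functor C (quot S) id (fun X Y f => quot_pi S f) (@quot_piD C S)
    (fun _ => erefl) (fun X Y Z g f => esym (quot_compE S g f)).

Lemma zero_homr (C : category) (X Z : C) : zero_object Z ->
  forall f : hom X Z, f = 0.
Proof. by move=> Z0 f; rewrite -[f]comp1m Z0 comp0l. Qed.

Section Ideal.
Variables (k : comPzRingType) (gT : finGroupType) (D : {group gT}).
Variables (V : kmod k D) (fl : bool) (b : boundedness) (o : option seq_class).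
Local Notation C := (C_cat k D fl b).
Local Notation CK := (CK_cat V fl b o).

(* The objects killed by the passage from C to CK. *)
Definition killed (X : C) : Prop :=
  match o with None => zero_object X | Some c => E_projective V fl b c X end.

Lemma zero_E_projective c (Z : C) : zero_object Z -> E_projective V fl b c Z.
Proof.
move=> Z0; apply/E_projectiveP => X Y W f g _ w; exists 0.
by rewrite comp0r -[RHS]compm1 Z0 comp0r.
Qed.

Lemma killed_sum : sum_closed killed.
Proof.
rewrite /killed; have [Z Z0] := @C_zero k gT D fl b.
case: o => [c|]; split.
- by exists Z => //; apply: zero_E_projective.
- move=> X Y W i1 i2 p1 p2 e /E_projectiveP Xp /E_projectiveP Yp.
  apply/E_projectiveP => A B E f g fg w.
  have [v vE] := Xp A B E f g fg (w \oc i1).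
  have [v' v'E] := Yp A B E f g fg (w \oc i2).
  exists (v \oc p1 + v' \oc p2).
  by rewrite compDr !compA vE v'E -!compA -compDr e compm1.
- by exists Z.
- move=> X Y W i1 i2 p1 p2 e; rewrite /zero_object => X0 Y0.
  by rewrite -e -[p1]comp1m X0 -[p2]comp1m Y0 !comp0l !comp0r addr0.
Qed.

Definition negligible (X Y : C) (f : hom X Y) : Prop := factors killed f.

Lemma negligible_killed (X Y Z : C) (c : hom Z Y) (a : hom X Z) :
  killed Z -> negligible (c \oc a).
Proof.
by move=> KZ; apply: factors1W; exists Z, a, c.
Qed.

(** It is the identity on objects, full, and kills exactly the negligible maps; through it,
    computations in C are moved to CK for all values of [o]. *)
Definition kap : functor C CK :=
  match o return functor C (CK_cat V fl b o) with
  | None => functor_id C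
  | Some c => quot_proj (E_projective V fl b c)
  end.

Lemma kap_full (X Y : C) (u : hom (kap X) (kap Y)) : exists f, fmap kap f = u.
Proof.
move: u; rewrite /kap; case: o => [c|] u; last by exists u.
by exists (quot_repr u); apply: quot_reprK.
Qed.

Lemma kap0 (X Y : C) (f : hom X Y) : fmap kap f = 0 <-> negligible f.
Proof.
rewrite /negligible /killed /kap; case: o => [c|]; first exact: quot_pi0.
split=> [f0|].
  have -> : f = 0 := f0.
  exact: factors0.
elim=> //= h Z a c Z0 _ ->.
rewrite add0r (zero_homr Z0 a). exact (comp0r X c).
Qed.

Lemma kap_obj (Z : CK) : exists X, Z = kap X.
Proof. by move: Z; rewrite /kap; case: o => [c|] Z; exists Z. Qed.

Lemma CK_complex_kap (X : C) : CK_complex (kap X) = sval X.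
Proof. by rewrite /kap; case: o. Qed.

Lemma kap_eq (X Y : C) (f g : hom X Y) :
  fmap kap f = fmap kap g <-> negligible (f - g).
Proof.
rewrite -kap0 fmapD fmapN; split=> [->|/eqP]; first exact: subrr.
by rewrite subr_eq0 => /eqP.
Qed.

Lemma CK_mono_split : mono_split CK.
Proof.
have := killed_sum; rewrite /killed; case: o => [c|] ks.
  exact: (quot_mono_split (@C_biproducts _ _ _ _ _) ks (@C_idem_split _ _ _ _ _)).
exact: (idem_mono_split (@C_idem_split _ _ _ _ _)).
Qed.

Variable U : {set {group gT}}.
Hypothesis UD : forall Q, Q \in U -> Q \subset D.
Let DD := subxx D.

(** The full preimage in C of the trace ideal of CK. The parts t and q are kept apart because
    Mackey's formula applies to t alone. *)
Definition jideal (X Y : C) (f : hom X Y) : Prop :=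
  exists (t : raw (sval X) (sval Y)) (q : hom X Y),
    [/\ trsum D U t, negligible q & forall n x, ev f x = t n x + ev q x].

Lemma jideal_negligible (X Y : C) (f : hom X Y) : negligible f -> jideal f.
Proof.
exists (fun n _ => 0), f; split=> // [|n x]; last by rewrite add0r.
exact: trsum0.
Qed.

Lemma jideal_tr (X Y : C) (f : hom X Y) (t : raw (sval X) (sval Y)) :
  trsum D U t -> (forall n x, ev f x = t n x) -> jideal f.
Proof.
move=> tU ft; exists t, 0; split=> // [|n x]; first exact: factors0.
by rewrite ft -[ev 0 x]/(0 : sval Y n) addr0.
Qed.

Lemma jideal0 (X Y : C) : jideal (0 : hom X Y).
Proof. by apply: jideal_negligible; apply: factors0. Qed.

Lemma jidealD (X Y : C) (f g : hom X Y) : jideal f -> jideal g -> jideal (f + g).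
Proof.
move=> [t [q [tU nq fE]]] [t' [q' [tU' nq' gE]]].
exists (fun n x => t n x + t' n x), (q + q'); split.
- exact: trsumD.
- exact: factors_add.
- move=> n x; rewrite -[LHS]/(ev f x + ev g x) fE gE.
  by rewrite -[ev (q + q') x]/(ev q x + ev q' x) addrACA.
Qed.

Lemma jideal_compl (X Y Z : C) (g : hom Y Z) (f : hom X Y) :
  jideal f -> jideal (g \oc f).
Proof.
move=> [t [q [tU nq fE]]]; exists (fun n x => ev g (t n x)), (g \oc q); split.
- by apply: trsum_compl => //; apply: is_map_ev.
- exact: factors_compl.
- move=> n x; rewrite -[LHS]/(ev g (ev f x)) fE.
  exact (linear_add (ev_lin g n) (t n x) (ev q x)).
Qed.

Lemma jideal_compr (X Y Z : C) (g : hom Y Z) (f : hom X Y) :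
  jideal g -> jideal (g \oc f).
Proof.
move=> [t [q [tU nq fE]]]; exists (fun n x => t n (ev f x)), (q \oc f); split.
- by apply: trsum_compr => //; apply: is_map_ev.
- exact: factors_compr.
- by move=> n x; rewrite -[LHS]/(ev g (ev f x)) fE.
Qed.

Lemma jidealN (X Y : C) (f : hom X Y) : jideal f -> jideal (- f).
Proof. by rewrite -[- f]comp1m compNr -compNl; apply: jideal_compl. Qed.

Definition jobj (Z : C) : Prop := jideal (idm Z).

Lemma jideal_factors (X Y : C) (f : hom X Y) : factors jobj f -> jideal f.
Proof.
elim=> [|{}f Z a c jZ _ IH]; first exact: jideal0.
by apply: jidealD => //; rewrite -[a]comp1m; apply/jideal_compl/jideal_compr.
Qed.

Lemma jobj_killed (Z : C) : killed Z -> jobj Z.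
Proof.
by move=> KZ; apply: jideal_negligible; rewrite -[idm Z]comp1m; apply: negligible_killed.
Qed.

Definition ind_obj (P : {group gT}) (PD : P \subset D) (X : C_cat k P fl b) : C :=
  exist _ (cpx_functor (ind P D) (sval X)) (allowed_ind PD (svalP X)).

Definition res_obj (P : {group gT}) (PD : P \subset D) (X : C) : C_cat k P fl b :=
  exist _ (cpx_functor (res k PD) (sval X)) (allowed_res PD (svalP X)).

Definition ir_obj (P : {group gT}) (PD : P \subset D) (X : C) : C :=
  ind_obj PD (res_obj PD X).

Section InduceRestrict.
Variables (P : {group gT}) (PD : P \subset D) (Y : C).

Definition ir_pi : raw (sval (ir_obj PD Y)) (sval Y) :=
  @rpi k gT P D (sval (res_obj PD Y)).
Definition ir_eta : raw (sval Y) (sval (ir_obj PD Y)) :=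
  @reta k gT P D (sval (res_obj PD Y)).

Lemma is_map_ir_pi : is_map P ir_pi.
Proof. exact (is_map_rpi PD (sval (res_obj PD Y))). Qed.

Lemma is_map_ir_eta : is_map P ir_eta.
Proof. exact (is_map_reta PD (sval (res_obj PD Y))). Qed.

Definition counit : hom (ir_obj PD Y) Y := mkmap (is_map_rtr DD PD is_map_ir_pi).

(** The trace of t is the counit Ind Res Y -> Y after the map X -> Ind Res Y that corresponds to t;
    this is why traces from P factor through objects induced from P. *)
Lemma counit_factor (X : C) (t : raw (sval X) (sval Y)) : is_map P t ->
  exists a : hom X (ir_obj PD Y),
    forall n (x : sval X n), ev (counit \oc a) x = rtr D P t x.
Proof.
move=> ht; have heta := is_map_comp ht is_map_ir_eta.
exists (mkmap (is_map_rtr DD PD heta)) => n x.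
rewrite -[LHS]/(rtr D P ir_pi (rtr D P (fun n x => ir_eta (t n x)) x)).
have [_ ea _] := is_map_rtr DD PD heta.
rewrite [LHS](tr_compr _ _ DD PD) //.
apply: tr_ext => y.
exact (@rpi_rtr_reta k gT P D PD (sval X) (sval (res_obj PD Y)) t n y ht).
Qed.

Lemma ir_jobj : P \in U -> jobj (ir_obj PD Y).
Proof.
move=> PU; apply: (jideal_tr (t := rtr D P (fun n x => ir_eta (ir_pi x)))).
  by apply: trsum_tr => //; apply: (is_map_comp is_map_ir_pi is_map_ir_eta).
move=> n x; apply: esym; exact (rtr_reta_rpi PD (x : cpx_fobj (ind P D) (sval (res_obj PD Y)) n)).
Qed.

End InduceRestrict.

(** Induction over the summands of a trace sum, each of them a counit after some map. The property Q
    is left open: it serves for factorizations in C and for explicit direct sums in CK. *)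
Lemma trsum_ind (Q : forall X Y : C, hom X Y -> Prop) (X Y : C) :
  Q X Y 0 ->
  (forall (f : hom X Y) (P : {group gT}) (PD : P \subset D) (a : hom X (ir_obj PD Y)),
     P \in U -> Q X Y f -> Q X Y (f + counit PD Y \oc a)) ->
  forall (t : raw (sval X) (sval Y)) (f : hom X Y), trsum D U t ->
    (forall n x, ev f x = t n x) -> Q X Y f.
Proof.
move=> Q0 QD t f [tt ttP tE] ft.
have {tE ft} fE n (x : sval X n) : ev f x = \sum_(P <- enum U) rtr D P (tt P) x.
  by rewrite ft tE big_enum.
have : {subset enum U <= U} by move=> P; rewrite mem_enum.
elim: (enum U) f fE => [|P s IH] f fE sU.
  have -> : f = 0 by apply: C_eq => n x; rewrite fE big_nil.
  exact: Q0.
have PU : P \in U by apply: sU; rewrite mem_head.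
have [a aE] := counit_factor (UD PU) (ttP P PU).
rewrite -(subrK (counit (UD PU) Y \oc a) f); apply: QD => //; apply: IH.
  move=> n x; rewrite -[LHS]/(ev f x - ev (counit (UD PU) Y \oc a) x) fE big_cons aE.
  by rewrite addrC addKr.
by move=> R Rs; apply: sU; rewrite inE Rs orbT.
Qed.

Lemma factors_jideal (X Y : C) (f : hom X Y) : jideal f -> factors jobj f.
Proof.
move=> [t [q [tU nq fE]]]; rewrite -(subrK q f); apply: factors_add; last first.
  by elim: nq => [|g Z a c KZ _]; [apply: factors0 | apply: factorsD; apply: jobj_killed].
apply: (@trsum_ind (fun X Y f => factors jobj f) X Y _ _ t) => //.
- exact: factors0.
- by move=> g P PD a PU; apply: factorsD; apply: ir_jobj.
- by move=> n x; rewrite -[LHS]/(ev f x - ev q x) fE addrK.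
Qed.

Lemma jobj_sum : sum_closed jobj.
Proof.
have [[Z KZ Z0] _] := killed_sum; split; first by exists Z => //; apply: jobj_killed.
move=> X Y W i1 i2 p1 p2 e jX jY; rewrite /jobj -e; apply: jidealD.
  by rewrite -[p1]comp1m; apply/jideal_compl/jideal_compr.
by rewrite -[p2]comp1m; apply/jideal_compl/jideal_compr.
Qed.

End Ideal.

(** * Relative projectivity and trace ideals *)

Section RelativeProjectives.
Variables (k : comPzRingType) (gT : finGroupType) (D : {group gT}).
Variables (V : kmod k D) (fl : bool) (b : boundedness) (o : option seq_class).
Local Notation C := (C_cat k D fl b).
Local Notation CK := (CK_cat V fl b o).
Local Notation kap := (kap V fl b o).
Local Notation jideal := (jideal V o).
Local Notation jobj := (jobj V o).
Variable U : {set {group gT}}.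
Hypothesis UD : forall Q, Q \in U -> Q \subset D.
Let DD := subxx D.

Lemma kap_biprod (X Y : C) : exists (S : C) (i1 : hom (kap X) (kap S))
  (i2 : hom (kap Y) (kap S)) (p1 : hom (kap S) (kap X)) (p2 : hom (kap S) (kap Y)),
  [/\ p1 \oc i1 = idm (kap X), p2 \oc i2 = idm (kap Y), p1 \oc i2 = 0,
      p2 \oc i1 = 0 & i1 \oc p1 + i2 \oc p2 = idm (kap S)].
Proof.
have [S [i1 [i2 [p1 [p2 [p11 p22 p12 p21 e]]]]]] := C_biproducts X Y.
exists S, (fmap kap i1), (fmap kap i2), (fmap kap p1), (fmap kap p2).
by rewrite -!fmapM p11 p22 p12 p21 -fmapD e !fmap1 !fmap0.
Qed.

(** [rel_projective] asks for an indexed direct sum, so finite sums are grown from the empty one,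
    one summand at a time, the index type I becoming [option I]. *)
Lemma direct_sum_option (I : Type) (Z : I -> CK) (X Y : C)
    (iota : forall i, hom (Z i) (kap X)) : is_direct_sum iota ->
  exists (S : C) (i1 : hom (kap X) (kap S)) (i2 : hom (kap Y) (kap S))
    (p1 : hom (kap S) (kap X)) (p2 : hom (kap S) (kap Y)),
  [/\ p1 \oc i1 = idm (kap X), p2 \oc i2 = idm (kap Y), p1 \oc i2 = 0,
      p2 \oc i1 = 0 &
    @is_direct_sum CK (option I) (fun j => if j is Some i then Z i else kap Y) (kap S)
      (fun j => match j return hom (if j is Some i then Z i else kap Y) (kap S) with
        Some i => i1 \oc iota i | None => i2 end)].
Proof.
move=> ds; have [S [i1 [i2 [p1 [p2 [p11 p22 p12 p21 e]]]]]] := kap_biprod X Y.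
exists S, i1, i2, p1, p2; split=> // T f.
have [u [uP uu]] := ds T (fun i => f (Some i)).
exists (u \oc p1 + f None \oc p2); split=> [[i|]|v vP].
- rewrite compDl -!compA !(compA p1) !(compA p2) p11 p21 comp1m comp0l comp0r.
  by rewrite addr0 uP.
- by rewrite compDl -!compA p12 p22 comp0r compm1 add0r.
- have -> : v = v \oc i1 \oc p1 + v \oc i2 \oc p2.
    by rewrite -!compA -compDr e compm1.
  have -> : u = v \oc i1 by apply: uu => i; rewrite -(vP (Some i)) compA.
  by rewrite -(vP None).
Qed.

Lemma induced_ir (P : {group gT}) (PD : P \subset D) (X : C) : P \in U ->
  induced_from U (kap (ir_obj PD X)).
Proof.
by move=> PU; exists P => //; exists (res_obj PD X); rewrite CK_complex_kap.
Qed.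

(** By [trsum_ind] the identity of X factors, in CK, through a finite direct sum of objects Ind Res
    X. *)
Lemma rel_projective_jobj (X : C) : jobj U X -> rel_projective U (kap X).
Proof.
move=> [t [q [tU nq xE]]].
pose T (X Y : C) (f : hom X Y) := exists (I : Type) (Z : I -> CK) (S : C)
  (iota : forall i, hom (Z i) (kap S)) (a : hom (kap X) (kap S))
  (c : hom (kap S) (kap Y)), [/\ forall i, induced_from U (Z i),
    is_direct_sum iota & fmap kap f = c \oc a].
have [I [Z [S [iota [a [c [Zind ds ca]]]]]]] : T X X (idm X - q).
  apply: (@trsum_ind _ _ _ fl b U UD T X X _ _ t) => //; last first.
  - by move=> n x; rewrite -[LHS]/(ev (idm X) x - ev q x) xE addrK.
  - move=> f P PD g PU [I [Z [S [iota [a [c [Zind ds fE]]]]]]].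
    have [S' [i1 [i2 [p1 [p2 [p11 p22 p12 p21 ds']]]]]] :=
      direct_sum_option (ir_obj PD X) ds.
    eexists (option I), _, S', _, (i1 \oc a + i2 \oc fmap kap g),
      (c \oc p1 + fmap kap (counit PD X) \oc p2).
    split; [|exact: ds'|].
      by case=> [i|]; [apply: Zind | apply: induced_ir].
    rewrite compDl !compDr -!compA !(compA p1) !(compA p2) p11 p22 p12 p21.
    by rewrite !comp0l !comp1m !comp0r addr0 add0r fmapD fE fmapM.
  - have [Z Z0] := @C_zero k gT D fl b.
    have kZ0 : idm (kap Z) = 0 by rewrite -fmap1 Z0 fmap0.
    exists void, (of_void _), Z, (fun i => of_void _ i), 0, 0.
    split; [by case| |by rewrite fmap0 comp0r].
    move=> T' f; exists 0; split=> [[]|v _].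
    by rewrite -[v]compm1 kZ0 comp0r.
have ca1 : c \oc a = idm (kap X).
  by rewrite -ca -fmap1; apply/kap_eq; rewrite addrAC subrr add0r; apply: factors_opp.
(* A retract is not yet a direct summand: the complement is obtained by splitting 1 - ac. *)
have [X' [i [p [pi ip]]]] := CK_mono_split ca1.
exists I, Z, (kap S), iota; split=> //.
by exists X', a, c, i, p; split=> //; rewrite ip addrC subrK.
Qed.

Lemma induced_trace (P : {group gT}) (PD : P \subset D) (Y : cx k P) (W : cx k D) :
  W = cpx_functor (ind P D) Y ->
  exists2 t : raw W W, is_map P t & forall n (x : W n), rtr D P t x = x.
Proof.
move=> ->; exists (fun n x => @reta k gT P D Y n (@rpi k gT P D Y n x)).
  exact: is_map_comp (is_map_rpi PD Y) (is_map_reta PD Y).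
by move=> n x; apply: rtr_reta_rpi.
Qed.

(** The identity of each summand Z i is one trace, from a group R i, but there may be infinitely
    many i. For each P in U the universal property of S collects the factorizations of all i with R
    i = P into one map S -> Ind Res S. Composed with the counits and summed over the finite set U,
    these give the identity of S, by uniqueness. *)
Lemma jobj_rel_projective (X : C) : rel_projective U (kap X) -> jobj U X.
Proof.
case=> I [Z [S [iota [Zind ds sm]]]].
have [Z0 ZE] : exists Z0 : I -> C, Z = fun i => kap (Z0 i).
  have ex i := cid (kap_obj (Z i)).
  by exists (fun i => sval (ex i)); apply: funext => i; case: (ex i).
have [S0 SE] := kap_obj S.
move: iota Zind ds sm; rewrite {}ZE {}SE {Z S} => iota Zind ds sm.
have [j jE] : exists j : forall i, hom (Z0 i) S0, forall i, fmap kap (j i) = iota i.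
  have ex i := cid (kap_full (iota i)).
  by exists (fun i => sval (ex i)) => i; case: (ex i).
have [R RP] : exists R : I -> {group gT}, forall i, R i \in U /\
    exists2 t : raw (sval (Z0 i)) (sval (Z0 i)), is_map (R i) t &
      forall n (x : sval (Z0 i) n), rtr D (R i) t x = x.
  have ex i : {P : {group gT} | P \in U /\
    exists2 t : raw (sval (Z0 i)) (sval (Z0 i)), is_map P t &
      forall n (x : sval (Z0 i) n), rtr D P t x = x}.
    apply: cid; case: (Zind i) => P PU [Y]; rewrite CK_complex_kap => YE.
    by exists P; split=> //; exact (induced_trace (UD PU) YE).
  by exists (fun i => sval (ex i)) => i; case: (ex i).
pose J : finType := {P : {group gT} | P \in U}.
(* The inclusion of Z i is itself a trace from R i, hence factors through the counit of that group;
   the other groups get the map 0. *)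
have F (P : J) i : {g : hom (Z0 i) (ir_obj (UD (valP P)) S0) |
    counit (UD (valP P)) S0 \oc g = if R i == val P then j i else 0}.
  apply: cid; have [RU [t tR tE]] := RP i.
  case: eqP => [RE|_]; last by exists 0; rewrite comp0r.
  rewrite RE in tR tE; have jmap := is_map_ev (j i) DD.
  have [a aE] := counit_factor (UD (valP P))
    (is_map_comp tR (is_mapS (UD (valP P)) jmap)).
  exists a; apply: C_eq => n x; rewrite aE.
  have [lj ej _] := jmap.
  rewrite -[in RHS](tE n x) [RHS](tr_compl _ _ DD) //.
  exact: UD (valP P).
have u (P : J) : {u : hom S0 (ir_obj (UD (valP P)) S0) |
    forall i, fmap kap (u) \oc iota i = fmap kap (sval (F P i))}.
  apply: cid; have [u0 [u0P _]] := ds _ (fun i => fmap kap (sval (F P i))).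
  by have [u1 u1E] := kap_full u0; exists u1 => i; rewrite u1E u0P.
pose e : hom S0 S0 := \sum_(P : J) counit (UD (valP P)) S0 \oc sval (u P).
have eJ : jideal U e.
  rewrite /e; elim/big_rec: _ => [|P x _ jx]; first exact: jideal0.
  apply: jidealD => //; rewrite -[sval (u P)]comp1m.
  by apply/jideal_compl/jideal_compr => //; apply: ir_jobj => //; apply: (valP P).
have e1 : fmap kap e = idm (kap S0).
  have [v [_ vu]] := ds _ iota; transitivity v; last by apply: vu => i; rewrite comp1m.
  apply: esym; apply: vu => i.
  have sumE (G : J -> hom S0 S0) : fmap kap (\sum_(P : J) G P) \oc iota i =
      \sum_(P : J) fmap kap (G P) \oc iota i.
    elim/big_ind2: _ => [|f g f' g' fE gE|//]; first by rewrite fmap0 comp0l.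
    by rewrite fmapD compDl fE gE.
  rewrite sumE (bigD1 (exist _ (R i) (RP i).1)) // big1 => [|P /andP[_ PR]].
    rewrite fmapM -compA; case: (u _) => w wE; rewrite [sval _]/= wE -fmapM.
    by case: (F _ _) => g gE; rewrite [sval _]/= gE eqxx jE; apply: addr0.
  rewrite fmapM -compA; case: (u _) => w wE; rewrite [sval _]/= wE -fmapM.
  case: (F _ _) => g gE; rewrite [sval _]/= gE; case: eqP => [RE|_]; last exact: fmap0.
  by case/eqP: PR; apply: val_inj.
have jS : jobj U S0.
  rewrite /jobj -(subrK e (idm S0)); apply: jidealD => //.
  by apply: jideal_negligible => //; apply/kap_eq; rewrite fmap1 e1.
have [X' [i [p [i' [p' [pi _ _]]]]]] := sm.
have [i0 i0E] := kap_full i; have [p0 p0E] := kap_full p.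
rewrite /jobj -(subrK (p0 \oc i0) (idm X)); apply: jidealD => //.
  by apply: jideal_negligible => //; apply/kap_eq; rewrite fmap1 fmapM i0E p0E.
by rewrite -[i0]comp1m; apply/jideal_compl/jideal_compr.
Qed.

Lemma rel_projectiveP (X : C) : rel_projective U (kap X) <-> jobj U X.
Proof. by split; [apply: jobj_rel_projective | apply: rel_projective_jobj]. Qed.

Lemma factors_kap (X Y : C) (f : hom X Y) :
  factors (rel_projective (V := V) (fl := fl) (b := b) (o := o) U) (fmap kap f) <-> jideal U f.
Proof.
split=> [|/(factors_jideal UD)]; last first.
  by apply: fmap_factors => Z /rel_projectiveP.
move=> fU; suff gen u : factors (rel_projective U) u ->
    forall g : hom X Y, fmap kap g = u -> jideal U g by exact: gen fU f erefl.
elim=> [g /kap0|v Z a c rZ _ IH {}f {fU}]; first exact: jideal_negligible.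
have [Z0 ZE] := kap_obj Z; move: a c rZ; rewrite {}ZE => a c /rel_projectiveP jZ.
have [a0 <-] := kap_full a; have [c0 <-] := kap_full c => fE.
rewrite -(subrK (c0 \oc a0) f); apply: jidealD => //.
  by apply: IH; rewrite fmapD fmapN fmapM fE addrK.
by rewrite -[a0]comp1m; apply/jideal_compl/jideal_compr.
Qed.

End RelativeProjectives.

(** * Transfer between H and G *)

Section Transfer.
Variables (k : comPzRingType) (gT : finGroupType) (G H : {group gT}).
Hypothesis sHG : H \subset G.
Variables (V : kmod k G) (fl : bool) (b : boundedness) (o : option seq_class).
Local Notation VH := (resM sHG V).
Local Notation CG := (C_cat k G fl b).
Local Notation CH := (C_cat k H fl b).

Definition hInd : descends (cpx_functor (ind H G)) VH V fl b o :=
  descends_ind V (@allowed_ind k gT H G sHG fl b) (@allowed_res k gT H G sHG fl b) o.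
Definition hRes : descends (cpx_functor (res k sHG)) V VH fl b o :=
  descends_res V (@allowed_ind k gT H G sHG fl b) (@allowed_res k gT H G sHG fl b) o.

Definition IC : functor CH CG := full_sub_functor (descends_C hInd).
Definition RC : functor CG CH := full_sub_functor (descends_C hRes).

Lemma killed_functor (A B : {group gT}) (F : functor (Cpx (Mod k A)) (Cpx (Mod k B)))
    (W : kmod k A) (W' : kmod k B) (h : descends F W W' fl b o) X :
  killed W o X -> killed W' o (full_sub_functor (descends_C h) X).
Proof.
rewrite /killed; case: o h => [c|] h; first exact: (descends_K h erefl).
move=> X0; have : fmap (full_sub_functor (descends_C h)) (idm X) = 0.
  by rewrite X0 fmap0.
by rewrite fmap1.
Qed.

Lemma negligible_ind (X Y : CH) (f : hom X Y) :
  negligible VH o f -> negligible V o (fmap IC f).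
Proof. by apply: fmap_factors => Z; apply: killed_functor. Qed.

Lemma negligible_res (X Y : CG) (f : hom X Y) :
  negligible V o f -> negligible VH o (fmap RC f).
Proof. by apply: fmap_factors => Z; apply: killed_functor. Qed.

Definition Tr (X Y : CG) (f : hom (RC X) (RC Y)) : hom X Y :=
  mkmap (@is_map_rtr k gT G H G (sval X) (sval Y)
    (fun n x => @ev k gT H (sval (RC X)) (sval (RC Y)) f n x)
    (subxx G) sHG (is_map_ev f (subxx H))).

Definition eta (X : CH) : hom X (RC (IC X)) := 
  @mkmap k gT H (sval X) (sval (RC (IC X))) (@reta k gT H G (sval X))
    (is_map_reta sHG (sval X)).
Definition pi (X : CH) : hom (RC (IC X)) X := 
  @mkmap k gT H (sval (RC (IC X))) (sval X) (@rpi k gT H G (sval X))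
    (is_map_rpi sHG (sval X)).

Lemma evTr (X Y : CG) (f : hom (RC X) (RC Y)) n (x : sval X n) :
  ev (Tr f) x = rtr G H ((fun n x => @ev k gT H (sval (RC X)) (sval (RC Y)) f n x) :
     raw (sval X) (sval Y)) x.
Proof. by []. Qed.

Lemma TrD (X Y : CG) (f g : hom (RC X) (RC Y)) : Tr (f + g) = Tr f + Tr g.
Proof.
apply: C_eq => n x; rewrite -[RHS]/(ev (Tr f) x + ev (Tr g) x) !evTr.
by rewrite /rtr -(trD _ _ _ (subxx G) sHG).
Qed.

Lemma TrN (X Y : CG) (f : hom (RC X) (RC Y)) : Tr (- f) = - Tr f.
Proof.
have Tr0 : Tr (0 : hom (RC X) (RC Y)) = 0 by apply: (addrI (Tr 0)); rewrite -TrD !addr0.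
by apply: (addrI (Tr f)); rewrite -TrD !addrN.
Qed.

Lemma Tr_compl (X Y Z : CG) (g : hom Y Z) (f : hom (RC X) (RC Y)) :
  Tr (fmap RC g \oc f) = g \oc Tr f.
Proof.
apply: C_eq => n x; rewrite -[RHS]/(ev g (ev (Tr f) x)) !evTr /rtr.
have [lg eg _] := is_map_ev g (subxx G).
by rewrite [RHS](tr_compl _ _ (subxx G) sHG).
Qed.

Lemma Tr_compr (X Y Z : CG) (g : hom X Y) (f : hom (RC Y) (RC Z)) :
  Tr (f \oc fmap RC g) = Tr f \oc g.
Proof.
apply: C_eq => n x; rewrite -[RHS]/(ev (Tr f) (ev g x)) !evTr /rtr.
have [lg eg _] := is_map_ev g (subxx G).
by rewrite [RHS](tr_compr _ _ (subxx G) sHG).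
Qed.

Lemma Tr_eta_pi (X : CH) : Tr (eta X \oc pi X) = idm (IC X).
Proof. by apply: C_eq => n x; rewrite evTr; exact (rtr_reta_rpi sHG x). Qed.

Lemma pi_eta (X : CH) : pi X \oc eta X = idm X.
Proof. by apply: C_eq => n x; exact (rpi_reta sHG x). Qed.

Lemma eta_nat (X Y : CH) (f : hom X Y) : eta Y \oc f = fmap RC (fmap IC f) \oc eta X.
Proof. by apply: C_eq => n x; exact (reta_nat G f x). Qed.

Lemma pi_nat (X Y : CH) (f : hom X Y) : pi Y \oc fmap RC (fmap IC f) = f \oc pi X.
Proof. by apply: C_eq => n x; exact (rpi_nat sHG f x). Qed.

Lemma Tr_ind (X Y : CH) (f : hom X Y) : Tr (eta Y \oc f \oc pi X) = fmap IC f.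
Proof. by rewrite eta_nat -compA Tr_compl Tr_eta_pi compm1. Qed.

Lemma pi_Tr (X : CG) (Y : CH) (f : hom (RC X) Y) :
  pi Y \oc fmap RC (Tr (eta Y \oc f : hom (RC X) (RC (IC Y)))) = f.
Proof.
apply: C_eq => n x.
exact (@rpi_rtr_reta k gT H G sHG (sval X) (sval Y)
  (fun n x => @ev k gT H (sval (RC X)) (sval Y) f n x) n x (is_map_ev f (subxx H))).
Qed.

Lemma Tr_eta (X : CH) (Y : CG) (f : hom X (RC Y)) :
  fmap RC (Tr (f \oc pi X : hom (RC (IC X)) (RC Y))) \oc eta X = f.
Proof.
apply: C_eq => n x.
exact (@rtr_rpi_reta k gT H G sHG (sval X) (sval Y)
  (fun n x => @ev k gT H (sval X) (sval (RC Y)) f n x) n x (is_map_ev f (subxx H))).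
Qed.

(** Up to the unit and the counit, Tr f is Ind f, and induction preserves negligible maps. *)
Lemma negligible_Tr (X Y : CG) (f : hom (RC X) (RC Y)) :
  negligible VH o f -> negligible V o (Tr f).
Proof.
move=> nf.
have -> : Tr f = Tr (pi (RC Y) : hom (RC (IC (RC Y))) (RC Y)) \oc
    (fmap IC f \oc Tr (eta (RC X) : hom (RC X) (RC (IC (RC X))))).
  rewrite -Tr_compr fmapM (compA (pi _)) pi_nat -compA.
  have E := pi_Tr (idm (RC X)); rewrite compm1 in E.
  by rewrite E compm1.
by apply: factors_compl; apply: factors_compr; apply: negligible_ind.
Qed.

Lemma jideal_Tr (U : {set {group gT}}) (X Y : CG) (f : hom (RC X) (RC Y)) :
  (forall Q, Q \in U -> Q \subset H) ->
  jideal VH o U f -> jideal V o U (Tr f).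
Proof.
move=> UH [t [q [tU nq fE]]].
exists (rtr G H (t : raw (sval X) (sval Y))), (Tr q); split.
- exact (@trsum_trans k gT H U G UH G (sval X) (sval Y) t (subxx G) sHG tU).
- exact: negligible_Tr.
- move=> n x; rewrite !evTr /rtr -(trD _ _ _ (subxx G) sHG).
  by apply: tr_ext => y; apply: fE.
Qed.

Lemma jideal_ind (U : {set {group gT}}) (X Y : CH) (f : hom X Y) :
  (forall Q, Q \in U -> Q \subset H) ->
  jideal VH o U f -> jideal V o U (fmap IC f).
Proof.
move=> UH jf; rewrite -Tr_ind; apply: jideal_Tr => //.
by apply: jideal_compr => //; apply: jideal_compl.
Qed.

Lemma trsum_mackey (A D : {group gT}) (U U' : {set {group gT}}) (X Y : cx k A)
    (t : raw X Y) (E : {group gT}) : D \subset A -> E \subset D ->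
  (forall P, P \in U -> P \subset D) -> (forall Q, Q \in U' -> Q \subset E) ->
  (forall (P : {group gT}) g, P \in U -> g \in D ->
     exists2 Q : {group gT}, Q \in U' & (E :&: P :^ g^-1)%g \subset Q) ->
  trsum D U t -> trsum E U' t.
Proof.
move=> DA ED UD U'E UU [tt ttP tE]; have EA := subset_trans ED DA.
apply: trsum_ext tE _; apply: trsum_sum => // P PU.
apply: (mackey EA U'E DA ED (UD P PU) (ttP P PU)) => //.
- by move=> h C hE; rewrite lcosets_lmul // (subsetP ED).
- by move=> g gD _; apply: UU.
Qed.

Lemma jideal_res (U U' : {set {group gT}}) (X Y : CG) (f : hom X Y) :
  (forall P, P \in U -> P \subset G) -> (forall Q, Q \in U' -> Q \subset H) ->
  (forall (P : {group gT}) g, P \in U -> g \in G ->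
     exists2 Q : {group gT}, Q \in U' & (H :&: P :^ g^-1)%g \subset Q) ->
  jideal V o U f -> jideal VH o U' (fmap RC f).
Proof.
move=> UG UH UU [t [q [tU nq fE]]]; exists t, (fmap RC q); split=> //.
- have := trsum_mackey (subxx G) sHG UG UH UU tU; exact.
- exact: negligible_res.
Qed.

End Transfer.

(** * Splitting idempotents modulo a trace ideal *)

Section IdempotentSplitting.
Variables (k : comPzRingType) (gT : finGroupType) (D : {group gT}).
Variables (V : kmod k D) (b : boundedness) (o : option seq_class).
Variable U : {set {group gT}}.
Hypothesis UD : forall Q, Q \in U -> Q \subset D.

Lemma negligible_seq (X Y : C_cat k D false b) (f : hom X Y) :
  negligible V o f -> negligible V o (seq_mor f).
Proof.
have h Z : killed V o Z -> killed V o (@seq_functor k gT D b Z).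
  rewrite /killed; case: o => [c|]; first exact: seq_E_projective.
  rewrite /zero_object => Z0.
  by have <- := fmap1 (@seq_functor k gT D b) Z; rewrite Z0 fmap0.
exact: (fmap_factors h).
Qed.

Lemma jobj_seq (X : C_cat k D false b) : jobj V o U X -> jobj V o U (seq_obj X).
Proof.
move=> [t [q [[tt ttP tE] nq xE]]].
exists (fun n => map_seq (@t n)), (seq_mor q); split.
- exists (fun P n => map_seq (@tt P n)) => [P PU|n x].
    by apply: is_map_map_seq (ttP P PU); apply: UD.
  apply: nthC_inj => i; rewrite nthC_sum nthC_map; last first.
    by have [] := trsum_is_map (subxx D) UD (ex_intro2 _ _ tt ttP tE).
  rewrite tE; apply: eq_bigr => P PU; have [lt _ _] := ttP P PU.
  rewrite -(map_seq_rtr _ (subxx D) (UD PU) (ttP P PU)) nthC_map //.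
  exact: tr_linear (subxx D) (UD PU) (lt n).
- exact: negligible_seq.
- move=> n x; apply: nthC_inj => i.
  rewrite -[LHS]/(ev (idm X) (nthC x i)) xE (linear_add (@nthC_linear _ _ _ _ _ _)).
  rewrite nthC_mor nthC_map //.
  by have [] := trsum_is_map (subxx D) UD (ex_intro2 _ _ tt ttP tE).
Qed.

Lemma quot_jobj_split fl : idem_split (quot (@jobj k gT D V fl b o U)).
Proof.
case: fl.
  apply: quot_idem_split_lift; try exact: C_biproducts; try exact: jobj_sum; try exact: C_idem_split.
  exact: fitting_lift.
apply: seq_swindle; first exact: jobj_seq.
exact: jobj_sum.
Qed.

Lemma jideal_split fl (M : C_cat k D fl b) (e : hom M M) :
  jideal V o U (e \oc e - e) ->
  exists (Z : C_cat k D fl b) (i : hom Z M) (p : hom M Z),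
    jideal V o U (i \oc p - e) /\ jideal V o U (p \oc i - idm Z).
Proof.
move=> ee; have eQ : @comp (quot (@jobj k gT D V fl b o U)) M M M (qp _ e) (qp _ e) = qp _ e.
  by rewrite -qpM; apply/quot_piP; apply: factors_jideal.
have [Z [i0 [p0 [pi ip]]]] := quot_jobj_split eQ.
have [i iE] := quot_lift i0; have [p pE] := quot_lift p0.
move: pi ip; rewrite -iE -pE => pi ip.
exists Z, i, p; split; apply: jideal_factors => //; apply/quot_piP.
  exact: etrans (qpM _ i p) ip.
exact: etrans (qpM _ p i) pi.
Qed.

End IdempotentSplitting.

(** * Intersections of conjugates in the two collections *)

Section Collections.
Variables (gT : finGroupType) (G H : {group gT}) (PP : {set {group gT}}).
Hypotheses (sHG : H \subset G) (PPH : forall P : {group gT}, P \in PP -> P \subset H).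
Local Notation XX := (coll_X G H PP).
Local Notation YY := (coll_Y G H PP).

Lemma coll_XP (Q : {group gT}) : reflect (exists P1 P2 g,
  [/\ P1 \in PP, P2 \in PP, g \in G :\: H & Q = (P1 :^ g^-1 :&: P2)%G])
  (Q \in XX).
Proof.
rewrite inE; apply: (iffP exists_inP) => [[P1 P1P]|[P1 [P2 [g [P1P P2P gGH ->]]]]].
  move=> /exists_inP[P2 P2P /exists_inP[g gGH /eqP ->]].
  by exists P1, P2, g.
by exists P1 => //; apply/exists_inP; exists P2 => //; apply/exists_inP; exists g.
Qed.

Lemma coll_YP (Q : {group gT}) : reflect (exists P g,
  [/\ P \in PP, g \in G :\: H & Q = (P :^ g^-1 :&: H)%G]) (Q \in YY).
Proof.
rewrite inE; apply: (iffP exists_inP) => [[P PP']|[P [g [PP' gGH ->]]]].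
  by move=> /exists_inP[g gGH /eqP ->]; exists P, g.
by exists P => //; apply/exists_inP; exists g.
Qed.

Lemma coll_X_sub Q : Q \in XX -> Q \subset H.
Proof.
move=> /coll_XP[P1 [P2 [g [_ P2P _ ->]]]].
by apply: subset_trans (PPH P2P); apply: subsetIr.
Qed.

Lemma coll_Y_sub Q : Q \in YY -> Q \subset H.
Proof. by move=> /coll_YP[P [g [_ _ ->]]]; apply: subsetIr. Qed.

Lemma coll_XPP Q : Q \in XX -> exists2 P : {group gT}, P \in PP & Q \subset P.
Proof.
by move=> /coll_XP[P1 [P2 [g [_ P2P _ ->]]]]; exists P2 => //; apply: subsetIr.
Qed.

Lemma coll_XY Q : Q \in XX -> exists2 P : {group gT}, P \in YY & Q \subset P.
Proof.
move=> /coll_XP[P1 [P2 [g [P1P P2P gGH ->]]]].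
exists (P1 :^ g^-1 :&: H)%G; last by apply: setIS; apply: PPH.
by apply/coll_YP; exists P1, g.
Qed.

Lemma setD_mull h g : h \in H -> g \in G :\: H -> (h * g)%g \in G :\: H.
Proof.
move=> hH /setDP[gG gH]; rewrite inE (groupMl _ hH) gH /=.
by apply: groupM => //; apply: (subsetP sHG).
Qed.

(** If Q = gP1g^-1 cap H with g outside H, then hg is outside H too, and P cap hQh^-1 lies in the
    member (hg)P1(hg)^-1 cap P of XX. *)
Lemma mackey_PY (P Q : {group gT}) h : P \in PP -> Q \in YY -> h \in H ->
  exists2 R : {group gT}, R \in [set R in XX | R \subset P] &
    (P :&: Q :^ h^-1)%g \subset R.
Proof.
move=> PP' /coll_YP[P1 [g [P1P gGH ->]]] hH.
exists (P1 :^ (h * g)^-1 :&: P)%G; last first.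
  by rewrite /= setIC setSI // conjIg invMg conjsgM subsetIl.
rewrite inE subsetIr andbT; apply/coll_XP.
by exists P1, P, (h * g)%g; split=> //; apply: setD_mull.
Qed.

(** Let Q = xP1x^-1 cap P2 with x outside H. If g is in H, then gx is outside H and P1 gives the
    member of YY; otherwise P2 does. *)
Lemma mackey_X (Q : {group gT}) g : Q \in XX -> g \in G ->
  exists2 R : {group gT}, R \in YY & (H :&: Q :^ g^-1)%g \subset R.
Proof.
move=> /coll_XP[P1 [P2 [x [P1P P2P xGH ->]]]] gG.
have [gH|gH] := boolP (g \in H).
  exists (P1 :^ (g * x)^-1 :&: H)%G; last first.
    by rewrite /= setIC setSI // conjIg invMg conjsgM subsetIl.
  by apply/coll_YP; exists P1, (g * x)%g; split=> //; apply: setD_mull.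
exists (P2 :^ g^-1 :&: H)%G; last by rewrite /= setIC setSI // conjIg subsetIr.
by apply/coll_YP; exists P2, g; rewrite inE gH.
Qed.

End Collections.

(** * Mackey's formula for the trace ideals *)

Section GreenIdeals.
Variables (k : comPzRingType) (gT : finGroupType) (G H : {group gT}).
Hypothesis sHG : H \subset G.
Variables (PP : {set {group gT}}).
Hypothesis PPH : forall P : {group gT}, P \in PP -> P \subset H.
Variables (V : kmod k G) (fl : bool) (b : boundedness) (o : option seq_class).
Local Notation VH := (resM sHG V).
Local Notation CG := (C_cat k G fl b).
Local Notation CH := (C_cat k H fl b).
Local Notation XX := (coll_X G H PP).
Local Notation YY := (coll_Y G H PP).
Local Notation jH := (jideal VH o).
Local Notation jG := (jideal V o).
Local Notation IC := (IC sHG V fl b o).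
Local Notation RC := (RC sHG V fl b o).
Local Notation Tr := (@Tr k gT G H sHG V fl b o _ _).
Let XXH := coll_X_sub (G := G) PPH.
Let YYH := @coll_Y_sub _ G H PP.

Lemma jideal_sub (U U' : {set {group gT}}) (X Y : CH) (f : hom X Y) :
  (forall Q, Q \in U' -> Q \subset H) ->
  (forall Q, Q \in U -> exists2 P : {group gT}, P \in U' & Q \subset P) ->
  jH U f -> jH U' f.
Proof.
move=> U'H UU [t [q [tU nq fE]]]; exists t, q; split=> //.
exact: (trsum_sub (subxx H) U'H UU tU).
Qed.

(** For h = Tr_P^H(u) one has gh = Tr_P^H(gu). As a P-map, g is a sum of traces from members of XX
    inside P, by Mackey's formula and [mackey_PY]; transitivity of traces does the rest. *)
Lemma jideal_YP (X Y Z : CH) (g : hom Y Z) (h : hom X Y) :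
  jH YY g -> jH PP h -> jH XX (g \oc h).
Proof.
move=> [t [q [tY nq gE]]] [u [r [[uu uuP uE] nr hE]]].
(* Only the product of the two trace parts needs work; the other terms are negligible. *)
have -> : g \oc h = (g \oc (h - r) - q \oc (h - r)) + (q \oc (h - r) + g \oc r).
  by rewrite addrA subrK -compDr subrK.
apply: jidealD => //; last first.
  by apply: jideal_negligible => //; apply: factors_add; [apply: factors_compr|apply: factors_compl].
apply: (@jideal_tr _ _ _ VH fl b o XX X Z _ (fun n x => \sum_(P in PP) t n (rtr H P (uu P) x))).
  apply: trsum_sum => // P PP'.
  have PH := PPH PP'.
  have tP : trsum P [set R in XX | R \subset P] t.
    apply: (trsum_mackey (subxx H) PH YYH _ _ tY).
      by move=> Q; rewrite inE => /andP[].
    by move=> Q g' QY gH; apply: mackey_PY.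
  have PXsub Q : Q \in [set R in XX | R \subset P] -> Q \subset P.
    by rewrite inE => /andP[].
  have tuP := trsum_compr PH PXsub (uuP P PP') tP.
  have PXX Q : Q \in [set R in XX | R \subset P] ->
      exists2 R : {group gT}, R \in XX & Q \subset R.
    by rewrite inE => /andP[QX _]; exists Q.
  have := trsum_sub (subxx H) XXH PXX (trsum_trans PXsub (subxx H) PH tuP).
  apply: trsum_ext => n x; have [lt et _] := trsum_is_map (subxx H) YYH tY.
  by rewrite /rtr (tr_compl _ _ (subxx H)).
move=> n x.
rewrite -[LHS]/(ev g (ev h x - ev r x) - ev q (ev h x - ev r x)) hE addrK gE addrK uE.
have [lt _ _] := trsum_is_map (subxx H) YYH tY.
exact: (lin_sum _ _ _ (lt n)).
Qed.

(** For z = Tr_P^H(t), Tr_H^G(z) is the sum over all of G/P and z is its part over H/P. The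
    remaining cosets gP have g outside H, and their stabilisers H cap gPg^-1 belong to YY. *)
Lemma Tr_outer (X Y : CG) (z : hom (RC X) (RC Y)) :
  jH PP z -> jH YY (fmap RC (Tr z) - z).
Proof.
move=> [t [q [[tt ttP tE] nq zE]]].
exists (fun n x => \sum_(P in PP) \sum_(C in lcosets P G :\: lcosets P H)
    conjt (@tt P n : sval X n -> sval Y n) (repr C) x), (fmap RC (Tr q) - q); split.
- apply: (@trsum_sum k gT H YY G sHG YYH (sval X) (sval Y)) => P PP'.
  have PH := PPH PP'; have PG := subset_trans PH sHG.
  apply: (mackey sHG YYH (subxx G) sHG PG (ttP P PP')).
  + exact: subsetDl.
  + move=> h C hH /setDP[CG CH]; rewrite inE !lcosets_lmul // ?CG ?CH //.
    exact: (subsetP sHG).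
  + move=> g gG /setDP[_ gPH]; exists (P :^ g^-1 :&: H)%G; last by rewrite /= setIC.
    apply/coll_YP; exists P, g; split=> //; rewrite inE gG andbT.
    by apply: contra gPH => gH; apply/lcosetsP; exists g.
- by apply: factors_add; [apply/negligible_res/negligible_Tr | apply: factors_opp].
- move=> n x; rewrite -[LHS]/(ev (Tr z) x - ev z x).
  rewrite -[ev (_ - q) x]/(ev (Tr q) x - ev q x).
  have -> : ev (Tr z) x = rtr G H (t : raw (sval X) (sval Y)) x + ev (Tr q) x.
    rewrite !evTr /rtr -(trD _ _ _ (subxx G) sHG).
    by apply: tr_ext => y; apply: zE.
  rewrite zE opprD addrACA; congr (_ + _).
  rewrite tE /rtr (@tr_ext k gT G G H (sval X n) (sval Y n) (@t n) _ x (tE n)).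
  rewrite tr_sum // -sumrB; apply: eq_bigr => P PP'.
  have PH := PPH PP'; have [_ et _] := ttP P PP'.
  rewrite [X in X - _](tr_trans _ (subxx G) sHG PH (et n)) {1}/tr.
  rewrite (big_setID (lcosets P H)) /= (setIidPr (lcosetsS P sHG)).
  by rewrite addrAC subrr add0r.
Qed.

(** As P lies in H, Tr_P^G = Tr_H^G Tr_P^H. *)
Lemma jideal_PP_Tr (X Y : CG) (f : hom X Y) : jG PP f ->
  exists2 e : hom (RC X) (RC Y), jH PP e & negligible V o (f - Tr e).
Proof.
move=> [t [q [[tt ttP tE] nq fE]]].
pose s : raw (sval (RC X)) (sval (RC Y)) := fun n x => \sum_(P in PP) rtr H P (tt P) x.
have sU : trsum H PP s by exists tt.
have hs := trsum_is_map (subxx H) PPH sU.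
exists (mkmap hs).
  exact: (@jideal_tr _ _ _ VH fl b o PP _ _ _ s sU).
have -> : f - Tr (mkmap hs) = q.
  apply: C_eq => n x; rewrite -[LHS]/(ev f x - ev (Tr (mkmap hs)) x) fE evTr.
  suff -> : t n x = rtr G H (s : raw (sval X) (sval Y)) x.
    by rewrite addrC addKr.
  rewrite tE /rtr tr_sum //; apply: eq_bigr => P PP'.
  have PH := PPH PP'; have [_ et _] := ttP P PP'.
  by rewrite [RHS](tr_trans _ (subxx G) sHG PH (et n)).
by [].
Qed.

Local Notation eta := (@eta k gT G H sHG V fl b o).
Local Notation pi := (@pi k gT G H sHG V fl b o).

(** [Tr_outer] is applied to z = [eta] after [pi]: its trace is the identity of Ind X, and it
    factors through the PP-projective X. *)
Lemma eta_pi_YY (X : CH) : jobj VH o PP X ->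
  jH YY (idm (RC (IC X)) - eta X \oc pi X).
Proof.
move=> jX; have := @Tr_outer (IC X) (IC X) (eta X \oc pi X).
rewrite Tr_eta_pi fmap1; apply; rewrite -[eta X]compm1.
by apply/jideal_compr/jideal_compl.
Qed.

Lemma jideal_YX (X Y : CH) (f : hom X Y) : jobj VH o PP X -> jH YY f -> jH XX f.
Proof. by move=> jX jf; rewrite -[f]compm1; apply: jideal_YP. Qed.

Lemma jideal_XX_PP (X Y : CH) (f : hom X Y) : jH XX f -> jH PP f.
Proof. by apply: jideal_sub => // Q; apply: coll_XPP. Qed.

Lemma jideal_XX_YY (X Y : CH) (f : hom X Y) : jH XX f -> jH YY f.
Proof. by apply: jideal_sub => // Q; apply: coll_XY. Qed.

(** The preimage is f = [pi] w [eta]. Since w is the trace of w [eta] [pi] and Ind f that of [eta] f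
    [pi], the difference is the trace of (1 - [eta] [pi]) w [eta] [pi]. The factor 1 - [eta] [pi] is
    in the YY ideal, and passing through the PP-projective X moves the product to the XX ideal. *)
Lemma ind_full (X Y : CH) (w : hom (IC X) (IC Y)) :
  jobj VH o PP X -> jobj VH o PP Y ->
  jG XX (w - fmap IC (pi Y \oc fmap RC w \oc eta X)).
Proof.
move=> jX jY.
have -> : w - fmap IC (pi Y \oc fmap RC w \oc eta X) =
    Tr ((idm _ - eta Y \oc pi Y) \oc fmap RC w \oc eta X \oc pi X).
  rewrite -[in LHS]Tr_ind !compBl comp1m TrD TrN -!compA Tr_compl Tr_eta_pi compm1.
  by [].
apply: jideal_Tr => //; apply: jideal_compr => //; apply: jideal_YX => //.
by do 2!apply: jideal_compr => //; apply: eta_pi_YY.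
Qed.

Lemma jideal_res_X (X Y : CG) (f : hom X Y) : jG XX f -> jH YY (fmap RC f).
Proof.
apply: jideal_res => //; first by move=> Q /XXH /subset_trans; apply.
by move=> Q g; apply: mackey_X.
Qed.

(** f is recovered as [pi] (Res Ind f) [eta]. Restriction takes the XX ideal to the YY ideal, and
    the PP-projective source improves YY to XX. *)
Lemma ind_faithful (X Y : CH) (f : hom X Y) : jobj VH o PP X ->
  jG XX (fmap IC f) -> jH XX f.
Proof.
move=> jX /jideal_res_X jf; apply: jideal_YX => //.
have -> : f = pi Y \oc fmap RC (fmap IC f) \oc eta X.
  by rewrite pi_nat -compA pi_eta compm1.
by apply: jideal_compr => //; apply: jideal_compl.
Qed.

(** e - e^2 = (1 - e)e lies in the XX ideal by [jideal_YP], so e splits modulo XX. *)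
Lemma split_PY (M : CH) (e : hom M M) : jH PP e -> jH YY (idm M - e) ->
  exists (Z : CH) (i : hom Z M) (p : hom M Z),
    [/\ jobj VH o PP Z, jH XX (i \oc p - e) & jH XX (p \oc i - idm Z)].
Proof.
move=> jP jY; have eX : jH XX (e \oc e - e).
  have -> : e \oc e - e = - ((idm M - e) \oc e).
    by rewrite compBl comp1m opprB.
  by apply: jidealN => //; apply: jideal_YP.
have [Z [i [p [ip pi]]]] := jideal_split XXH eX.
exists Z, i, p; split=> //.
(* Modulo XX the identity of Z is p(ip)i, hence pei, which is in the PP ideal because e is; and the
   XX ideal is contained in the PP ideal. *)
have E : idm Z = p \oc (e + (i \oc p - e)) \oc i -
    ((p \oc i - idm Z) \oc (p \oc i) + (p \oc i - idm Z)).
  rewrite [e + _]addrC subrK compBl comp1m -!compA.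
  by rewrite subrKA opprB addrC subrK.
rewrite /jobj E; apply: jidealD => //.
  apply/jideal_compr/jideal_compl => //; apply: jidealD => //.
  exact: jideal_XX_PP.
apply: jidealN => //; apply: jidealD => //; last exact: jideal_XX_PP.
by apply: jideal_compr => //; apply: jideal_XX_PP.
Qed.

End GreenIdeals.

(** * Subquotients *)

(** S is contained in P, so the objects factored through in A belong to the full subcategory. *)
Lemma factors_full_sub (A : category) (P S : A -> Prop) (X Y : full_sub P)
    (f : @hom A (sval X) (sval Y)) : (forall Z, S Z -> P Z) ->
  factors S f -> @factors (full_sub P) (fun Z => S (sval Z)) X Y f.
Proof.
move=> SP; elim=> [|g Z a c SZ _ IH]; first exact: (@factors0 (full_sub P)).
exact: (@factorsD (full_sub P) _ X Y g (exist _ Z (SP Z SZ)) a c SZ IH).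
Qed.

Lemma full_sub_factors (A : category) (P S : A -> Prop) (X Y : full_sub P)
    (f : @hom (full_sub P) X Y) :
  @factors (full_sub P) (fun Z => S (sval Z)) X Y f -> @factors A S (sval X) (sval Y) f.
Proof.
elim=> [|g Z a c SZ _ IH]; first exact: factors0.
exact: (@factorsD A S (sval X) (sval Y) g (sval Z) a c SZ IH).
Qed.

Section Subquotients.
Variables (A : category) (P S : A -> Prop).
Hypothesis SP : forall Z, S Z -> P Z.

Definition sq (X Y : full_sub P) (f : @hom A (sval X) (sval Y)) :
  @hom (subquot P S) X Y := @quot_pi (full_sub P) (fun Z => S (sval Z)) X Y f.

Lemma sq_lift (X Y : full_sub P) (u : @hom (subquot P S) X Y) :
  exists f, sq (X := X) (Y := Y) f = u.
Proof. by exists (quot_repr u); apply: quot_reprK. Qed.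

Lemma sq_eq (X Y : full_sub P) (f g : @hom A (sval X) (sval Y)) :
  sq (X := X) (Y := Y) f = sq (X := X) (Y := Y) g <-> factors S (f - g).
Proof.
split=> [/quot_piP|h]; first exact: full_sub_factors.
by apply/quot_piP; apply: factors_full_sub.
Qed.

Lemma sq0 (X Y : full_sub P) (f : @hom A (sval X) (sval Y)) :
  sq (X := X) (Y := Y) f = 0 <-> factors S f.
Proof.
split=> [/quot_pi0|h]; first exact: full_sub_factors.
by apply/quot_pi0; apply: factors_full_sub.
Qed.

Lemma sqM (X Y Z : full_sub P) (g : @hom A (sval Y) (sval Z))
    (f : @hom A (sval X) (sval Y)) :
  sq (X := X) (Y := Z) (g \oc f) =
  @comp (subquot P S) X Y Z (sq (X := Y) (Y := Z) g) (sq (X := X) (Y := Y) f).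
Proof. exact: esym (@quot_compE (full_sub P) _ X Y Z g f). Qed.

End Subquotients.

Lemma sq_fmap (A B : category) (F : functor A B) (P S : A -> Prop)
    (P' S' : B -> Prop) (hP : forall X, P X -> P' (F X))
    (hS : forall X, S X -> S' (F X)) (X Y : full_sub P)
    (f : @hom A (sval X) (sval Y)) :
  @fmap _ _ (subquot_functor hP hS) X Y (sq S (X := X) (Y := Y) f) =
  @sq B P' S' (full_sub_functor hP X) (full_sub_functor hP Y) (fmap F f).
Proof. exact (@quot_fmapE _ _ (full_sub_functor hP) _ _ (fun X => hS (sval X)) X Y f). Qed.

(** * The correspondence in abstract form *)

Section Green.
Variables (A B : category) (I : functor A B) (R : functor B A).
Variables (PA XA PYA YA : A -> Prop) (PB XB : B -> Prop).
Hypotheses (IP : forall X, PA X -> PB (I X)) (IX : forall X, XA X -> XB (I X)).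
Hypotheses (RP : forall X, PB X -> PYA (R X)) (RX : forall X, XB X -> YA (R X)).
Hypotheses (JP : forall X, PA X -> PYA (functor_id A X))
  (JX : forall X, XA X -> YA (functor_id A X)).
Hypotheses (XPA : forall X, XA X -> PA X) (XPB : forall X, XB X -> PB X)
  (YPA : forall X, YA X -> PYA X).
Hypothesis J_faithful : forall X Y (f : hom X Y), PA X -> factors YA f -> factors XA f.
Hypothesis J_ess : forall X, PYA X -> exists (Z : A) (i : hom Z X) (p : hom X Z),
  [/\ PA Z, factors YA (i \oc p - idm X) & factors YA (p \oc i - idm Z)].
Hypothesis I_full : forall X Y (w : hom (I X) (I Y)), PA X -> PA Y ->
  exists f : hom X Y, factors XB (fmap I f - w).
Hypothesis I_faithful : forall X Y (f : hom X Y), PA X ->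
  factors XB (fmap I f) -> factors XA f.
Hypothesis I_ess : forall X, PB X -> exists (Z : A) (i : hom (I Z) X) (p : hom X (I Z)),
  [/\ PA Z, factors XB (i \oc p - idm X) & factors XB (p \oc i - idm (I Z))].
Hypothesis unit : exists (e : forall X, hom X (R (I X))) (p : forall X, hom (R (I X)) X),
  [/\ forall X Y (f : hom X Y), fmap R (fmap I f) \oc e X = e Y \oc f,
      forall X, p X \oc e X = idm X
    & forall X, PA X -> factors YA (e X \oc p X - idm (R (I X)))].

Local Notation QH := (subquot PA XA).
Local Notation QG := (subquot PB XB).
Local Notation QY := (subquot PYA YA).
Local Notation IQ := (subquot_functor IP IX : functor QH QG).
Local Notation RQ := (subquot_functor RP RX : functor QG QY).
Local Notation J := (subquot_functor JP JX : functor QH QY).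

Lemma J_equivalence : is_equivalence J.
Proof.
apply: ff_es_equivalence.
- move=> X Y u; have [f <-] := sq_lift u.
  exists (@sq A PA XA X Y f); exact: (@sq_fmap _ _ (functor_id A)).
- move=> X Y u; have [f <-] := sq_lift u.
  rewrite [fmap _ _](@sq_fmap _ _ (functor_id A)) => /(sq0 YPA) Yf.
  by apply/(sq0 XPA); apply: J_faithful Yf; apply: (svalP X).
- move=> [X PX]; have [Z [i [p [PZ ip pi]]]] := J_ess PX.
  pose Z' : full_sub PA := exist _ Z PZ; exists Z'.
  pose JZ : full_sub PYA := full_sub_functor JP Z'; pose X' : full_sub PYA := exist _ X PX.
  have es : exists (u : @hom QY JZ X') (v : @hom QY X' JZ),
      @comp QY _ _ _ u v = @idm QY X' /\ @comp QY _ _ _ v u = @idm QY JZ.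
    exists (@sq A PYA YA JZ X' i), (@sq A PYA YA X' JZ p); split.
    apply: etrans (esym (sqM YA (X := X') (Y := JZ) (Z := X') i p)) _.
    exact/(sq_eq YPA).
  apply: etrans (esym (sqM YA (X := JZ) (Y := X') (Z := JZ) p i)) _.
  exact/(sq_eq YPA).
  exact: es.
Qed.

Lemma I_equivalence : exists R' : functor QG QH, inverse_equivalences IQ R'.
Proof.
apply: ff_es_equivalence.
- move=> X Y u; have [w <-] := sq_lift u.
  have [f fw] := I_full (w : hom (I (sval X)) (I (sval Y))) (svalP X) (svalP Y).
  exists (@sq A PA XA X Y f); rewrite [LHS](@sq_fmap _ _ I).
  exact/(sq_eq XPB).
- move=> X Y u; have [f <-] := sq_lift u.
  rewrite [fmap _ _](@sq_fmap _ _ I) => /(sq0 XPB) Xf.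
  by apply/(sq0 XPA); apply: I_faithful Xf; apply: (svalP X).
- move=> [X PX]; have [Z [i [p [PZ ip pi]]]] := I_ess PX.
  pose Z' : full_sub PA := exist _ Z PZ; exists Z'.
  pose IZ : full_sub PB := full_sub_functor IP Z'; pose X' : full_sub PB := exist _ X PX.
  have es : exists (u : @hom QG IZ X') (v : @hom QG X' IZ),
      @comp QG _ _ _ u v = @idm QG X' /\ @comp QG _ _ _ v u = @idm QG IZ.
    exists (@sq B PB XB IZ X' i), (@sq B PB XB X' IZ p); split.
    apply: etrans (esym (sqM XB (X := X') (Y := IZ) (Z := X') i p)) _.
    exact/(sq_eq XPB).
  apply: etrans (esym (sqM XB (X := IZ) (Y := X') (Z := IZ) p i)) _.
  exact/(sq_eq XPB).
  exact: es.
Qed.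

Lemma RI_iso_J : nat_iso (functor_comp RQ IQ) J.
Proof.
have [e [p [en pe ep]]] := unit.
pose JJ (X : full_sub PA) : full_sub PYA := full_sub_functor JP X.
pose RI (X : full_sub PA) : full_sub PYA :=
  full_sub_functor RP (full_sub_functor IP X).
pose a (X : QH) : hom (RQ (IQ X)) (J X) := @sq A PYA YA (RI X) (JJ X) (p (sval X)).
pose c (X : QH) : hom (J X) (RQ (IQ X)) := @sq A PYA YA (JJ X) (RI X) (e (sval X)).
have ca X : c X \oc a X = idm (RQ (IQ X)).
  apply: etrans (esym (sqM YA (X := RI X) (Y := JJ X) (Z := RI X) _ _)) _.
  by apply/(sq_eq YPA); apply: ep; apply: (svalP X).
have ac X : a X \oc c X = idm (J X).
  apply: etrans (esym (sqM YA (X := JJ X) (Y := RI X) (Z := JJ X) _ _)) _.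
  by rewrite pe.
have cn X Y (u : hom X Y) : fmap RQ (fmap IQ u) \oc c X = c Y \oc fmap J u.
  have [f <-] := sq_lift u.
  rewrite [fmap IQ _](@sq_fmap _ _ I) [fmap RQ _](@sq_fmap _ _ R).
  rewrite [fmap J _](@sq_fmap _ _ (functor_id A)).
  apply: etrans (esym (sqM YA (X := JJ X) (Y := RI X) (Z := RI Y) _ _)) _.
  apply: etrans (sqM YA (X := JJ X) (Y := JJ Y) (Z := RI Y) _ _).
  by congr sq; apply: en.
apply: nat_iso_sym; exists c, a; split=> // X Y u.
by rewrite cn.
Qed.

(** R' is a quasi-inverse of I, and J R' is isomorphic to Res I R' by [RI_iso_J], hence to Res. *)
Lemma green_abstract : is_equivalence J /\ exists R' : functor QG QH,
  nat_iso (functor_comp J R') RQ /\ inverse_equivalences IQ R'.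
Proof.
split; first exact: J_equivalence.
have [R' [RI IR]] := I_equivalence; exists R'; split; last by [].
apply: nat_iso_trans (nat_iso_compr R' (nat_iso_sym RI_iso_J)) _.
have [a [c [an ca ac]]] := nat_iso_compl RQ IR.
by exists a, c.
Qed.

End Green.

(** * The Green correspondence *)

Section DescendedFunctor.
Variables (k : comPzRingType) (gT : finGroupType) (D D' : {group gT}).
Variables (F : functor (Cpx (Mod k D)) (Cpx (Mod k D'))) (W : kmod k D) (W' : kmod k D').
Variables (fl : bool) (b : boundedness) (U U' : {set {group gT}}).
Hypotheses (UD : forall Q, Q \in U -> Q \subset D)
  (UD' : forall Q, Q \in U' -> Q \subset D').
Local Notation FC h := (full_sub_functor (descends_C h)).

(** [CK_cat] and [CK_functor] compute only once [o] is a constructor, hence the case split here and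
    in the next three lemmas. *)
Lemma CK_functor_rel o (h : descends F W W' fl b o) :
  (forall X, jobj W o U X -> jobj W' o U' (FC h X)) ->
  forall X : CK_cat W fl b o, rel_projective U X -> rel_projective U' (CK_functor h X).
Proof.
move: h; case: o => [c|] h hU X rX.
  apply: (@rel_projective_jobj _ _ _ W' fl b (Some c) U' UD' (FC h X)).
  apply: hU; exact: (@jobj_rel_projective _ _ _ W _ _ (Some c) U UD X rX).
apply: (@rel_projective_jobj _ _ _ W' fl b None U' UD' (FC h X)).
apply: hU; exact: (@jobj_rel_projective _ _ _ W _ _ None U UD X rX).
Qed.

Lemma CK_functor_full o (h : descends F W W' fl b o) :
  (forall X Y (w : hom (FC h X) (FC h Y)),
    jobj W o U X -> jobj W o U Y -> exists f : hom X Y,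
      jideal W' o U' (fmap (FC h) f - w)) ->
  forall (X Y : CK_cat W fl b o) (w : hom (CK_functor h X) (CK_functor h Y)),
    rel_projective U X -> rel_projective U Y -> exists f : hom X Y,
      factors (rel_projective U') (fmap (CK_functor h) f - w).
Proof.
move: h; case: o => [c|] h hU X Y w rX rY.
  have [w0 <-] := @kap_full _ _ _ W' fl b (Some c) (FC h X) (FC h Y) w.
  have jX := @jobj_rel_projective _ _ _ W _ _ (Some c) U UD X rX.
  have jY := @jobj_rel_projective _ _ _ W _ _ (Some c) U UD Y rY.
  have [f fw] := hU X Y w0 jX jY; exists (fmap (kap W fl b (Some c)) f).
  have -> : fmap (CK_functor h) (fmap (kap W fl b (Some c)) f) =
      fmap (kap W' fl b (Some c)) (fmap (FC h) f).
    exact (@quot_fmapE _ _ (FC h) _ _ (descends_K h erefl) X Y f).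
  have := proj2 (@factors_kap _ _ _ W' fl b (Some c) U' UD' _ _ _) fw.
  by rewrite fmapD fmapN.
have jX := @jobj_rel_projective _ _ _ W _ _ None U UD X rX.
have jY := @jobj_rel_projective _ _ _ W _ _ None U UD Y rY.
have [f fw] := hU X Y w jX jY; exists f.
exact: (proj2 (@factors_kap _ _ _ W' fl b None U' UD' _ _ _) fw).
Qed.

Lemma CK_functor_faithful o (h : descends F W W' fl b o) (U0 : {set {group gT}}) :
  (forall Q, Q \in U0 -> Q \subset D) ->
  (forall X Y (f : hom X Y), jobj W o U X ->
     jideal W' o U' (fmap (FC h) f) -> jideal W o U0 f) ->
  forall (X Y : CK_cat W fl b o) (f : hom X Y), rel_projective U X ->
    factors (rel_projective U') (fmap (CK_functor h) f) -> factors (rel_projective U0) f.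
Proof.
move=> U0D; move: h; case: o => [c|] h hU X Y f rX.
  have [f0 <-] := @kap_full _ _ _ W _ _ (Some c) X Y f.
  have jX := @jobj_rel_projective _ _ _ W _ _ (Some c) U UD X rX.
  have -> : fmap (CK_functor h) (fmap (kap W fl b (Some c)) f0) =
      fmap (kap W' fl b (Some c)) (fmap (FC h) f0).
    exact (@quot_fmapE _ _ (FC h) _ _ (descends_K h erefl) X Y f0).
  move=> /(proj1 (@factors_kap _ _ _ W' fl b (Some c) U' UD' _ _ _)) jf.
  by apply: (proj2 (@factors_kap _ _ _ W fl b (Some c) U0 U0D _ _ _)); apply: hU.
have jX := @jobj_rel_projective _ _ _ W _ _ None U UD X rX => Ff.
have jf := proj1 (@factors_kap _ _ _ W' fl b None U' UD' _ _ (fmap (FC h) f)) Ff.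
exact: (proj2 (@factors_kap _ _ _ W fl b None U0 U0D _ _ f) (hU X Y f jX jf)).
Qed.

Lemma CK_functor_ess o (h : descends F W W' fl b o) (U0 : {set {group gT}}) :
  (forall Q, Q \in U0 -> Q \subset D') ->
  (forall X, jobj W' o U0 X -> exists Z (i : hom (FC h Z) X)
     (p : hom X (FC h Z)),
     [/\ jobj W o U Z, jideal W' o U' (i \oc p - idm X) & jideal W' o U' (p \oc i - idm _)]) ->
  forall X : CK_cat W' fl b o, rel_projective U0 X ->
    exists (Z : CK_cat W fl b o) (i : hom (CK_functor h Z) X) (p : hom X (CK_functor h Z)),
     [/\ rel_projective U Z, factors (rel_projective U') (i \oc p - idm X)
       & factors (rel_projective U') (p \oc i - idm _)].
Proof.
move=> U0D; move: h; case: o => [c|] h hU X rX.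
  have jX := @jobj_rel_projective _ _ _ W' fl b (Some c) U0 U0D X rX.
  have [Z [i [p [jZ ip pi]]]] := hU X jX.
  exists Z, (fmap (kap W' fl b (Some c)) i), (fmap (kap W' fl b (Some c)) p); split.
  - exact: (@rel_projective_jobj _ _ _ W _ _ (Some c) U UD Z jZ).
  - have := proj2 (@factors_kap _ _ _ W' fl b (Some c) U' UD' _ _ _) ip.
    by rewrite fmapD fmapN fmapM fmap1.
  - have := proj2 (@factors_kap _ _ _ W' fl b (Some c) U' UD' _ _ _) pi.
    by rewrite fmapD fmapN fmapM fmap1.
have jX := @jobj_rel_projective _ _ _ W' fl b None U0 U0D X rX.
have [Z [i [p [jZ ip pi]]]] := hU X jX.
exists Z, i, p; split.
- exact: (@rel_projective_jobj _ _ _ W _ _ None U UD Z jZ).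
- exact: (proj2 (@factors_kap _ _ _ W' fl b None U' UD' _ _ _) ip).
- exact: (proj2 (@factors_kap _ _ _ W' fl b None U' UD' _ _ _) pi).
Qed.

End DescendedFunctor.

Section Green.
Variables (k : comPzRingType) (gT : finGroupType) (G H : {group gT}).
Hypothesis sHG : H \subset G.
Variables (PP : {set {group gT}}).
Hypothesis PPH : forall P : {group gT}, P \in PP -> P \subset H.
Variables (V : kmod k G) (fl : bool) (b : boundedness) (o : option seq_class).
Local Notation VH := (resM sHG V).
Local Notation CG := (C_cat k G fl b).
Local Notation CH := (C_cat k H fl b).
Local Notation XX := (coll_X G H PP).
Local Notation YY := (coll_Y G H PP).
Local Notation CKH := (CK_cat VH fl b o).
Local Notation IG := (IC sHG V fl b o).
Local Notation RH := (RC sHG V fl b o).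
Local Notation Ind := (CK_functor (hInd sHG V fl b o)).
Local Notation Res := (CK_functor (hRes sHG V fl b o)).
Let XXH := coll_X_sub (G := G) PPH.
Let YYH := @coll_Y_sub _ G H PP.

Lemma PYH Q : Q \in PP :|: YY -> Q \subset H.
Proof. by rewrite inE => /orP[/PPH|/YYH]. Qed.

Lemma PPG (Q : {group gT}) : Q \in PP -> Q \subset G.
Proof. by move=> /PPH /subset_trans; apply. Qed.

Lemma XXG (Q : {group gT}) : Q \in XX -> Q \subset G.
Proof. by move=> /XXH /subset_trans; apply. Qed.

Lemma jideal_P_PY (X Y : CH) (f : hom X Y) : jideal VH o PP f -> jideal VH o (PP :|: YY) f.
Proof.
apply: jideal_sub; first exact: PYH.
by move=> Q QP; exists Q; rewrite // inE QP.
Qed.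

Lemma jideal_Y_PY (X Y : CH) (f : hom X Y) : jideal VH o YY f -> jideal VH o (PP :|: YY) f.
Proof.
apply: jideal_sub; first exact: PYH.
by move=> Q QP; exists Q; rewrite // inE QP orbT.
Qed.

Lemma jideal_PY_split (X Y : CH) (f : hom X Y) : jideal VH o (PP :|: YY) f ->
  exists2 e, jideal VH o PP e & jideal VH o YY (f - e).
Proof.
move=> [t [q [[tt ttP tE] nq fE]]].
pose s : raw (sval X) (sval Y) := fun n x => \sum_(P in PP) rtr H P (tt P) x.
have sP : trsum H PP s by exists tt => // Q QP; apply: ttP; rewrite inE QP.
have hs := trsum_is_map (subxx H) PPH sP.
exists (mkmap hs); first exact: (@jideal_tr _ _ _ VH fl b o PP _ _ _ s sP).
(* Groups in both collections have already been counted in [s]. *)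
exists (fun n x => \sum_(P in (PP :|: YY) :\: PP) rtr H P (tt P) x), q; split=> //.
  apply: (trsum_sum (subxx H) YYH) => P /setDP[]; rewrite inE => /orP[->//|PY] _.
  by apply: trsum_tr => //; apply: ttP; rewrite inE PY orbT.
move=> n x; rewrite -[LHS]/(ev f x - s n x) fE tE (big_setID PP) /=.
by rewrite setUK addrAC [_ + _ - s n x]addrAC subrr add0r.
Qed.

(** The identity of X is Tr e up to a negligible map, and Tr e restricts to e plus a map in the YY
    ideal. *)
Lemma relP_res (X : CG) : jobj V o PP X ->
  jobj VH o (PP :|: YY) (RH X).
Proof.
move=> jX; have [e eP ne] := jideal_PP_Tr sHG PPH jX.
rewrite /jobj -fmap1 -(subrK (Tr e) (idm X)) fmapD.
apply: jidealD; first exact: PYH.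
  by apply: jideal_negligible; [exact: PYH | apply: negligible_res].
rewrite -(subrK e (fmap _ (Tr e))); apply: jidealD; first exact: PYH.
  by apply: jideal_Y_PY; apply: Tr_outer.
exact: jideal_P_PY.
Qed.

(** The PP part e of the identity of M differs from 1 by a map in the YY ideal, so the object split
    off by e is M modulo YY. *)
Lemma ess_Y (M : CH) : jobj VH o (PP :|: YY) M ->
  exists (Z : CH) (i : hom Z M) (p : hom M Z), [/\ jobj VH o PP Z,
    jideal VH o YY (i \oc p - idm M) & jideal VH o YY (p \oc i - idm Z)].
Proof.
move=> /jideal_PY_split[e eP eY].
have [Z [i [p [jZ ip pi]]]] := split_PY PPH eP eY.
exists Z, i, p; split=> //; last exact: jideal_XX_YY.
rewrite -(subrK e (i \oc p)) -addrA; apply: jidealD => //.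
  exact: jideal_XX_YY.
by rewrite -opprB; apply: jidealN.
Qed.

(** The identity of X is Tr e with e in the PP ideal, up to a negligible map. By [Tr_outer], e
    agrees with 1 on Res X modulo YY, so it splits off an object Z. The Frobenius transposes of i
    and pe are then inverse to each other, modulo XX, between Ind Z and X. *)
Lemma ess_G (X : CG) : jobj V o PP X ->
  exists (Z : CH) (i : hom (IG Z) X) (p : hom X (IG Z)),
  [/\ jobj VH o PP Z, jideal V o XX (i \oc p - idm X)
    & jideal V o XX (p \oc i - idm (IG Z))].
Proof.
move=> jX; have [e eP ne] := jideal_PP_Tr sHG PPH jX.
have eY : jideal VH o YY (idm (RH X) - e).
  rewrite -fmap1 -(subrK (Tr e) (idm X)) fmapD -addrA; apply: jidealD => //.
    by apply: jideal_negligible => //; apply: negligible_res.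
  exact: Tr_outer.
have [Z [i [p [jZ ip piZ]]]] := split_PY PPH eP eY.
pose a := @Tr k gT G H sHG V fl b o (IG Z) X (i \oc pi sHG V o Z).
pose c := @Tr k gT G H sHG V fl b o X (IG Z) (eta sHG V o Z \oc (p \oc e)).
have piX : jideal VH o XX (p \oc e \oc i - idm Z).
  have -> : p \oc e \oc i - idm Z = - (p \oc (i \oc p - e) \oc i) +
      ((p \oc i - idm Z) \oc (p \oc i) + (p \oc i - idm Z)).
    rewrite compBr !compBl comp1m -!compA subrKA opprB.
    by rewrite addrA subrK.
  apply: jidealD => //; first by apply/jidealN => //; apply/jideal_compr/jideal_compl.
  by apply: jidealD => //; apply: jideal_compr.
exists Z, a, c; split=> //.
(* By [pi_Tr] the composite is Tr(ipe), which is Tr e modulo XX. *)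
- have -> : a \oc c = Tr (i \oc (p \oc e)).
    by rewrite /a -Tr_compr -compA pi_Tr.
  rewrite -[idm X](subrK (Tr e)) opprD addrCA addrC -TrN -TrD; apply: jidealD; first exact: XXG.
    apply: jideal_Tr => //.
    have -> : i \oc (p \oc e) - e = (i \oc p - e) \oc e - (idm _ - e) \oc e.
      by rewrite -compBl opprB addrA subrK compBl comp1m compA.
    apply: jidealD => //; first exact: jideal_compr.
    by apply: jidealN => //; apply: jideal_YP.
  by apply: jideal_negligible; [exact: XXG | rewrite TrN; apply: factors_opp].
(* By [ind_full] the composite is, modulo XX, Ind of its transpose; the latter is pei, which is
   congruent to 1. *)
- rewrite -[c \oc a](subrK (fmap IG (pi sHG V o Z \oc
    fmap RH (c \oc a) \oc eta sHG V o Z))) -addrA.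
  apply: jidealD; first exact: XXG.
    exact: ind_full.
  rewrite -fmap1 -fmapN -fmapD; apply: jideal_ind => //.
  have -> : pi sHG V o Z \oc fmap RH (c \oc a) \oc eta sHG V o Z =
      p \oc e \oc i.
    by rewrite fmapM compA pi_Tr -compA Tr_eta.
  exact: piX.
Qed.

Lemma CK_unit : exists (e : forall X : CKH, hom X (Res (Ind X)))
    (p : forall X : CKH, hom (Res (Ind X)) X),
  [/\ forall (X Y : CKH) (f : hom X Y), fmap Res (fmap Ind f) \oc e X = e Y \oc f,
      forall X, p X \oc e X = idm X
    & forall X, rel_projective PP X ->
        factors (rel_projective YY) (e X \oc p X - idm (Res (Ind X)))].
Proof.
have ep o' (X : CH) : jobj VH o' PP X ->
    jideal VH o' YY (eta sHG V o' X \oc pi sHG V o' X - idm _).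
  by move=> jX; rewrite -opprB; apply: jidealN => //; apply: eta_pi_YY.
case: o => [c|].
  pose K := kap VH fl b (Some c).
  exists (fun X => fmap K (eta sHG V (Some c) X)), (fun X => fmap K (pi sHG V (Some c) X)).
  split=> [X Y f|X|X rX].
  - have [f0 <-] := @kap_full _ _ _ VH _ _ (Some c) X Y f.
    have -> : fmap (CK_functor (hRes sHG V fl b (Some c)))
        (fmap (CK_functor (hInd sHG V fl b (Some c))) (fmap K f0)) =
        fmap K (fmap (RC sHG V fl b (Some c)) (fmap (IC sHG V fl b (Some c)) f0)).
      rewrite [fmap (CK_functor (hInd _ _ _ _ _)) _](@quot_fmapE _ _ (IC sHG V fl b (Some c)) _ _
        (descends_K (hInd sHG V fl b (Some c)) erefl) X Y f0).
      exact (@quot_fmapE _ _ (RC sHG V fl b (Some c)) _ _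
        (descends_K (hRes sHG V fl b (Some c)) erefl) _ _ (fmap (IC sHG V fl b (Some c)) f0)).
    apply: etrans (esym (fmapM K _ _)) _; apply: etrans _ (fmapM K _ _).
    by rewrite -eta_nat.
  - apply: etrans (esym (fmapM K _ _)) _.
    by rewrite pi_eta.
  - have jX := @jobj_rel_projective _ _ _ VH _ _ (Some c) PP PPH X rX.
    have := proj2 (@factors_kap _ _ _ VH fl b (Some c) YY YYH _ _ _) (ep _ X jX).
    by rewrite fmapD fmapN fmapM fmap1.
exists (eta sHG V None), (pi sHG V None).
split=> [X Y f|X|X rX].
- by rewrite [RHS]eta_nat.
- exact: pi_eta.
- have jX := @jobj_rel_projective _ _ _ VH _ _ None PP PPH X rX.
  exact: (proj2 (@factors_kap _ _ _ VH fl b None YY YYH _ _ _) (ep _ X jX)).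
Qed.

Lemma rel_projective_sub (U U' : {set {group gT}}) (A : {group gT}) (W : kmod k A)
    (X : CK_cat W fl b o) :
  (forall Q, Q \in U' -> Q \subset A) -> (forall Q, Q \in U -> Q \subset A) ->
  (forall Q, Q \in U -> exists2 P : {group gT}, P \in U' & Q \subset P) ->
  rel_projective U X -> rel_projective U' X.
Proof.
move=> U'A UA UU; have [X0 ->] := kap_obj X.
move=> /(rel_projectiveP _ _ UA)[t [q [tU nq xE]]]; apply/(rel_projectiveP _ _ U'A).
exists t, q; split=> //; exact: (trsum_sub (subxx A) U'A UU tU).
Qed.

Lemma PPY Q : Q \in PP -> exists2 P : {group gT}, P \in PP :|: YY & Q \subset P.
Proof. by move=> QP; exists Q => //; rewrite inE QP. Qed.

Lemma YPY Q : Q \in YY -> exists2 P : {group gT}, P \in PP :|: YY & Q \subset P.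
Proof. by move=> QP; exists Q => //; rewrite inE QP orbT. Qed.

End Green.

(** Res also produces summands that come from conjugates of members of PP by elements outside H, so
    it lands in the quotient of the objects projective for PP and YY together by the YY-projectives.
    That J is an equivalence and J R is isomorphic to Res makes R the restriction with its
    YY-projective part discarded. *)
Theorem theorem8p2
  (k : comPzRingType) (gT : finGroupType) (G H : {group gT}) (sHG : H \subset G)
  (PP : {set {group gT}}) (PP0 : PP != set0)
  (PPH : forall P : {group gT}, P \in PP -> P \subset H)
  (V : kmod k G) (Vfg : finitely_generated V) (Vfree : free_module V)
  (fl : bool) (b : boundedness) (o : option seq_class) :
  let XX := coll_X G H PP in
  let YY := coll_Y G H PP in
  let CG := CK_cat V fl b o in
  let CH := CK_cat (resM sHG V) fl b o in
  exists (hInd : descends (cpx_functor (ind H G)) (resM sHG V) V fl b o)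
         (hRes : descends (cpx_functor (res k sHG)) V (resM sHG V) fl b o),
  let Ind : functor CH CG := CK_functor hInd in
  let Res : functor CG CH := CK_functor hRes in
  exists (IndP : forall X : CH, rel_projective PP X -> rel_projective PP (Ind X))
         (IndX : forall X : CH, rel_projective XX X -> rel_projective XX (Ind X))
         (ResP : forall X : CG, rel_projective PP X ->
                   rel_projective (PP :|: YY) (Res X))
         (ResX : forall X : CG, rel_projective XX X -> rel_projective YY (Res X))
         (JP : forall X : CH, rel_projective PP X ->
                   rel_projective (PP :|: YY) (functor_id CH X))
         (JX : forall X : CH, rel_projective XX X ->
                   rel_projective YY (functor_id CH X)),
  let QH : category := @subquot CH (rel_projective PP) (rel_projective XX) in
  let QG : category := @subquot CG (rel_projective PP) (rel_projective XX) in
  let QY : category :=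
    @subquot CH (rel_projective (PP :|: YY)) (rel_projective YY) in
  let I : functor QH QG := subquot_functor IndP IndX in
  let ResQ : functor QG QY := subquot_functor ResP ResX in
  let J : functor QH QY := subquot_functor JP JX in
  is_equivalence J /\
  exists R : functor QG QH,
    nat_iso (functor_comp J R) ResQ /\ inverse_equivalences I R.
Proof.
move=> XX YY CG CH; exists (hInd sHG V fl b o), (hRes sHG V fl b o) => Ind Res.
have XXH := coll_X_sub (G := G) PPH; have YYH := @coll_Y_sub _ G H PP.
have PYH := PYH (G := G) PPH; have PPG := PPG sHG PPH; have XXG := XXG sHG PPH.
have IndP : forall X : CH, rel_projective PP X -> rel_projective PP (Ind X).
  apply: CK_functor_rel => // X jX; rewrite /jobj -[idm _](fmap1 (IC sHG V fl b o)).
  exact: jideal_ind.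
have IndX : forall X : CH, rel_projective XX X -> rel_projective XX (Ind X).
  apply: CK_functor_rel => // X jX; rewrite /jobj -[idm _](fmap1 (IC sHG V fl b o)).
  exact: jideal_ind.
have ResP : forall X : CG, rel_projective PP X -> rel_projective (PP :|: YY) (Res X).
  by apply: CK_functor_rel => // X jX; apply: relP_res.
have ResX : forall X : CG, rel_projective XX X -> rel_projective YY (Res X).
  apply: CK_functor_rel => // X jX; rewrite /jobj -[idm _](fmap1 (RC sHG V fl b o)).
  exact: jideal_res_X.
have JP : forall X : CH, rel_projective PP X ->
    rel_projective (PP :|: YY) (functor_id CH X).
  by move=> X; apply: rel_projective_sub => // Q; apply: PPY.
have JX : forall X : CH, rel_projective XX X -> rel_projective YY (functor_id CH X).
  by move=> X; apply: rel_projective_sub => // Q; apply: coll_XY.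
exists IndP, IndX, ResP, ResX, JP, JX.
apply: green_abstract.
- by move=> X; apply: rel_projective_sub => // Q; apply: coll_XPP.
- by move=> X; apply: rel_projective_sub => // Q; apply: coll_XPP.
- by move=> X; apply: rel_projective_sub => // Q; apply: YPY.
- move=> X Y f; have [X0 XE] := kap_obj X; have [Y0 YE] := kap_obj Y.
  move: f; rewrite XE YE => f; have [f0 <-] := kap_full f.
  move=> /(rel_projectiveP _ _ PPH) jX /(factors_kap _ _ YYH) jf.
  by apply/(factors_kap _ _ XXH); apply: jideal_YX.
- move=> X; have [X0 ->] := kap_obj X => /(rel_projectiveP _ _ PYH) /(ess_Y PPH).
  move=> [Z [i [p [jZ ip piZ]]]].
  exists (kap (resM sHG V) fl b o Z), (fmap (kap (resM sHG V) fl b o) i), (fmap (kap (resM sHG V) fl b o) p).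
  split; first exact/(rel_projectiveP _ _ PPH).
    by rewrite -fmapM -fmap1 -fmapN -fmapD; apply/(factors_kap _ _ YYH).
  by rewrite -fmapM -fmap1 -fmapN -fmapD; apply/(factors_kap _ _ YYH).
- apply: CK_functor_full => // X Y w jX jY.
  exists (pi sHG V o Y \oc fmap (RC sHG V fl b o) w \oc eta sHG V o X).
  by rewrite -opprB; apply: jidealN => //; apply: ind_full.
- apply: CK_functor_faithful => // X Y f jX; exact: ind_faithful.
- by apply: CK_functor_ess => // X; apply: ess_G.
- exact: CK_unit.
Qed.
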